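(* Let $G$ be a finite group and let $f : k \rightarrow R$ and $g : R \rightarrow S$ be morphisms of $G$-Tambara functors. (1) If $S$ is finitely presented over $R$ and $R$ is finitely presented over $k$, then $S$ is finitely presented over $k$. (2) If $S$ is flat over $R$ and $R$ is flat over $k$, then $S$ is flat over $k$. (3) If $\Omega^{1,\mathrm{Tamb}}_{S/R} = 0$ and $\Omega^{1,\mathrm{Tamb}}_{R/k} = 0$, then $\Omega^{1,\mathrm{Tamb}}_{S/k} = 0$. Consequently the class of étale morphisms of Tambara functors is closed under composition.
   Context: Mackey, (commutative) Green and Tambara functors for a finite group $G$ have their standard meaning: a $G$-Tambara functor $k$ has commutative rings $k(X)$ for finite $G$-sets $X$, with restrictions $\mathrm{Res}$, transfers $\mathrm{Tr}$ and norms $\mathrm{Nm}$. A module over a Tambara functor is a module over its underlying Green functor. A $k$-algebra is a Tambara functor $R$ with a morphism $k \to R$. $\boxtimes_k$ is the relative box product over $k$. Étale. A $k$-module $M$ is flat if $M \boxtimes_k -$ is exact on $k$-modules. The free polynomial $k$-algebra on a generator in level $X$ ($X$ a finite $G$-set) is the $k$-algebra representing $R \mapsto R(X)$. A $k$-algebra is finitely presented if it is the coequalizer of a pair of maps between free polynomial $k$-algebras on finitely many generators. A Tambara ideal is the (levelwise) kernel of a morphism of Tambara functors. For a Tambara ideal $I$, $I^{>1}$ is the sub-ideal of $I$ generated by all nontrivial norms (including products) of elements of $I$: in level $G/H$ by $I(G/H)^2$ together with the images of all norms $I(G/K) \to I(G/H)$ for $K$ conjugate to a proper subgroup of $H$.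 For a $k$-algebra $R$ with $I = \ker(R \boxtimes_k R \to R)$ (multiplication), the genuine Kähler differentials are $\Omega^{1,\mathrm{Tamb}}_{R/k} := I/I^{>1}$. A morphism $k \to R$ is formally étale if $R$ is flat as a $k$-module and $\Omega^{1,\mathrm{Tamb}}_{R/k} = 0$; it is étale if it is moreover finitely presented. *)

(* Defs.v *)
From HB Require Import structures.
From mathcomp Require Import all_boot all_fingroup all_algebra.
From mathcomp Require Import boolp classical_sets.

Set Implicit Arguments.
Unset Strict Implicit.
Unset Printing Implicit Defensive.

Import GRing.Theory.
Local Open Scope ring_scope.

(* The finite group G is the finGroupType gT.  Following the library, G acts
   on the right of a finite G-set; g |-> g^-1 turns this into a left action. *)

Section FiniteGSets.
Variable gT : finGroupType.

Record gset := GSet {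
  gcar :> finType;
  gact : {action gT &-> gcar} }.

Record gmap (X Y : gset) := GMap {
  gfun :> X -> Y;
  gmapJ : forall (x : X) (a : gT), gfun (gact X x a) = gact Y (gfun x) a }.

Definition gid (X : gset) : gmap X X := @GMap X X id (fun (x : X) (a : gT) => erefl).

Lemma gcompJ (X Y Z : gset) (g : gmap Y Z) (f : gmap X Y) (x : X) (a : gT) :
  g (f (gact X x a)) = gact Z (g (f x)) a.
Proof. by rewrite !gmapJ. Qed.

Definition gcomp (X Y Z : gset) (g : gmap Y Z) (f : gmap X Y) : gmap X Z :=
  GMap (gcompJ g f).

(* Transitive finite G-sets are, up to isomorphism, the orbits G/H. *)
Definition gtransitive (X : gset) : bool :=
  [transitive [set: gT], on [set: X] | gact X].

Definition is_coproduct (X Y Z : gset) (i : gmap X Z) (j : gmap Y Z) : Prop :=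
  bijective (fun s : X + Y => match s with inl x => i x | inr y => j y end).

(*   P --b--> B
     |        |
     a        g
     v        v
     A --f--> C    *)
Definition is_pullback (P A B C : gset) (a : gmap P A) (b : gmap P B)
    (f : gmap A C) (g : gmap B C) : Prop :=
  (forall p : P, f (a p) = g (b p)) /\
  (forall (x : A) (y : B), f x = g y -> exists! p : P, a p = x /\ b p = y).

(*   X <--q-- A <--e-- Z
     |                 |
     f                 p
     v                 v
     Y <------pi------ W
   W is the dependent product of q along f: the fibre of pi over y is the set
   of the sections s of q over the fibre of f over y.  Z is the pullback of X
   and W over Y, and e is the evaluation (x, s) |-> s x.  As e, p and pi are
   equivariant, the action on W corresponds to conjugation of sections. *)
Definition is_exponential (A X Y Z W : gset) (q : gmap A X) (f : gmap X Y)
    (e : gmap Z A) (p : gmap Z W) (pi : gmap W Y) : Prop :=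
  is_pullback (gcomp q e) p f pi /\
  (forall (y : Y) (s : {x : X | f x == y} -> A),
    (forall x, q (s x) = val x) ->
    exists! w : W, pi w = y /\
      (forall (z : Z) (x : {x : X | f x == y}),
         p z = w -> q (e z) = val x -> e z = s x)).

End FiniteGSets.

Section MackeyGreenTambara.
Variable gT : finGroupType.
Local Notation gset := (gset gT).

Record mackey_axioms (M : gset -> zmodType)
    (res : forall X Y : gset, gmap X Y -> M Y -> M X)
    (tr : forall X Y : gset, gmap X Y -> M X -> M Y) : Prop := MackeyAxioms {
  res_id : forall (X : gset) (m : M X), res X X (gid X) m = m;
  res_comp : forall (X Y Z : gset) (g : gmap Y Z) (f : gmap X Y) (m : M Z),
    res X Z (gcomp g f) m = res X Y f (res Y Z g m);
  tr_id : forall (X : gset) (m : M X), tr X X (gid X) m = m;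
  tr_comp : forall (X Y Z : gset) (g : gmap Y Z) (f : gmap X Y) (m : M X),
    tr X Z (gcomp g f) m = tr Y Z g (tr X Y f m);
  res_tr : forall (P A B C : gset) (a : gmap P A) (b : gmap P B)
    (f : gmap A C) (g : gmap B C), is_pullback a b f g ->
    forall m : M A, res B C g (tr A C f m) = tr P B b (res P A a m);
  res_empty : forall X : gset, #|X| = 0%N -> forall m : M X, m = 0;
  res_coproduct : forall (X Y Z : gset) (i : gmap X Z) (j : gmap Y Z),
    is_coproduct i j ->
    bijective (fun m : M Z => (res X Z i m, res Y Z j m)) }.

Record mackey := Mackey {
  mobj :> gset -> zmodType;
  mres : forall X Y : gset, gmap X Y -> {additive mobj Y -> mobj X};
  mtr : forall X Y : gset, gmap X Y -> {additive mobj X -> mobj Y};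
  mackeyP : mackey_axioms (fun X Y f m => mres f m) (fun X Y f m => mtr f m) }.

(* Commutative Green functors.  The zero ring is allowed as a value. *)
Record green := Green {
  gobj :> gset -> comPzRingType;
  gres : forall X Y : gset, gmap X Y -> {rmorphism gobj Y -> gobj X};
  gtr : forall X Y : gset, gmap X Y -> {additive gobj X -> gobj Y};
  green_mackeyP :
    @mackey_axioms (fun X => gobj X)
      (fun X Y f m => gres f m) (fun X Y f m => gtr f m);
  frobenius : forall (X Y : gset) (f : gmap X Y) (x : gobj X) (y : gobj Y),
    gtr f (x * gres f y) = gtr f x * y }.

Definition green_mackey (k : green) : mackey :=
  @Mackey (fun X => k X) (fun X Y f => gres k f) (fun X Y f => gtr k f)
    (green_mackeyP k).

Record tambara := Tambara {
  tgreen :> green;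
  tnm : forall X Y : gset, gmap X Y -> tgreen X -> tgreen Y;
  nm_one : forall (X Y : gset) (f : gmap X Y), tnm f 1 = 1;
  nm_mul : forall (X Y : gset) (f : gmap X Y) (x x' : tgreen X),
    tnm f (x * x') = tnm f x * tnm f x';
  nm_id : forall (X : gset) (x : tgreen X), tnm (gid X) x = x;
  nm_comp : forall (X Y Z : gset) (g : gmap Y Z) (f : gmap X Y) (x : tgreen X),
    tnm (gcomp g f) x = tnm g (tnm f x);
  res_nm : forall (P A B C : gset) (a : gmap P A) (b : gmap P B)
    (f : gmap A C) (g : gmap B C), is_pullback a b f g ->
    forall x : tgreen A, gres tgreen g (tnm f x) = tnm b (gres tgreen a x);
  nm_tr : forall (A X Y Z W : gset) (q : gmap A X) (f : gmap X Y)
    (e : gmap Z A) (p : gmap Z W) (pi : gmap W Y), is_exponential q f e p pi ->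
    forall x : tgreen A,
      tnm f (gtr tgreen q x) = gtr tgreen pi (tnm p (gres tgreen e x)) }.

Record tmap (R S : tambara) := TMap {
  tmor :> forall X : gset, {rmorphism R X -> S X};
  tmap_res : forall (X Y : gset) (f : gmap X Y) (y : R Y),
    tmor X (gres R f y) = gres S f (tmor Y y);
  tmap_tr : forall (X Y : gset) (f : gmap X Y) (x : R X),
    tmor Y (gtr R f x) = gtr S f (tmor X x);
  tmap_nm : forall (X Y : gset) (f : gmap X Y) (x : R X),
    tmor Y (tnm f x) = tnm f (tmor X x) }.

Section TComp.
Variables (R S T : tambara) (g : tmap S T) (f : tmap R S).

Definition tcomp_mor (X : gset) : {rmorphism R X -> T X} := g X \o f X.

Lemma tcomp_res (X Y : gset) (u : gmap X Y) (y : R Y) :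
  tcomp_mor X (gres R u y) = gres T u (tcomp_mor Y y).
Proof. by rewrite /= !tmap_res. Qed.

Lemma tcomp_tr (X Y : gset) (u : gmap X Y) (x : R X) :
  tcomp_mor Y (gtr R u x) = gtr T u (tcomp_mor X x).
Proof. by rewrite /= !tmap_tr. Qed.

Lemma tcomp_nm (X Y : gset) (u : gmap X Y) (x : R X) :
  tcomp_mor Y (tnm u x) = tnm u (tcomp_mor X x).
Proof. by rewrite /= !tmap_nm. Qed.

Definition tcomp : tmap R T := TMap tcomp_res tcomp_tr tcomp_nm.
End TComp.

(* Modules over a Green functor k; for a Tambara functor k this applies to the
   underlying Green functor through the coercion tgreen. *)
Record kmodule (k : green) := KModule {
  kmod :> mackey;
  kact : forall X : gset, k X -> kmod X -> kmod X;
  kactDl : forall (X : gset) (c d : k X) (m : kmod X),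
    kact (c + d) m = kact c m + kact d m;
  kactDr : forall (X : gset) (c : k X) (m n : kmod X),
    kact c (m + n) = kact c m + kact c n;
  kact1 : forall (X : gset) (m : kmod X), kact 1 m = m;
  kactM : forall (X : gset) (c d : k X) (m : kmod X),
    kact (c * d) m = kact c (kact d m);
  res_kact : forall (X Y : gset) (f : gmap X Y) (c : k Y) (m : kmod Y),
    mres kmod f (kact c m) = kact (gres k f c) (mres kmod f m);
  tr_kactl : forall (X Y : gset) (f : gmap X Y) (c : k Y) (m : kmod X),
    mtr kmod f (kact (gres k f c) m) = kact c (mtr kmod f m);
  tr_kactr : forall (X Y : gset) (f : gmap X Y) (c : k X) (m : kmod Y),
    mtr kmod f (kact c (mres kmod f m)) = kact (gtr k f c) m }.

Record kmap (k : green) (M N : kmodule k) := KMap {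
  kmor :> forall X : gset, {additive M X -> N X};
  kmap_res : forall (X Y : gset) (f : gmap X Y) (m : M Y),
    kmor X (mres M f m) = mres N f (kmor Y m);
  kmap_tr : forall (X Y : gset) (f : gmap X Y) (m : M X),
    kmor Y (mtr M f m) = mtr N f (kmor X m);
  kmap_act : forall (X : gset) (c : k X) (m : M X),
    kmor X (kact c m) = kact c (kmor X m) }.

Section AlgebraAsModule.
Variables (k R : tambara) (f : tmap k R).
Let act (X : gset) (c : k X) (x : green_mackey R X) : green_mackey R X :=
  (f X c : R X) * (x : R X).

Lemma alg_actDl (X : gset) (c d : k X) (m : green_mackey R X) :
  act (c + d) m = act c m + act d m.
Proof. by rewrite /act rmorphD mulrDl. Qed.

Lemma alg_actDr (X : gset) (c : k X) (m n : green_mackey R X) :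
  act c (m + n) = act c m + act c n.
Proof. by rewrite /act mulrDr. Qed.

Lemma alg_act1 (X : gset) (m : green_mackey R X) : act 1 m = m.
Proof. by rewrite /act rmorph1 mul1r. Qed.

Lemma alg_actM (X : gset) (c d : k X) (m : green_mackey R X) :
  act (c * d) m = act c (act d m).
Proof. by rewrite /act rmorphM mulrA. Qed.

Lemma alg_res_act (X Y : gset) (u : gmap X Y) (c : k Y)
    (m : green_mackey R Y) :
  mres (green_mackey R) u (act c m) =
    act (gres k u c) (mres (green_mackey R) u m).
Proof. by rewrite /act /= rmorphM tmap_res. Qed.

Lemma alg_tr_actl (X Y : gset) (u : gmap X Y) (c : k Y)
    (m : green_mackey R X) :
  mtr (green_mackey R) u (act (gres k u c) m) =
    act c (mtr (green_mackey R) u m).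
Proof. by rewrite /act /= tmap_res mulrC frobenius mulrC. Qed.

Lemma alg_tr_actr (X Y : gset) (u : gmap X Y) (c : k X)
    (m : green_mackey R Y) :
  mtr (green_mackey R) u (act c (mres (green_mackey R) u m)) =
    act (gtr k u c) m.
Proof. by rewrite /act /= tmap_tr frobenius. Qed.

Definition alg_module : kmodule k :=
  KModule alg_actDl alg_actDr alg_act1 alg_actM
          alg_res_act alg_tr_actl alg_tr_actr.
End AlgebraAsModule.

End MackeyGreenTambara.

Section RelativeBoxProduct.
Variable gT : finGroupType.
Local Notation gset := (gset gT).
Variable k : green gT.

(* k-bilinear Dress pairings, i.e. levelwise data for a k-balanced map from the
   box product of the underlying Mackey functors of M and N to P. *)
Record is_pairing (M N P : kmodule k)
    (t : forall X : gset, M X -> N X -> P X) : Prop := IsPairing {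
  pairDl : forall (X : gset) (m m' : M X) (n : N X),
    t X (m + m') n = t X m n + t X m' n;
  pairDr : forall (X : gset) (m : M X) (n n' : N X),
    t X m (n + n') = t X m n + t X m n';
  pair_actl : forall (X : gset) (c : k X) (m : M X) (n : N X),
    t X (kact c m) n = kact c (t X m n);
  pair_actr : forall (X : gset) (c : k X) (m : M X) (n : N X),
    t X m (kact c n) = kact c (t X m n);
  pair_res : forall (X Y : gset) (f : gmap X Y) (m : M Y) (n : N Y),
    t X (mres M f m) (mres N f n) = mres P f (t Y m n);
  pair_trl : forall (X Y : gset) (f : gmap X Y) (m : M X) (n : N Y),
    t Y (mtr M f m) n = mtr P f (t X m (mres N f n));
  pair_trr : forall (X Y : gset) (f : gmap X Y) (m : M Y) (n : N X),
    t Y m (mtr N f n) = mtr P f (t X (mres M f m) n) }.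

(* The relative box product of M and N over k is the target of the universal
   k-bilinear pairing; it is unique up to a unique isomorphism. *)
Definition is_box (M N P : kmodule k)
    (t : forall X : gset, M X -> N X -> P X) : Prop :=
  is_pairing t /\
  (forall (Q : kmodule k) (u : forall X : gset, M X -> N X -> Q X),
    is_pairing u ->
    exists h : kmap P Q,
      (forall (X : gset) (m : M X) (n : N X), h X (t X m n) = u X m n) /\
      (forall h' : kmap P Q,
        (forall (X : gset) (m : M X) (n : N X), h' X (t X m n) = u X m n) ->
        forall (X : gset) (p : P X), h' X p = h X p)).

Record box_product (M N : kmodule k) := BoxProduct {
  box :> kmodule k;
  box_pair : forall X : gset, M X -> N X -> box X;
  box_univ : is_box box_pair }.

Definition short_exact (A B C : kmodule k) (u : kmap A B) (v : kmap B C) :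
    Prop :=
  forall X : gset,
    [/\ injective (u X),
        (forall b : B X, v X b = 0 <-> exists a : A X, u X a = b)
      & (forall c : C X, exists b : B X, v X b = c)].

(* w is the map induced by u : N -> N' on box products with M. *)
Definition box_induced (M N N' : kmodule k) (u : kmap N N')
    (P : box_product M N) (P' : box_product M N') (w : kmap P P') : Prop :=
  forall (X : gset) (m : M X) (n : N X),
    w X (box_pair P m n) = box_pair P' m (u X n).

Definition flat_module (M : kmodule k) : Prop :=
  forall (A B C : kmodule k) (u : kmap A B) (v : kmap B C),
    short_exact u v ->
    forall (MA : box_product M A) (MB : box_product M B)
           (MC : box_product M C) (Mu : kmap MA MB) (Mv : kmap MB MC),
      box_induced u Mu -> box_induced v Mv -> short_exact Mu Mv.

End RelativeBoxProduct.

Section FinitePresentation.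
Variable gT : finGroupType.
Local Notation gset := (gset gT).
Variable k : tambara gT.

Record talgebra := TAlgebra {
  aobj :> tambara gT;
  astr : tmap k aobj }.

Record ahom (A B : talgebra) := AHom {
  ahom_map :> tmap A B;
  ahom_str : forall (X : gset) (c : k X),
    ahom_map X (astr A X c) = astr B X c }.

(* P, with the universal elements x i, represents
   A |-> A (Y 0) * ... * A (Y (n-1)). *)
Definition is_free_talgebra (n : nat) (Y : 'I_n -> gset) (P : talgebra)
    (x : forall i : 'I_n, P (Y i)) : Prop :=
  forall (A : talgebra) (a : forall i : 'I_n, A (Y i)),
    exists h : ahom P A,
      (forall i : 'I_n, h (Y i) (x i) = a i) /\
      (forall h' : ahom P A, (forall i : 'I_n, h' (Y i) (x i) = a i) ->
        forall (X : gset) (p : P X), h' X p = h X p).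

Definition is_coequalizer (Q P A : talgebra) (a b : ahom Q P) (c : ahom P A) :
    Prop :=
  (forall (X : gset) (q : Q X), c X (a X q) = c X (b X q)) /\
  (forall (B : talgebra) (h : ahom P B),
    (forall (X : gset) (q : Q X), h X (a X q) = h X (b X q)) ->
    exists h' : ahom A B,
      (forall (X : gset) (p : P X), h' X (c X p) = h X p) /\
      (forall h'' : ahom A B,
        (forall (X : gset) (p : P X), h'' X (c X p) = h X p) ->
        forall (X : gset) (x : A X), h'' X x = h' X x)).

Definition finitely_presented_talgebra (A : talgebra) : Prop :=
  exists (n : nat) (Y : 'I_n -> gset) (P : talgebra)
         (y : forall i : 'I_n, P (Y i))
         (m : nat) (Z : 'I_m -> gset) (Q : talgebra)
         (z : forall i : 'I_m, Q (Z i))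
         (a b : ahom Q P) (c : ahom P A),
    [/\ is_free_talgebra y, is_free_talgebra z & is_coequalizer a b c].

End FinitePresentation.

Section KahlerDifferentials.
Variable gT : finGroupType.
Local Notation gset := (gset gT).
Local Open Scope classical_set_scope.

Definition family (T : tambara gT) := forall X : gset, set (T X).

Definition tkernel (T U : tambara gT) (h : tmap T U) : family T :=
  fun X => [set x | h X x = 0].
Arguments tkernel [T U] h X.

Definition is_tambara_ideal (T : tambara gT) (J : family T) : Prop :=
  exists (U : tambara gT) (h : tmap T U), forall X : gset, J X = tkernel h X.

(* In an orbit level Y = G/H: products of two elements of I, and norms of
   elements of I along maps f : G/K -> G/H.  For orbits, f is not injective
   exactly when K is conjugate to a proper subgroup of H. *)
Inductive nontrivial_norm (T : tambara gT) (I : family T) (Y : gset) :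
    T Y -> Prop :=
| NormProduct (x y : T Y) of gtransitive Y & I Y x & I Y y :
    nontrivial_norm I (x * y)
| NormProper (X : gset) (f : gmap X Y) (x : T X)
    of gtransitive X & gtransitive Y & ~ injective f & I X x :
    nontrivial_norm I (tnm f x).

(* I^{>1}: the Tambara ideal generated by the nontrivial norms. *)
Definition ideal_gt1 (T : tambara gT) (I : family T) : family T :=
  fun X => [set x | forall J : family T, is_tambara_ideal J ->
    (forall (Y : gset) (y : T Y), nontrivial_norm I y -> J Y y) -> J X x].
Arguments ideal_gt1 [T] I X.

(* R box_k R as a Tambara functor: a Tambara functor with two maps from R, the
   coprojections x |-> x (x) 1 and y |-> 1 (x) y, whose underlying k-module is
   the relative box product with x (x) y = (x (x) 1) * (1 (x) y).  This
   determines the norms.  sbox_mul is the multiplication map. *)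
Record self_box (k R : tambara gT) (f : tmap k R) := SelfBox {
  sbox :> tambara gT;
  sbox_l : tmap R sbox;
  sbox_r : tmap R sbox;
  sbox_box : @is_box gT k (alg_module f) (alg_module f)
    (alg_module (tcomp sbox_l f))
    (fun (X : gset) (x y : R X) => sbox_l X x * sbox_r X y);
  sbox_mul : tmap sbox R;
  sbox_mulE : forall (X : gset) (x y : R X),
    sbox_mul X (sbox_l X x * sbox_r X y) = x * y }.

Definition mul_ideal (k R : tambara gT) (f : tmap k R) (B : self_box f) :
  family B := tkernel (sbox_mul B).
Arguments mul_ideal [k R f] B X.

Section Omega.
Variables (k R : tambara gT) (f : tmap k R) (B : self_box f).

Definition kahler_class (X : gset) (x : B X) : set (B X) :=
  [set y | ideal_gt1 (mul_ideal B) X (y - x)].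

(* The quotient I/I^{>1}, as the set of the cosets of I^{>1} in I. *)
Definition kahler (X : gset) : set (set (B X)) :=
  [set kahler_class x | x in mul_ideal B X].
End Omega.
Arguments kahler [k R f] B X.

(* A self_box f is unique up to a unique isomorphism compatible with sbox_l and
   sbox_r, so the choice of B below is immaterial; likewise for box_product in
   flat_module. *)
Definition kahler_zero (k R : tambara gT) (f : tmap k R) : Prop :=
  forall (B : self_box f) (X : gset), kahler B X = [set kahler_class (0 : B X)].

End KahlerDifferentials.

Section Etale.
Variable gT : finGroupType.
Variables (k R : tambara gT) (f : tmap k R).

Definition finitely_presented : Prop :=
  finitely_presented_talgebra (TAlgebra f).

Definition flat : Prop := flat_module (alg_module f).

Definition formally_etale : Prop := flat /\ kahler_zero f.

Definition etale : Prop := formally_etale /\ finitely_presented.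

End Etale.

(* Main.v *)
From HB Require Import structures.
From mathcomp Require Import all_boot all_fingroup all_algebra.
From mathcomp Require Import boolp classical_sets.
Require Import Defs.

(* (1) Presentations of R over k and of S over R combine to one of S over k:
   the generators of S over k are those of R and of S, and the relators of S
   over R are lifted along the map k[Y0, Y1] -> R[Y1], which is onto because
   coequalizer maps are onto.

   (2) S (x)_k N = S (x)_R (R (x)_k N), where R (x)_k N carries its R-module
   structure.

   (3) Vanishing differentials mean that k -> R is formally unramified: maps
   a, b : R -> U that agree on k are equal as soon as the image in U of the
   kernel of R (x)_k R -> R has vanishing nontrivial norms.  Given a quotient
   U of S (x)_k S by an ideal containing the nontrivial norms, apply this to
   the two maps S -> U first on R over k, then on S over R.

   Both (2) and (3) rest on a construction of the box product, which for
   R (x)_k R has to carry norms, as otherwise the hypotheses on differentials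
   would be vacuous.  Its elements are classes of single transferred tensors
   tr_q (x (x) y), and the norm of such an element is given by an exponential
   diagram. *)

Set Implicit Arguments.
Unset Strict Implicit.
Unset Printing Implicit Defensive.

Import GRing.Theory.
Local Open Scope ring_scope.

(** * Finite G-sets *)

Section GSets.
Variable gT : finGroupType.
Local Notation gset := (gset gT).
Implicit Types A B C P V X Y Z W : gset.

(** A Tambara ideal is by definition the kernel of a morphism, so belonging to I^{>1} means being
    killed by every morphism that kills the nontrivial norms; no quotient functor has to be formed.
    Flatness speaks of arbitrary box products, which universality compares with the constructed
    ones.

    In (1), freeness and coequalizers are bare universal properties among k-algebras and say nothing
    about elements. That free algebras are generated by their generators, and that coequalizer maps
    are onto, is obtained from the subalgebra F generated by the relevant elements: a map into F
    followed by the inclusion is the identity by uniqueness, so the inclusion is onto. The free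
    algebra on the combined generators and the subalgebra F come from one construction: formal terms
    modulo equality of values in a class of models. The Tambara axioms hold in the quotient because
    they hold in every model, so no normal form for terms is required. *)

Lemma gmap_ext X Y (f g : gmap X Y) : (forall x, f x = g x) -> f = g.
Proof.
case: f g => [f fJ] [g gJ] /= fg; have {}fg : f = g by apply: funext.
by case: _ / fg in gJ *; rewrite (Prop_irrelevance fJ gJ).
Qed.

Lemma gmap_app X Y (f g : gmap X Y) : f = g -> forall x, f x = g x.
Proof. by move=> ->. Qed.

Lemma gcomp_idl X Y (f : gmap X Y) : gcomp (gid Y) f = f.
Proof. exact: gmap_ext. Qed.

Lemma gcomp_idr X Y (f : gmap X Y) : gcomp f (gid X) = f.
Proof. exact: gmap_ext. Qed.

Lemma gcompA X Y Z W (h : gmap Z W) (g : gmap Y Z) (f : gmap X Y) :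
  gcomp h (gcomp g f) = gcomp (gcomp h g) f.
Proof. exact: gmap_ext. Qed.

Definition gset_of (T : finType) (to : T -> gT -> T)
    (to1 : forall x, to x 1%g = x)
    (toM : forall x a b, to x (a * b)%g = to (to x a) b) : gset :=
  @GSet gT T (TotalAction to1 toM).

Lemma gact1 X (x : X) : gact X x 1%g = x.
Proof. exact: act1. Qed.

Lemma gactM X (x : X) a b : gact X x (a * b)%g = gact X (gact X x a) b.
Proof. exact: actM. Qed.

(** Equivariance of the chosen function is a consequence of uniqueness. This is the passage from
    pointwise universal properties, such as those of pullbacks and exponentials, to equivariant
    maps. *)
Lemma gmap_choice X Y (R : X -> Y -> Prop) :
    (forall x, exists! y, R x y) ->
    (forall x y a, R x y -> R (gact X x a) (gact Y y a)) ->
  exists f : gmap X Y, forall x, R x (f x).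
Proof.
move=> R1 RJ; pose f x := projT1 (cid (R1 x)).
have fP x : R x (f x) by rewrite /f; case: cid => y [].
have fU x y : R x y -> f x = y by rewrite /f; case: cid => z [_ zU] /= /zU.
have fJ x a : f (gact X x a) = gact Y (f x) a by apply: fU; exact: RJ.
by exists (GMap fJ).
Qed.

Definition gbij X Y (h : gmap X Y) := forall y, exists! x, h x = y.

Lemma gbij_inj X Y (h : gmap X Y) : gbij h -> injective h.
Proof.
by move=> hb x x' e; have [z [_ zU]] := hb (h x'); rewrite -(zU x) // (zU x').
Qed.

Lemma bij_gbij X Y (h : gmap X Y) : bijective h -> gbij h.
Proof.
by move=> [g hK gK] y; exists (g y); split=> [|x <-]; rewrite ?gK ?hK.
Qed.

(** * Pullbacks of finite G-sets *)

Section Pullback.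
Variables (A B C : gset) (f : gmap A C) (g : gmap B C).
Let T : finType := {u : A * B | f u.1 == g u.2}.

Lemma pb_act_subproof (u : T) a :
  f (gact A (val u).1 a) == g (gact B (val u).2 a).
Proof. by case: u => -[x y] /= /eqP e; rewrite !gmapJ e. Qed.

Let act (u : T) a : T := exist _ (gact A (val u).1 a, gact B (val u).2 a)
  (pb_act_subproof u a).

Lemma pb_act1_subproof u : act u 1%g = u.
Proof. by apply: val_inj; case: u => -[x y] e /=; rewrite !gact1. Qed.

Lemma pb_actM_subproof u a b : act u (a * b)%g = act (act u a) b.
Proof. by apply: val_inj; case: u => -[x y] e /=; rewrite !gactM. Qed.

Definition pb : gset := gset_of pb_act1_subproof pb_actM_subproof.

Definition pb1 : gmap pb A :=
  @GMap gT pb A (fun u : T => (val u).1) (fun _ _ => erefl).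
Definition pb2 : gmap pb B :=
  @GMap gT pb B (fun u : T => (val u).2) (fun _ _ => erefl).

Lemma pbP : is_pullback pb1 pb2 f g.
Proof.
split=> [[u /eqP //]|x y e].
have e' : f (x, y).1 == g (x, y).2 by apply/eqP.
exists (exist _ (x, y) e' : T); split=> // -[[x' y'] e2] /= [] ex ey.
by apply: val_inj; rewrite /= ex ey.
Qed.

End Pullback.

Lemma pb_ext P A B C (a : gmap P A) (b : gmap P B) (f : gmap A C)
    (g : gmap B C) : is_pullback a b f g ->
  forall u v, a u = a v -> b u = b v -> u = v.
Proof.
case=> com uni u v ea eb; have [w [_ wU]] := uni _ _ (com v).
by rewrite -(wU u) // (wU v).
Qed.

Lemma pb_ex P A B C (a : gmap P A) (b : gmap P B) (f : gmap A C)
    (g : gmap B C) : is_pullback a b f g ->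
  forall x y, f x = g y -> exists u, a u = x /\ b u = y.
Proof. by case=> _ uni x y /uni[u [? _]]; exists u. Qed.

Lemma is_pullbackI P A B C (a : gmap P A) (b : gmap P B) (f : gmap A C)
    (g : gmap B C) :
    (forall u, f (a u) = g (b u)) ->
    (forall u v, a u = a v -> b u = b v -> u = v) ->
    (forall x y, f x = g y -> exists u, a u = x /\ b u = y) ->
  is_pullback a b f g.
Proof.
move=> com ext ex; split=> // x y /ex[u [ax by_]].
by exists u; split=> // v [av bv]; apply: ext; congruence.
Qed.

Lemma is_pullback_sym P A B C (a : gmap P A) (b : gmap P B) (f : gmap A C)
    (g : gmap B C) : is_pullback a b f g -> is_pullback b a g f.
Proof.
move=> pP; apply: is_pullbackI => [u|u v e1 e2|x y e].
- by case: pP => ->.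
- exact: pb_ext pP _ _ e2 e1.
- by have [u [? ?]] := pb_ex pP (esym e); exists u.
Qed.

Lemma pb_lift P A B C V (a : gmap P A) (b : gmap P B) (f : gmap A C)
    (g : gmap B C) (u : gmap V A) (v : gmap V B) :
    is_pullback a b f g -> (forall x, f (u x) = g (v x)) ->
  exists w : gmap V P, gcomp a w = u /\ gcomp b w = v.
Proof.
move=> pP com.
have [|x p c [e1 e2]|w wP] :=
  @gmap_choice V P (fun x p => a p = u x /\ b p = v x); last first.
- by exists w; split; apply: gmap_ext => x; case: (wP x).
- by rewrite !gmapJ e1 e2.
- by move=> x; case: pP => _; apply.
Qed.

Lemma pb_uniq P P' A B C (a : gmap P A) (b : gmap P B) (a' : gmap P' A)
    (b' : gmap P' B) (f : gmap A C) (g : gmap B C) :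
    is_pullback a b f g -> is_pullback a' b' f g ->
  exists h : gmap P P', [/\ gbij h, gcomp a' h = a & gcomp b' h = b].
Proof.
move=> pP pP'; have [h [ha hb]] := pb_lift pP' (proj1 pP).
exists h; split=> // y; case: (pP) => _ /(_ (a' y) (b' y) (proj1 pP' y)).
have ah u : a' (h u) = a u by rewrite -ha.
have bh u : b' (h u) = b u by rewrite -hb.
move=> [x [[ax bx] xU]]; exists x; split.
  by apply: (pb_ext pP'); rewrite ?ah ?bh.
by move=> z e; apply: xU; rewrite -e ah bh.
Qed.

(*  P --a--> A --v--> D        pasting the squares (P, A, B, C) and
    |        |        |        (A, D, C, E)
    b        f        w
    v        v        v
    B --g--> C --u--> E   *)
Lemma pb_paste P A B C D E (a : gmap P A) (b : gmap P B) (f : gmap A C)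
    (g : gmap B C) (v : gmap A D) (w : gmap D E) (u : gmap C E) :
    is_pullback a b f g -> is_pullback v f w u ->
  is_pullback (gcomp v a) b w (gcomp u g).
Proof.
move=> p1 p2; apply: is_pullbackI => [x|x y /= e1 e2|x y /= e].
- by rewrite /= (proj1 p2) (proj1 p1).
- apply: (pb_ext p1) => //; apply: (pb_ext p2) => //.
  by rewrite !(proj1 p1) e2.
- have [z [e1 e2]] := pb_ex p2 e; have [t [e3 e4]] := pb_ex p1 e2.
  by exists t; rewrite e3.
Qed.

Lemma pb_cancel P A B C D E (a : gmap P A) (b : gmap P B) (f : gmap A C)
    (g : gmap B C) (v : gmap A D) (w : gmap D E) (u : gmap C E) :
    (forall x, f (a x) = g (b x)) -> is_pullback v f w u ->
  is_pullback (gcomp v a) b w (gcomp u g) -> is_pullback a b f g.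
Proof.
move=> com p2 p3; apply: is_pullbackI => [//|x y e1 e2|x y e].
- by apply: (pb_ext p3) => //=; rewrite e1.
- have e3 : w (v x) = gcomp u g y by rewrite (proj1 p2) /= e.
  have [t [e4 e5]] := pb_ex p3 e3; exists t; split=> //.
  by apply: (pb_ext p2) => //; rewrite com e5.
Qed.

Lemma pb_idl A X (q : gmap A X) : is_pullback q (gid A) (gid X) q.
Proof.
apply: is_pullbackI => // x y /= ->; by exists y.
Qed.

Lemma pb_idr A X (q : gmap A X) : is_pullback (gid A) q q (gid X).
Proof. exact/is_pullback_sym/pb_idl. Qed.

(** Fed to the base change axiom [res_tr], this square yields tr_h res_h = id. In the same way
    [pb_inj] yields res_h tr_h = id for injective h, and [pb_void] yields res_j tr_i = 0 for
    disjoint images. *)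
Lemma pb_gbij A B (h : gmap A B) :
  gbij h -> is_pullback h h (gid B) (gid B).
Proof.
move=> hb; apply: is_pullbackI => // [u v e _|x y /= ->].
  exact: gbij_inj e.
by have [z [ez _]] := hb y; exists z.
Qed.

Lemma pb_inj A B (h : gmap A B) :
  injective h -> is_pullback (gid A) (gid A) h h.
Proof.
by move=> hi; apply: is_pullbackI => // x y /hi ->; exists y.
Qed.

Lemma pb_gbij_sq P A B C (a : gmap P A) (b : gmap P B) (f : gmap A C)
    (g : gmap B C) : (forall x, f (a x) = g (b x)) -> gbij a -> gbij g ->
  is_pullback a b f g.
Proof.
move=> com ab gb; apply: is_pullbackI => // [u v e _|x y e].
  exact: gbij_inj e.
have [u [eu _]] := ab x; exists u; split=> //.
by apply: (gbij_inj gb); rewrite -com eu.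
Qed.

(** * Coproducts of finite G-sets *)

Section Sum.
Variables A B : gset.
Let act (s : (A + B)%type) a : (A + B)%type :=
  match s with inl x => inl (gact A x a) | inr y => inr (gact B y a) end.

Lemma gsum_act1_subproof s : act s 1%g = s.
Proof. by case: s => x /=; rewrite gact1. Qed.

Lemma gsum_actM_subproof s a b : act s (a * b)%g = act (act s a) b.
Proof. by case: s => x /=; rewrite gactM. Qed.

Definition gsum : gset := gset_of gsum_act1_subproof gsum_actM_subproof.

Definition ginl : gmap A gsum := @GMap gT A gsum inl (fun _ _ => erefl).
Definition ginr : gmap B gsum := @GMap gT B gsum inr (fun _ _ => erefl).

Lemma copair_subproof C (f : gmap A C) (g : gmap B C) (s : gsum) a :
  let h := fun s : gsum => match s with inl x => f x | inr y => g y end in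
  h (gact gsum s a) = gact C (h s) a.
Proof. by case: s => x /=; rewrite gmapJ. Qed.

Definition copair C (f : gmap A C) (g : gmap B C) : gmap gsum C :=
  GMap (copair_subproof f g).

Lemma gsumP : is_coproduct ginl ginr.
Proof.
by exists (fun s : gsum => s : (A + B)%type) => -[].
Qed.
End Sum.

Lemma copair_comp A B C D (f : gmap A C) (g : gmap B C) (h : gmap C D) :
  gcomp h (copair f g) = copair (gcomp h f) (gcomp h g).
Proof. by apply: gmap_ext => -[]. Qed.

Lemma copair_gbij A B C (i : gmap A C) (j : gmap B C) :
  is_coproduct i j -> gbij (copair i j).
Proof.
case=> r K1 K2; apply: bij_gbij; exists r; first exact: K1.
exact: K2.
Qed.

Lemma coprod_inj A B C (i : gmap A C) (j : gmap B C) : is_coproduct i j ->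
  [/\ injective i, injective j & forall x y, i x <> j y].
Proof.
move=> /bij_inj bi; split=> [x y e|x y e|x y e].
- by case: (bi (inl x) (inl y) e).
- by case: (bi (inr x) (inr y) e).
- by case: (bi (inl x) (inr y) e).
Qed.

Lemma coprod_case A B C (i : gmap A C) (j : gmap B C) : is_coproduct i j ->
  forall z, (exists x, z = i x) \/ (exists y, z = j y).
Proof.
by move=> [r _ K2] z; rewrite -(K2 z); case: (r z) => x; [left|right]; exists x.
Qed.

Lemma is_coproductI A B C (i : gmap A C) (j : gmap B C) :
    injective i -> injective j -> (forall x y, i x <> j y) ->
    (forall z, (exists x, z = i x) \/ (exists y, z = j y)) ->
  is_coproduct i j.
Proof.
move=> ii ji ij cs.
have ex z : {s : A + B | match s with inl x => i x | inr y => j y end = z}.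
  apply: cid; have [[x ->]|[y ->]] := cs z; by [exists (inl x)|exists (inr y)].
exists (fun z => projT1 (ex z)) => [s|z]; last by case: (ex z).
case: (ex _) => t /=; case: s t => [x|x] [y|y].
- by move/ii ->.
- by move/esym/ij.
- by move/ij.
- by move/ji ->.
Qed.

(** Extensivity of finite G-sets. It splits a transferred tensor along a decomposition of the level
    in which it lives. *)
Lemma pb_coprod A B C D (q : gmap C D) (i : gmap A D) (j : gmap B D)
    (P P' : gset) (a : gmap P C) (b : gmap P A) (a' : gmap P' C)
    (b' : gmap P' B) : is_coproduct i j ->
  is_pullback a b q i -> is_pullback a' b' q j -> is_coproduct a a'.
Proof.
move=> ij p1 p2; have [ii ji ijN] := coprod_inj ij.
apply: is_coproductI => [x y e|x y e|x y e|z].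
- by apply: (pb_ext p1) => //; apply: ii; rewrite -!(proj1 p1) e.
- by apply: (pb_ext p2) => //; apply: ji; rewrite -!(proj1 p2) e.
- by apply: (ijN (b x) (b' y)); rewrite -(proj1 p1) -(proj1 p2) e.
- have [[x e]|[y e]] := coprod_case ij (q z).
    by left; have [u [<- _]] := pb_ex p1 e; exists u.
  by right; have [u [<- _]] := pb_ex p2 e; exists u.
Qed.

Definition gsummap A B A' B' (f : gmap A A') (g : gmap B B') :
    gmap (gsum A B) (gsum A' B') :=
  copair (gcomp (ginl A' B') f) (gcomp (ginr A' B') g).

Definition gvoid : gset :=
  @gset_of void (fun x _ => x) (fun _ => erefl) (fun _ _ _ => erefl).

Lemma gvoid0 : #|gvoid| = 0%N.
Proof. exact: card_void. Qed.

Definition gvoid_to X : gmap gvoid X :=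
  @GMap gT gvoid X (fun v : void => match v with end)
    (fun v : void => match v with end).

Lemma pb_void A B C (i : gmap A C) (j : gmap B C) :
  (forall x y, i x <> j y) -> is_pullback (gvoid_to A) (gvoid_to B) i j.
Proof. by move=> ij; apply: is_pullbackI => [[]|[]|x y /ij]. Qed.

Lemma gset0_void X (x : X) : #|X| = 0%N -> False.
Proof. by move/card0_eq/(_ x). Qed.

End GSets.

(* The values of the functors constructed below range over representatives
   that involve a finite G-set.  Restricting these to G-sets on ordinals keeps
   them in the universe of the carriers of rings. *)
Section Codes.
Variable gT : finGroupType.

Record gcode := GCode { gsize : nat; gcodeact : {action gT &-> 'I_gsize} }.
Definition gcode_gset (c : gcode) : gset gT := GSet (gcodeact c).
Coercion gcode_gset : gcode >-> gset.

Section Code.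
Variable X : gset gT.
Let act (i : 'I_#|X|) a := enum_rank (gact X (enum_val i) a).

Lemma code_act1_subproof i : act i 1%g = i.
Proof. by rewrite /act gact1 enum_valK. Qed.

Lemma code_actM_subproof i a b : act i (a * b)%g = act (act i a) b.
Proof. by rewrite /act gactM enum_rankK. Qed.

Definition code : gcode :=
  GCode (TotalAction code_act1_subproof code_actM_subproof).

Lemma cin_subproof (x : X) a :
  enum_rank (gact X x a) = act (enum_rank x) a.
Proof. by rewrite /act enum_rankK. Qed.
Definition cin : gmap X code := @GMap gT X code enum_rank cin_subproof.

Lemma cout_subproof i a : enum_val (act i a) = gact X (enum_val i) a.
Proof. by rewrite /act enum_rankK. Qed.
Definition cout : gmap code X := @GMap gT code X enum_val cout_subproof.

Lemma cinK : gcomp cout cin = gid X.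
Proof. by apply: gmap_ext => x /=; rewrite enum_rankK. Qed.
Lemma coutK : gcomp cin cout = gid code.
Proof. by apply: gmap_ext => x /=; rewrite enum_valK. Qed.

Lemma cin_gbij : gbij cin.
Proof.
by apply: bij_gbij; exists cout; [exact: enum_rankK|exact: enum_valK].
Qed.
Lemma cout_gbij : gbij cout.
Proof.
by apply: bij_gbij; exists cin; [exact: enum_valK|exact: enum_rankK].
Qed.
End Code.
End Codes.

(** * Exponential diagrams *)

Section Exponentials.
Variable gT : finGroupType.
Local Notation gset := (gset gT).
Implicit Types A B C P V X Y Z W : gset.

(* The universal property of an exponential diagram without dependent types:
   a section of q over the fibre of y is encoded by a predicate on A. *)
Record expo A X Y Z W (q : gmap A X) (f : gmap X Y)
    (e : gmap Z A) (p : gmap Z W) (pi : gmap W Y) : Prop := Expo {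
  expo_comm : forall z, f (q (e z)) = pi (p z);
  expo_fib : forall w x, f x = pi w -> exists z, p z = w /\ q (e z) = x;
  expo_fibI : forall z z', p z = p z' -> q (e z) = q (e z') -> z = z';
  expo_inj : forall w w', pi w = pi w' ->
    (forall z z', p z = w -> p z' = w' -> q (e z) = q (e z') -> e z = e z') ->
    w = w';
  expo_ex : forall y (S : A -> Prop),
    (forall x, f x = y -> exists a, q a = x /\ S a) ->
    exists w, pi w = y /\ forall z, p z = w -> S (e z) }.

(** From left to right, [expo_inj] is the uniqueness clause: two points with the same evaluations
    classify one and the same section. From right to left, a section is replaced by the predicate
    describing its graph. *)
Lemma expoP A X Y Z W (q : gmap A X) (f : gmap X Y)
    (e : gmap Z A) (p : gmap Z W) (pi : gmap W Y) :
  is_exponential q f e p pi <-> expo q f e p pi.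
Proof.
split=> [[pP uni]|[com fib fibI inj ex]].
- have com z : f (q (e z)) = pi (p z) := proj1 pP z.
  have fib w x : f x = pi w -> exists z, p z = w /\ q (e z) = x.
    by move=> /(pb_ex pP)[z [<- <-]]; exists z.
  split=> // [z z' e1 e2|w w' ew H|y S H].
  + exact: (pb_ext pP).
  + have ch (x : {x : X | f x == pi w}) :
      {z : Z | p z = w /\ q (e z) = val x}.
      by apply: cid; apply: fib; apply/eqP; case: x.
    have [x|v [_ vU]] := uni (pi w) (fun x => e (projT1 (ch x))).
      by case: (ch x) => z [].
    transitivity v; [symmetry|]; apply: vU; (split; first by []).
    * move=> z x ez eqx; case: (ch x) => z' [e1 e2] /=.
      congr (e _); apply: (pb_ext pP) => /=; congruence.
    * move=> z x ez eqx; case: (ch x) => z' [e1 e2] /=.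
      by symmetry; apply: H => //; congruence.
  + have ch (x : {x : X | f x == y}) : {a : A | q a = val x /\ S a}.
      by apply: cid; apply: H; apply/eqP; case: x.
    have [x|v [[v1 v2] _]] := uni y (fun x => projT1 (ch x)).
      by case: (ch x) => z [].
    exists v; split=> // z ez.
    have fz : f (q (e z)) == y by rewrite com ez v1.
    by rewrite (v2 z (exist _ (q (e z)) fz)) //; case: (ch _) => a [].
- split.
    apply: is_pullbackI => [//|z z' /= e1 e2|x w /fib[z [e1 e2]]].
      exact: fibI.
    by exists z.
  move=> y s sP.
  (* The graph of [s]. Quantifying over the points of the fibre avoids transporting a membership
     proof; the condition is vacuous when [q a] lies outside the fibre. *)
  pose S a := forall x : {x : X | f x == y}, val x = q a -> s x = a.
  have [x fx|w [e1 wS]] := ex y S.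
    have fx' : f x == y by apply/eqP.
    exists (s (exist _ x fx')); split=> [|x' ex']; first exact: sP.
    by congr s; apply: val_inj; rewrite ex' sP.
  exists w; split=> [|w' [e1' w'S]].
    by split=> // z x ez eqx; rewrite (wS z).
  apply: inj; first by rewrite e1.
  move=> z z' ez ez' eqz.
  have fz : f (q (e z)) == y by rewrite com ez e1.
  pose x : {x : X | f x == y} := exist _ (q (e z)) fz.
  by rewrite (w'S z' x) // -(wS z ez x).
Qed.

(** * Existence of exponential diagrams *)

Section Existence.
Variables (A X Y : gset) (q : gmap A X) (f : gmap X Y).

(* A section over the fibre of y is encoded by its graph. *)
Let is_sec (u : Y * {set A}) : bool :=
  [forall a in u.2, f (q a) == u.1] &&
  [forall x, (f x == u.1) ==> [exists a in u.2, q a == x]] &&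
  [forall a in u.2, forall b in u.2, (q a == q b) ==> (a == b)].

Let sec_prop (u : Y * {set A}) :=
  [/\ forall a, a \in u.2 -> f (q a) = u.1,
      forall x, f x = u.1 -> exists a, a \in u.2 /\ q a = x
    & forall a b, a \in u.2 -> b \in u.2 -> q a = q b -> a = b].

Let is_secP u : reflect (sec_prop u) (is_sec u).
Proof.
apply: (iffP idP) => [/andP[/andP[H1 H2] H3]|[H1 H2 H3]].
  split=> [a au|x xu|a b au bu eab].
  - exact/eqP/(forall_inP H1).
  - have /implyP := forallP H2 x; rewrite xu eqxx => /(_ isT).
    by case/existsP=> a /andP[au /eqP <-]; exists a.
  - have /forall_inP/(_ _ bu) := forall_inP H3 _ au.
    by rewrite eab eqxx => /eqP.
rewrite /is_sec -andbA; apply/and3P; split.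
- by apply/forall_inP => a /H1/eqP.
- apply/forallP => x; apply/implyP => /eqP/H2[a [au qa]].
  by apply/existsP; exists a; rewrite au qa eqxx.
- apply/forall_inP => a au; apply/forall_inP => b bu; apply/implyP => /eqP.
  by move/(H3 _ _ au bu) ->.
Qed.

Let W0 : finType := {u : Y * {set A} | is_sec u}.

Let sact (D : {set A}) a : {set A} := [set gact A x a | x in D].

Let mem_sact D a x : (gact A x a \in sact D a) = (x \in D).
Proof.
apply: (mem_imset (f := fun x => gact A x a)) => y z.
move/(congr1 (fun t => gact A t a^-1%g)).
by rewrite -!gactM mulgV !gact1.
Qed.

Let sactE D a x : (x \in sact D a) = (gact A x a^-1%g \in D).
Proof. by rewrite -(mem_sact D a) -gactM mulVg gact1. Qed.

Lemma secact_subproof (w : W0) a :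
  is_sec (gact Y (val w).1 a, sact (val w).2 a).
Proof.
case: w => -[y D] /= /is_secP[/= H1 H2 H3]; apply/is_secP; split=> /=.
- move=> x; rewrite sactE => /H1; rewrite !gmapJ => <-.
  by rewrite -gactM mulVg gact1.
- move=> x fx; have /H2[b [bD qb]] : f (gact X x a^-1%g) = y.
    by rewrite gmapJ fx -gactM mulgV gact1.
  exists (gact A b a); rewrite mem_sact; split=> //.
  by rewrite gmapJ qb -gactM mulVg gact1.
- move=> x x'; rewrite !sactE => xD x'D e.
  have := H3 _ _ xD x'D; rewrite !gmapJ e => /(_ erefl).
  by move/(congr1 (fun t => gact A t a)); rewrite -!gactM mulVg !gact1.
Qed.

Let wact (w : W0) a : W0 :=
  exist (fun u => is_true (is_sec u)) _ (secact_subproof w a).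

Lemma secact1_subproof w : wact w 1%g = w.
Proof.
apply: val_inj; case: w => -[y D] H /=; rewrite gact1; congr (_, _).
by apply/setP => x; rewrite sactE invg1 gact1.
Qed.

Lemma secactM_subproof w a b : wact w (a * b)%g = wact (wact w a) b.
Proof.
apply: val_inj; case: w => -[y D] H /=; rewrite gactM; congr (_, _).
by apply/setP => x; rewrite !sactE -gactM invMg.
Qed.

Let W : gset := gset_of secact1_subproof secactM_subproof.

Let Z0 : finType := {u : A * W | u.1 \in (val (u.2 : W0)).2}.

Lemma evact_subproof (z : Z0) a :
  gact A (val z).1 a \in (val (gact W (val z).2 a : W0)).2.
Proof. by case: z => -[x w] /=; rewrite mem_sact. Qed.

Let zact (z : Z0) a : Z0 :=
  exist _ (gact A (val z).1 a, gact W (val z).2 a) (evact_subproof z a).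

Lemma evact1_subproof z : zact z 1%g = z.
Proof. by apply: val_inj; case: z => -[x w] H; congr (_, _); exact: gact1. Qed.

Lemma evactM_subproof z a b : zact z (a * b)%g = zact (zact z a) b.
Proof. by apply: val_inj; case: z => -[x w] H; congr (_, _); exact: gactM. Qed.

Let Z : gset := gset_of evact1_subproof evactM_subproof.

(** [W] is the set of pairs of a point y and the graph of a section over the fibre at y, and [Z] is
    the incidence set of the pairs (a, w) with a on the graph w. Graphs are subsets of A, which
    makes both finite. *)
Lemma expo_exists : exists (Z W : gset) (e : gmap Z A) (p : gmap Z W)
  (pi : gmap W Y), expo q f e p pi.
Proof.
exists Z, W, (@GMap gT Z A (fun z : Z0 => (val z).1) (fun _ _ => erefl)).
exists (@GMap gT Z W (fun z : Z0 => (val z).2) (fun _ _ => erefl)).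
exists (@GMap gT W Y (fun w : W0 => (val w).1) (fun _ _ => erefl)).
split=> /=.
- by move=> [[a [[y D] wP]] /= aD]; case/is_secP: (wP) => H _ _; exact: H.
- move=> w x fx; case: (w) (fx) => -[y D] wP /= {}fx.
  case/is_secP: (wP) => /= _ H _; have [a [aD qa]] := H _ fx.
  pose w' : W := exist (fun u => is_true (is_sec u)) (y, D) wP.
  by exists (exist _ (a, w') aD : Z0).
- move=> [[a w] aw] [[a' w'] aw'] /= ew eq.
  apply: val_inj => /=; rewrite ew in aw *; congr (_, _).
  case: w' aw' aw {ew} => -[y D] wP ? ?.
  by case/is_secP: (wP) => /= _ _ H; apply: H.
- move=> [[y D] wP] [[y' D'] wP'] /= ey H; rewrite -{}ey in wP' H *.
  apply: val_inj; congr (_, _) => /=.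
  pose w : W := exist (fun u => is_true (is_sec u)) (y, D) wP; pose w' : W :=
    exist (fun u => is_true (is_sec u)) (y, D') wP'.
  have {}H a a' : a \in D -> a' \in D' -> q a = q a' -> a = a'.
    move=> aD aD' e.
    exact: (H (exist _ (a, w) aD : Z0) (exist _ (a', w') aD' : Z0)).
  case/is_secP: (wP) => /= D1 D2 _; case/is_secP: (wP') => /= D1' D2' _.
  apply/setP => a; apply/idP/idP => aD.
    have [b [bD qb]] := D2' _ (D1 _ aD).
    by rewrite (H a b).
  have [b [bD qb]] := D2 _ (D1' _ aD).
  by rewrite -(H b a).
- move=> y S H.
  (* One admissible point is chosen in each fibre of [q] where there is one; the graph [D] below
     consists of the points over the fibre of y that are the chosen ones. *)
  pose s (x : X) : option A :=
    match pselect (exists a, q a = x /\ S a) with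
    | left ex => Some (projT1 (cid ex)) | right _ => None end.
  have sP x : f x = y -> exists a, [/\ s x = Some a, q a = x & S a].
    move/H => ex; rewrite /s; case: pselect => [ex'|[]//].
    by case: (cid ex') => a [] /=; exists a.
  pose D := [set a | (f (q a) == y) && (s (q a) == Some a)].
  have DP : is_sec (y, D).
    apply/is_secP; split=> /= [a|x fx|a b].
    - by rewrite inE => /andP[/eqP].
    - have [a [sa qa _]] := sP _ fx.
      by exists a; rewrite inE qa sa fx !eqxx.
    - rewrite !inE => /andP[_ /eqP e1] /andP[_ /eqP e2] e.
      by move: e1; rewrite e e2 => -[].
  exists (exist (fun u => is_true (is_sec u)) (y, D) DP : W0).
  split=> // -[[a w] aw] /= ew.
  rewrite ew /= inE in aw; case/andP: aw => /eqP fa /eqP sa.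
  by have [b [+ _ Sb]] := sP _ fa; rewrite sa => -[->].
Qed.
End Existence.

Lemma expo_pb A X Y Z W (q : gmap A X) (f : gmap X Y) (e : gmap Z A)
    (p : gmap Z W) (pi : gmap W Y) :
  expo q f e p pi -> is_pullback (gcomp q e) p f pi.
Proof. by case/expoP. Qed.

(** * Uniqueness of exponential diagrams *)

Section Uniqueness.
Variables (A X Y : gset) (q : gmap A X) (f : gmap X Y).

Let same_section Z W Z' W' (e : gmap Z A) (p : gmap Z W) (pi : gmap W Y)
    (e' : gmap Z' A) (p' : gmap Z' W') (pi' : gmap W' Y) w w' :=
  pi' w' = pi w /\
  forall z z', p z = w -> p' z' = w' -> q (e z) = q (e' z') -> e z = e' z'.

Let same_section_uniq Z W Z' W' (e : gmap Z A) (p : gmap Z W) (pi : gmap W Y)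
    (e' : gmap Z' A) (p' : gmap Z' W') (pi' : gmap W' Y) :
    expo q f e p pi -> expo q f e' p' pi' ->
  forall w, exists! w', same_section e p pi e' p' pi' w w'.
Proof.
move=> E E' w.
(* The section that w classifies is handed to the other diagram as the set of values of [e] on the
   fibre of [p] over w. *)
have [x fx|w' [e1 w'S]] := expo_ex E' (y := pi w)
  (S := fun a => exists z, p z = w /\ e z = a).
  by have [z [pz qz]] := expo_fib E fx; exists (e z); split=> //; exists z.
exists w'; split.
  split=> // z z' pz pz' qz; have [z2 [pz2 ez2]] := w'S _ pz'.
  by rewrite -ez2; congr (e _); apply: (expo_fibI E); rewrite ?pz ?ez2.
move=> w2 [e2 w2S]; apply: (expo_inj E'); first by rewrite e1.
move=> z z' pz pz' qz; have [z2 [pz2 ez2]] := w'S _ pz.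
by rewrite -ez2; apply: w2S => //; rewrite ez2.
Qed.

(** Points of [W] and [W'] correspond when they classify the same section, and the pullback property
    lifts this bijection to [Z]. The last pullback square is what makes norms along [p] and [p']
    comparable. *)
Lemma expo_uniq Z W Z' W' (e : gmap Z A) (p : gmap Z W) (pi : gmap W Y)
    (e' : gmap Z' A) (p' : gmap Z' W') (pi' : gmap W' Y) :
    expo q f e p pi -> expo q f e' p' pi' ->
  exists (h : gmap W W') (u : gmap Z Z'),
    [/\ gbij h, gcomp pi' h = pi, gcomp e' u = e & is_pullback u p p' h].
Proof.
move=> E E'.
have [w w' a [e1 R1]|h hP] := @gmap_choice gT W W'
  (same_section e p pi e' p' pi') (same_section_uniq E E').
- split; first by rewrite !gmapJ e1.
  move=> z z' pz pz' qz.
  have /(congr1 (fun t => gact A t a)) :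
      e (gact Z z a^-1%g) = e' (gact Z' z' a^-1%g).
    apply: R1; rewrite !gmapJ ?pz ?pz' -?gactM ?mulgV ?gact1 //.
    by rewrite -!gmapJ !gmapJ qz.
  by rewrite !gmapJ -!gactM !mulVg !gact1.
have pih : gcomp pi' h = pi by apply: gmap_ext => w; case: (hP w).
have [z|u [u1 u2]] := pb_lift (u := gcomp q e) (v := gcomp h p) (expo_pb E').
  by rewrite /= (expo_comm E) -pih.
have qe z : q (e' (u z)) = q (e z) by exact: (gmap_app u1 z).
have pu z : p' (u z) = h (p z) by exact: (gmap_app u2 z).
have eu z : e' (u z) = e z.
  by have [_ H] := hP (p z); symmetry; apply: H.
exists h, u; split=> //.
- move=> w'; have [w [wR wU]] := same_section_uniq E' E w'.
  have sym v : same_section e p pi e' p' pi' v w' <->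
      same_section e' p' pi' e p pi w' v.
    split=> -[e1 H]; split=> // z z' pz pz' qz; symmetry; exact: H.
  exists w; split.
    have [w2 [_ w2U]] := same_section_uniq E E' w.
    by rewrite -(w2U _ (hP w)); apply: w2U; apply/sym.
  by move=> v e1; apply: wU; apply/sym; rewrite -e1.
- exact: gmap_ext.
- apply: is_pullbackI => [//|z z' e1 e2|z' w e1].
    by apply: (expo_fibI E) => //; rewrite -!qe e1.
  have [|z [pz qz]] := expo_fib E (w := w) (x := q (e' z')).
    by rewrite (expo_comm E') e1 -pih.
  exists z; split=> //; apply: (expo_fibI E'); first by rewrite pu pz.
  by rewrite qe.
Qed.
End Uniqueness.

Lemma expo_idr A X (q : gmap A X) : expo q (gid X) (gid A) (gid A) q.
Proof.
split=> //= [w x ->|w w' e H|y S /(_ _ erefl)[a [qa Sa]]].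
- by exists w.
- exact: H.
- by exists a; split=> // z ->.
Qed.

Lemma expo_idl X Y (f : gmap X Y) : expo (gid X) f (gid X) f (gid Y).
Proof.
split=> //= [w x <-|y S H]; first by exists x.
by exists y; split=> // x /H[a [<-]].
Qed.

(** A section over a fibre of g f is a family of sections over fibres of f, indexed by a fibre of g.
    This gives the functoriality of norms. *)
Lemma expo_comp A X Y Y' Z W Z1 W1 Z2 (q : gmap A X) (f : gmap X Y)
    (e : gmap Z A) (p : gmap Z W) (pi : gmap W Y) (g : gmap Y Y')
    (e1 : gmap Z1 W) (p1 : gmap Z1 W1) (pi1 : gmap W1 Y')
    (e2 : gmap Z2 Z) (p2 : gmap Z2 Z1) :
    expo q f e p pi -> expo pi g e1 p1 pi1 -> is_pullback e2 p2 p e1 ->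
  expo q (gcomp g f) (gcomp e e2) (gcomp p1 p2) pi1.
Proof.
move=> E E1 pP; have com := proj1 pP.
split=> /= [z|w x gx|z z' ep eq|w w' ew H|y S H].
- by rewrite (expo_comm E) com (expo_comm E1).
- have [z1 [pz1 e1z1]] := expo_fib E1 gx.
  have [z [pz qz]] := expo_fib E (esym e1z1).
  have [z2 [ez2 pz2]] := pb_ex pP pz.
  by exists z2; rewrite pz2 ez2.
- have e12 : p2 z = p2 z'.
    by apply: (expo_fibI E1) => //; rewrite -!com -!(expo_comm E) eq.
  apply: (pb_ext pP) => //; apply: (expo_fibI E) => //.
  by rewrite !com e12.
- apply: (expo_inj E1) => // z1 z1' pz1 pz1' ez1.
  apply: (expo_inj E) => // z z' pz pz' qz.
  have [z2 [ez2 pz2]] := pb_ex pP pz; have [z2' [ez2' pz2']] := pb_ex pP pz'.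
  have := H z2 z2'; rewrite ez2 ez2' pz2 pz2'; exact.
- pose S1 w := forall z, p z = w -> S (e z).
  have [y1 gy1|w [pw wS]] := expo_ex E1 (y := y) (S := S1).
    have [x fx|w [pw wS]] := expo_ex E (y := y1) (S := S).
      by apply: H; rewrite fx.
    by exists w.
  exists w; split=> // z pz; apply: (wS (p2 z)) => //.
Qed.

(** A section of q q' is found in two stages: a section of q, then a lift of it through q'. The lift
    is a section of [q1], the pullback of q' along the evaluation [e], over a fibre of [p]. *)
Lemma expo_tr A' A X Y Z W A1 Z2 W2 (q' : gmap A' A) (q : gmap A X)
    (f : gmap X Y) (e : gmap Z A) (p : gmap Z W) (pi : gmap W Y)
    (e1 : gmap A1 A') (q1 : gmap A1 Z) (e2 : gmap Z2 A1) (p2 : gmap Z2 W2)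
    (pi2 : gmap W2 W) :
    expo q f e p pi -> is_pullback e1 q1 q' e -> expo q1 p e2 p2 pi2 ->
  expo (gcomp q q') f (gcomp e1 e2) p2 (gcomp pi pi2).
Proof.
move=> E pP E2; have com := proj1 pP.
split=> /= [z|w x fx|z z' ep eq|w w' ew H|y S H].
- by rewrite com (expo_comm E) (expo_comm E2).
- have [z [pz qz]] := expo_fib E fx.
  have [z2 [pz2 qz2]] := expo_fib E2 pz.
  by exists z2; rewrite com qz2.
- apply: (expo_fibI E2) => //; apply: (expo_fibI E).
    by rewrite !(expo_comm E2) ep.
  by rewrite -!com.
- have ew2 : pi2 w = pi2 w'.
    apply: (expo_inj E) => // z z' pz pz' qz.
    have [z2 [pz2 qz2]] := expo_fib E2 pz.
    have [z2' [pz2' qz2']] := expo_fib E2 pz'.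
    have := H z2 z2' pz2 pz2'; rewrite !com qz2 qz2' => /(_ qz).
    by move/(congr1 q'); rewrite !com qz2 qz2'.
  apply: (expo_inj E2) => // z z' pz pz' qz.
  by apply: (pb_ext pP) => //; apply: H; rewrite // !com qz.
- have [x fx|w [pw wS]] := expo_ex E (y := y)
    (S := fun a => exists a', q' a' = a /\ S a').
    by have [a' [qa' Sa']] := H x fx; exists (q' a'); split=> //; exists a'.
  have [z pz|w2 [pw2 w2S]] := expo_ex E2 (y := w) (S := fun a1 => S (e1 a1)).
    have [a' [qa' Sa']] := wS z pz.
    by have [a1 [ea1 qa1]] := pb_ex pP qa'; exists a1; rewrite ea1.
  by exists w2; rewrite pw2.
Qed.

(** The fibre of f' over y' is the fibre of f over h y', so both diagrams classify the same
    sections. The evaluation [e'] is obtained by lifting through the squares for [X'] and [A'] in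
    turn. *)
Lemma expo_bc A X Y Z W A' X' Y' Z' W' (q : gmap A X) (f : gmap X Y)
    (e : gmap Z A) (p : gmap Z W) (pi : gmap W Y) (h : gmap Y' Y)
    (hX : gmap X' X) (f' : gmap X' Y') (hA : gmap A' A) (q' : gmap A' X')
    (hW : gmap W' W) (pi' : gmap W' Y') (hZ : gmap Z' Z) (p' : gmap Z' W') :
    expo q f e p pi -> is_pullback hX f' f h -> is_pullback hA q' q hX ->
    is_pullback hW pi' pi h -> is_pullback hZ p' p hW ->
  exists e' : gmap Z' A', gcomp hA e' = gcomp e hZ /\ expo q' f' e' p' pi'.
Proof.
move=> E pX pA pW pZ.
have [cX cA cW cZ] := And4 (proj1 pX) (proj1 pA) (proj1 pW) (proj1 pZ).
have [z|v [v1 v2]] :=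
  pb_lift (u := gcomp q (gcomp e hZ)) (v := gcomp pi' p') pX.
  by rewrite /= (expo_comm E) cZ cW.
have v1' z : hX (v z) = q (e (hZ z)) by exact: (gmap_app v1 z).
have v2' z : f' (v z) = pi' (p' z) by exact: (gmap_app v2 z).
have [z|e' [ea eb]] := pb_lift (u := gcomp e hZ) (v := v) pA.
  by rewrite v1'.
have ha z : hA (e' z) = e (hZ z) by exact: (gmap_app ea z).
have qe z : q' (e' z) = v z by rewrite -eb.
exists e'; split=> //.
split=> [z|w x fx|z z' ep eq|w w' ew H|y S H].
- by rewrite qe.
- have [|z [pz qz]] := expo_fib E (w := hW w) (x := hX x).
    by rewrite cX cW fx.
  have [z' [ez' pz']] := pb_ex pZ pz.
  exists z'; split=> //; apply: (pb_ext pX); first by rewrite qe v1' ez'.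
  by rewrite qe v2' pz'.
- apply: (pb_ext pZ) => //; apply: (expo_fibI E); first by rewrite !cZ ep.
  by rewrite -!v1' -!qe eq.
- apply: (pb_ext pW) => //; apply: (expo_inj E); first by rewrite !cW ew.
  move=> z z' pz pz' qz.
  have [z1 [ez1 pz1]] := pb_ex pZ pz; have [z1' [ez1' pz1']] := pb_ex pZ pz'.
  rewrite -ez1 -ez1' -!ha; congr (hA _); apply: H => //; rewrite !qe.
  apply: (pb_ext pX); first by rewrite !v1' ez1 ez1'.
  by rewrite !v2' pz1 pz1'.
- have [x fx|w [pw wS]] := expo_ex E (y := h y)
    (S := fun a => exists a', [/\ hA a' = a, f' (q' a') = y & S a']).
    have [x' [ex' fx']] := pb_ex pX fx.
    have [a' [qa' Sa']] := H _ fx'.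
    by exists (hA a'); rewrite cA qa' ex'; split=> //; exists a'; rewrite qa'.
  have [w' [ew' pw']] := pb_ex pW pw.
  exists w'; split=> // z' pz'.
  have [|a' [ha' fa' Sa']] := wS (hZ z'); first by rewrite cZ pz'.
  suff -> : e' z' = a' by [].
  apply: (pb_ext pA); first by rewrite ha ha'.
  apply: (pb_ext pX); first by rewrite qe v1' -cA ha'.
  by rewrite fa' qe v2' pz' pw'.
Qed.

End Exponentials.

(** * Box products *)

Section Mackey.
Variables (gT : finGroupType) (M : mackey gT).
Local Notation gset := (gset gT).
Implicit Types A B C P X Y Z : gset.

Lemma mres_id X (m : M X) : mres M (gid X) m = m.
Proof. exact: (res_id (mackeyP M)). Qed.

Lemma mres_comp X Y Z (g : gmap Y Z) (f : gmap X Y) (m : M Z) :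
  mres M (gcomp g f) m = mres M f (mres M g m).
Proof. exact: (res_comp (mackeyP M)). Qed.

Lemma mtr_id X (m : M X) : mtr M (gid X) m = m.
Proof. exact: (tr_id (mackeyP M)). Qed.

Lemma mtr_comp X Y Z (g : gmap Y Z) (f : gmap X Y) (m : M X) :
  mtr M (gcomp g f) m = mtr M g (mtr M f m).
Proof. exact: (tr_comp (mackeyP M)). Qed.

Lemma mres_tr P A B C (a : gmap P A) (b : gmap P B) (f : gmap A C)
    (g : gmap B C) (m : M A) : is_pullback a b f g ->
  mres M g (mtr M f m) = mtr M b (mres M a m).
Proof. by move=> pP; exact: (res_tr (mackeyP M)). Qed.

Lemma mackey0 X (m : M X) : #|X| = 0%N -> m = 0.
Proof. by move=> X0; exact: (res_empty (mackeyP M)). Qed.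

Lemma mvoid (m : M (gvoid gT)) : m = 0.
Proof. exact/mackey0/gvoid0. Qed.

Lemma mtr_res_gbij X Y (h : gmap X Y) (m : M Y) :
  gbij h -> mtr M h (mres M h m) = m.
Proof.
by move=> /pb_gbij pP; rewrite -(mres_tr _ pP) mtr_id mres_id.
Qed.

Lemma mres_tr_inj X Y (h : gmap X Y) (m : M X) :
  injective h -> mres M h (mtr M h m) = m.
Proof. by move=> /pb_inj pP; rewrite (mres_tr _ pP) mtr_id mres_id. Qed.

Lemma mres_tr_disj X Y Z (i : gmap X Z) (j : gmap Y Z) (m : M X) :
  (forall x y, i x <> j y) -> mres M j (mtr M i m) = 0.
Proof.
by move=> /pb_void pP; rewrite (mres_tr _ pP) (mvoid (mres M _ m)) raddf0.
Qed.

Lemma coprod_ext X Y Z (i : gmap X Z) (j : gmap Y Z) (m m' : M Z) :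
  is_coproduct i j -> mres M i m = mres M i m' -> mres M j m = mres M j m' ->
  m = m'.
Proof.
move=> ij e1 e2; have /bij_inj := res_coproduct (mackeyP M) ij; apply.
by rewrite e1 e2.
Qed.

Lemma coprod_split X Y Z (i : gmap X Z) (j : gmap Y Z) (m : M Z) :
  is_coproduct i j -> mtr M i (mres M i m) + mtr M j (mres M j m) = m.
Proof.
move=> ij; have [ii ji ijN] := coprod_inj ij.
have jiN y x : j y <> i x by move/esym/ijN.
apply: (coprod_ext ij); rewrite raddfD.
  by rewrite mres_tr_inj // (mres_tr_disj _ jiN) addr0.
by rewrite mres_tr_inj // (mres_tr_disj _ ijN) add0r.
Qed.

Section Join.
Variables (A B : gset).

(** The inverse of the additivity isomorphism from M(A + B) to M(A) x M(B), written with transfers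
    so that no inverse has to be chosen. *)
Definition mjoin (x : M A) (y : M B) : M (gsum A B) :=
  mtr M (ginl A B) x + mtr M (ginr A B) y.

Lemma mres_inl_join x y : mres M (ginl A B) (mjoin x y) = x.
Proof.
have [ii ji ijN] := coprod_inj (gsumP A B).
rewrite raddfD mres_tr_inj // mres_tr_disj ?addr0 //.
Qed.

Lemma mres_inr_join x y : mres M (ginr A B) (mjoin x y) = y.
Proof.
have [ii ji ijN] := coprod_inj (gsumP A B).
by rewrite raddfD mres_tr_inj // mres_tr_disj ?add0r.
Qed.

Lemma mjoin_uniq x y z :
  mres M (ginl A B) z = x -> mres M (ginr A B) z = y -> mjoin x y = z.
Proof.
move=> <- <-.
by apply: (coprod_ext (gsumP A B)); rewrite ?mres_inl_join ?mres_inr_join.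
Qed.
End Join.

Lemma mres_gsummap A B A' B' (f : gmap A A') (g : gmap B B') x y :
  mres M (gsummap f g) (mjoin x y) = mjoin (mres M f x) (mres M g y).
Proof.
have e1 : gcomp (gsummap f g) (ginl A B) = gcomp (ginl A' B') f.
  exact: gmap_ext.
have e2 : gcomp (gsummap f g) (ginr A B) = gcomp (ginr A' B') g.
  exact: gmap_ext.
symmetry; apply: mjoin_uniq.
  by rewrite -mres_comp e1 mres_comp mres_inl_join.
by rewrite -mres_comp e2 mres_comp mres_inr_join.
Qed.

Lemma mtr_gsummap A B A' B' (f : gmap A A') (g : gmap B B') x y :
  mtr M (gsummap f g) (mjoin x y) = mjoin (mtr M f x) (mtr M g y).
Proof.
rewrite /mjoin raddfD -!mtr_comp.
by congr (_ + _); congr (mtr M _ _); apply: gmap_ext.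
Qed.

Lemma mtr_copair A B C (f : gmap A C) (g : gmap B C) x y :
  mtr M (copair f g) (mjoin x y) = mtr M f x + mtr M g y.
Proof.
rewrite /mjoin raddfD -!mtr_comp.
by congr (_ + _); congr (mtr M _ _); apply: gmap_ext.
Qed.

Lemma mres_copair A B C (f : gmap A C) (g : gmap B C) z :
  mres M (copair f g) z = mjoin (mres M f z) (mres M g z).
Proof.
by symmetry; apply: mjoin_uniq; rewrite -mres_comp;
  congr (mres M _ _); apply: gmap_ext.
Qed.

End Mackey.

Section GreenLemmas.
Variables (gT : finGroupType) (R : green gT).
Local Notation gset := (gset gT).
Implicit Types A B C P X Y Z : gset.

Lemma gres_id X (m : R X) : gres R (gid X) m = m.
Proof. exact: (mres_id (M := green_mackey R)). Qed.

Lemma gres_comp X Y Z (g : gmap Y Z) (f : gmap X Y) (m : R Z) :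
  gres R (gcomp g f) m = gres R f (gres R g m).
Proof. exact: (mres_comp (M := green_mackey R)). Qed.

Lemma gtr_id X (m : R X) : gtr R (gid X) m = m.
Proof. exact: (mtr_id (M := green_mackey R)). Qed.

Lemma gtr_comp X Y Z (g : gmap Y Z) (f : gmap X Y) (m : R X) :
  gtr R (gcomp g f) m = gtr R g (gtr R f m).
Proof. exact: (mtr_comp (M := green_mackey R)). Qed.

Lemma gres_tr P A B C (a : gmap P A) (b : gmap P B) (f : gmap A C)
    (g : gmap B C) (m : R A) : is_pullback a b f g ->
  gres R g (gtr R f m) = gtr R b (gres R a m).
Proof. exact: (mres_tr (M := green_mackey R)). Qed.
End GreenLemmas.

Section KAct.
Variables (gT : finGroupType) (R : green gT) (M : kmodule R).
Lemma kact0 X (c : R X) : kact c (0 : M X) = 0.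
Proof. by apply: (addrI (kact c 0)); rewrite -kactDr !addr0. Qed.
Lemma kactN X (c : R X) (m : M X) : kact c (- m) = - kact c m.
Proof. by apply: (addrI (kact c m)); rewrite -kactDr !subrr kact0. Qed.
End KAct.

(* An element of the box product of M and N over k is represented by a single
   transferred pure tensor tr_q (x (x) y): sums are absorbed by disjoint unions
   of G-sets.  M and N are modules over k-algebras R and R', so that the box
   product inherits the actions of both. *)
Section Box.
Variables (gT : finGroupType) (k R R' : tambara gT).
Variables (f : tmap k R) (f' : tmap k R') (M : kmodule R) (N : kmodule R').
Local Notation gset := (gset gT).
Implicit Types A B C P X Y Z : gset.

Record brep X := BRep {
  bdom : gcode gT;
  bproj : gmap bdom X;
  bl : M bdom;
  br : N bdom }.

(** Besides the equivalence closure, the relations are the projection formulas in both variables and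
    balancing over k. Bilinearity is not imposed: it follows from the projection formula along a
    fold map. *)
Inductive breq X : brep X -> brep X -> Prop :=
| breq_refl t : breq t t
| breq_sym t u : breq t u -> breq u t
| breq_trans t u v : breq t u -> breq u v -> breq t v
| breq_trl (A B : gcode gT) (h : gmap A B) (q : gmap B X) (x : M A) (y : N B) :
    breq (BRep (gcomp q h) x (mres N h y)) (BRep q (mtr M h x) y)
| breq_trr (A B : gcode gT) (h : gmap A B) (q : gmap B X) (x : M B) (y : N A) :
    breq (BRep (gcomp q h) (mres M h x) y) (BRep q x (mtr N h y))
| breq_act (A : gcode gT) (q : gmap A X) (c : k A) (x : M A) (y : N A) :
    breq (BRep q (kact (f A c) x) y) (BRep q x (kact (f' A c) y)).

Definition boxT X := {S : brep X -> Prop | exists t, S = breq t}.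

HB.instance Definition _ X := gen_eqMixin (boxT X).
HB.instance Definition _ X := gen_choiceMixin (boxT X).

Definition bclass X (t : brep X) : boxT X :=
  exist _ (breq t) (ex_intro _ t erefl).

Lemma bclassE X (t u : brep X) : bclass t = bclass u <-> breq t u.
Proof.
split=> [/(congr1 (fun b => sval b u)) /= e|tu].
  by rewrite e; exact: breq_refl.
apply: eq_exist; apply: funext => v; apply: propext; split=> h.
  by apply: breq_trans h; apply: breq_sym.
exact: breq_trans tu h.
Qed.

(** Representatives live on coded G-sets; [cls] admits any finite G-set by transport along its
    enumeration, and the lemmas below restate the relations in that generality. *)
Definition cls X A (q : gmap A X) (x : M A) (y : N A) : boxT X :=
  bclass (BRep (gcomp q (cout A)) (mres M (cout A) x) (mres N (cout A) y)).

Lemma bclass_cls X (A : gcode gT) (q : gmap A X) (x : M A) (y : N A) :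
  bclass (BRep q x y) = cls q x y.
Proof.
apply/bclassE/breq_sym; apply: breq_trans (breq_trl _ _ _ _) _.
by rewrite mtr_res_gbij; [exact: breq_refl|exact: cout_gbij].
Qed.

Lemma boxT_ind X (S : boxT X -> Prop) :
  (forall A (q : gmap A X) x y, S (cls q x y)) -> forall b, S b.
Proof.
move=> H [b [[A q x y] eb]]; have := H _ q x y; rewrite -bclass_cls.
by congr S; exact: eq_exist.
Qed.

Let cod A B (h : gmap A B) : gmap (code A) (code B) :=
  gcomp (cin B) (gcomp h (cout A)).

Let codE A B (h : gmap A B) : gcomp (cout B) (cod h) = gcomp h (cout A).
Proof. by rewrite /cod gcompA cinK gcomp_idl. Qed.

Let cod_pb A B (h : gmap A B) : is_pullback (cout A) (cod h) h (cout B).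
Proof.
apply: pb_gbij_sq; [|exact: cout_gbij|exact: cout_gbij] => x.
by symmetry; exact: gmap_app (codE h) x.
Qed.

Lemma cls_trl X A B (h : gmap A B) (q : gmap B X) (x : M A) (y : N B) :
  cls (gcomp q h) x (mres N h y) = cls q (mtr M h x) y.
Proof.
apply/bclassE; rewrite -gcompA -mres_comp -codE gcompA mres_comp.
by rewrite (mres_tr _ (cod_pb h)); exact: breq_trl.
Qed.

Lemma cls_trr X A B (h : gmap A B) (q : gmap B X) (x : M B) (y : N A) :
  cls (gcomp q h) (mres M h x) y = cls q x (mtr N h y).
Proof.
apply/bclassE; rewrite -gcompA -mres_comp -codE gcompA mres_comp.
by rewrite (mres_tr _ (cod_pb h)); exact: breq_trr.
Qed.

Lemma cls_act X A (q : gmap A X) (c : k A) (x : M A) (y : N A) :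
  cls q (kact (f A c) x) y = cls q x (kact (f' A c) y).
Proof.
by apply/bclassE; rewrite !res_kact -!tmap_res; exact: breq_act.
Qed.

Lemma cls_gbij X A B (h : gmap A B) (q : gmap B X) (x : M B) (y : N B) :
  gbij h -> cls (gcomp q h) (mres M h x) (mres N h y) = cls q x y.
Proof. by move=> hb; rewrite cls_trl mtr_res_gbij. Qed.

Section Lift.
Variables (X : gset) (D : Type) (F : forall A, gmap A X -> M A -> N A -> D).

Record bresp : Prop := BResp {
  bresp_trl : forall A B (h : gmap A B) (q : gmap B X) (x : M A) (y : N B),
    F (gcomp q h) x (mres N h y) = F q (mtr M h x) y;
  bresp_trr : forall A B (h : gmap A B) (q : gmap B X) (x : M B) (y : N A),
    F (gcomp q h) (mres M h x) y = F q x (mtr N h y);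
  bresp_act : forall A (q : gmap A X) (c : k A) (x : M A) (y : N A),
    F q (kact (f A c) x) y = F q x (kact (f' A c) y) }.

(** [F] is evaluated at a chosen representative, so no proof of compatibility enters the definition;
    independence of the choice is [bliftE], under [bresp]. *)
Definition blift (b : boxT X) : D :=
  let t := projT1 (cid (svalP b)) in F (bproj t) (bl t) (br t).

Lemma bliftE (HF : bresp) A (q : gmap A X) x y : blift (cls q x y) = F q x y.
Proof.
rewrite /blift; case: (cid _) => t /= e.
have {e} : breq t
    (BRep (gcomp q (cout A)) (mres M (cout A) x) (mres N (cout A) y)).
  by apply: breq_sym; rewrite e; exact: breq_refl.
pose G t := F (bproj t) (bl t) (br t).
have GE t1 t2 : breq t1 t2 -> G t1 = G t2.
  elim=> {t1 t2} [//|t1 t2 _ ->//|t1 t2 t3 _ -> _ ->//|||] *; rewrite /G /=.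
  - exact: bresp_trl HF _ _ _ _ _ _.
  - exact: bresp_trr HF _ _ _ _ _ _.
  - exact: bresp_act HF _ _ _ _ _.
move/GE; rewrite /G /= => ->; rewrite (bresp_trl HF).
by rewrite mtr_res_gbij //; exact: cout_gbij.
Qed.
End Lift.
Arguments bliftE {X D F} HF {A} q x y.

Section Add.
Variable X : gset.

Definition badd_rep A (q : gmap A X) (x : M A) (y : N A) (b : boxT X) :
    boxT X :=
  blift (fun A' q' x' y' => cls (copair q q') (mjoin x x') (mjoin y y')) b.

Let copair_sum A A' B B' (u : gmap A A') (v : gmap B B') (q : gmap A' X)
    (q' : gmap B' X) :
  gcomp (copair q q') (gsummap u v) = copair (gcomp q u) (gcomp q' v).
Proof. by apply: gmap_ext => -[]. Qed.

Let jact A B (U : green gT) (L : kmodule U) (c : U A) (d : U B)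
    (x : L A) (y : L B) :
  kact (mjoin (M := green_mackey U) c d : U (gsum A B)) (mjoin x y) =
  mjoin (kact c x) (kact d y).
Proof.
symmetry; apply: mjoin_uniq; rewrite res_kact.
  by rewrite [gres _ _ _](@mres_inl_join _ (green_mackey U)) mres_inl_join.
by rewrite [gres _ _ _](@mres_inr_join _ (green_mackey U)) mres_inr_join.
Qed.

Let jmor A B (S S' : tambara gT) (g : tmap S S') (c : S A) (d : S B) :
  mjoin (M := green_mackey S') (g A c) (g B d) =
  g (gsum A B) (mjoin (M := green_mackey S) c d).
Proof. by rewrite /mjoin /= rmorphD !tmap_tr. Qed.

(** The fixed summand is padded with the identity map, or with the scalar 1, so that a relation in
    the other summand becomes a relation for the whole disjoint union. *)
Let resp_r A (q : gmap A X) (x : M A) (y : N A) :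
  bresp (fun A' (q' : gmap A' X) x' y' =>
    cls (copair q q') (mjoin x x') (mjoin y y')).
Proof.
split=> [A1 B h q1 x1 y1|A1 B h q1 x1 y1|A1 q1 c x1 y1].
- rewrite -{1}(gcomp_idr q) -{1}(mres_id y) -copair_sum -mres_gsummap cls_trl.
  by rewrite mtr_gsummap mtr_id.
- rewrite -{1}(gcomp_idr q) -{1}(mres_id x) -copair_sum -mres_gsummap cls_trr.
  by rewrite mtr_gsummap mtr_id.
- rewrite -{1}(kact1 x) -{1}(rmorph1 (f A)) -jact jmor cls_act -jmor jact.
  by rewrite rmorph1 kact1.
Qed.

Let resp_l A' (q' : gmap A' X) (x' : M A') (y' : N A') :
  bresp (fun A (q : gmap A X) x y =>
    cls (copair q q') (mjoin x x') (mjoin y y')).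
Proof.
split=> [A1 B h q1 x1 y1|A1 B h q1 x1 y1|A1 q1 c x1 y1].
- rewrite -{1}(gcomp_idr q') -{1}(mres_id y') -copair_sum -mres_gsummap cls_trl.
  by rewrite mtr_gsummap mtr_id.
- rewrite -{1}(gcomp_idr q') -{1}(mres_id x') -copair_sum -mres_gsummap cls_trr.
  by rewrite mtr_gsummap mtr_id.
- rewrite -{1}(kact1 x') -{1}(rmorph1 (f A')) -jact jmor cls_act -jmor jact.
  by rewrite rmorph1 kact1.
Qed.

Definition badd (b b' : boxT X) : boxT X :=
  blift (fun A q x y => badd_rep q x y b') b.

Lemma badd_cls A A' (q : gmap A X) (q' : gmap A' X) x y x' y' :
  badd (cls q x y) (cls q' x' y') =
  cls (copair q q') (mjoin x x') (mjoin y y').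
Proof.
have rb b' : bresp (fun A (q : gmap A X) x y => badd_rep q x y b').
  elim/boxT_ind: b' => A1 q1 x1 y1; have [r1 r2 r3] := resp_l q1 x1 y1.
  by split=> *; rewrite /badd_rep !(bliftE (resp_r _ _ _)) ?r1 ?r2 ?r3.
by rewrite /badd (bliftE (rb _)) /badd_rep (bliftE (resp_r _ _ _)).
Qed.

Lemma badd_coprod A B C (i : gmap A C) (j : gmap B C) (q : gmap C X) x y :
  is_coproduct i j ->
  badd (cls (gcomp q i) (mres M i x) (mres N i y))
       (cls (gcomp q j) (mres M j x) (mres N j y)) = cls q x y.
Proof.
move=> ij; rewrite badd_cls -!mres_copair -copair_comp.
exact/cls_gbij/copair_gbij.
Qed.

(** Transfer along the fold map from A + A to A takes the pair (x, x') to x + x', while y on both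
    summands is the restriction of y. Additivity is thus an instance of [cls_trl]. *)
Lemma badd_l A (q : gmap A X) x x' y :
  badd (cls q x y) (cls q x' y) = cls q (x + x') y.
Proof.
rewrite badd_cls -{1 2}(gcomp_idr q) -copair_comp -{1 2}(mres_id y).
by rewrite -mres_copair cls_trl mtr_copair !mtr_id.
Qed.

Lemma badd_r A (q : gmap A X) x y y' :
  badd (cls q x y) (cls q x y') = cls q x (y + y').
Proof.
rewrite badd_cls -{1 2}(gcomp_idr q) -copair_comp -{1 2}(mres_id x).
by rewrite -mres_copair cls_trr mtr_copair !mtr_id.
Qed.

Lemma baddC : commutative badd.
Proof.
elim/boxT_ind => A q x y; elim/boxT_ind => A' q' x' y'.
rewrite !badd_cls.
pose s : gmap (gsum A A') (gsum A' A) := copair (ginr A' A) (ginl A' A).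
have sb : gbij s.
  apply: bij_gbij.
  by exists (copair (ginr A A') (ginl A A')) => -[].
rewrite -(cls_gbij (copair q' q) _ _ sb) !mres_copair.
rewrite !mres_inl_join !mres_inr_join.
by congr cls; apply: gmap_ext => -[].
Qed.

Lemma baddA : associative badd.
Proof.
elim/boxT_ind => A q x y; elim/boxT_ind => A' q' x' y'.
elim/boxT_ind => A2 q2 x2 y2; rewrite !badd_cls.
pose s : gmap (gsum (gsum A A') A2) (gsum A (gsum A' A2)) :=
  copair (copair (ginl _ _) (gcomp (ginr _ _) (ginl _ _)))
         (gcomp (ginr _ _) (ginr _ _)).
have sb : gbij s.
  apply: bij_gbij.
  by exists (copair (gcomp (ginl _ _) (ginl _ _))
    (copair (gcomp (ginl _ _) (ginr _ _)) (ginr _ _))) => [[[]|]|[|[]]].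
rewrite -(cls_gbij (copair q (copair q' q2)) _ _ sb) !mres_copair !mres_comp.
rewrite !(mres_inl_join, mres_inr_join).
by congr cls; apply: gmap_ext => -[[]|].
Qed.

Definition bzero : boxT X := cls (gvoid_to X) 0 0.

(** Zero is a transfer from the empty G-set, so [cls_trl] moves the whole tensor there. *)
Lemma cls0l A (q : gmap A X) y : cls q 0 y = bzero.
Proof.
rewrite -[0 in LHS](raddf0 (mtr M (gvoid_to A))) -cls_trl (mvoid (mres _ _ _)).
by congr cls; apply: gmap_ext => -[].
Qed.

Lemma add0b : left_id bzero badd.
Proof.
by elim/boxT_ind => A q x y; rewrite -(cls0l q y) badd_l add0r.
Qed.

Let opp_resp : bresp (fun A (q : gmap A X) x y => cls q (- x) y).
Proof.
split=> [A B h q x y|A B h q x y|A q c x y].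
- by rewrite cls_trl raddfN.
- by rewrite -raddfN cls_trr.
- by rewrite -kactN cls_act.
Qed.

Definition bopp (b : boxT X) : boxT X := blift (fun A q x y => cls q (- x) y) b.

Lemma addNb : left_inverse bzero bopp badd.
Proof.
elim/boxT_ind => A q x y; rewrite /bopp (bliftE opp_resp) badd_l addNr.
exact: cls0l.
Qed.

HB.instance Definition _ :=
  GRing.isZmodule.Build (boxT X) baddA baddC add0b addNb.

End Add.

Lemma box_cls0l X A (q : gmap A X) y : cls q 0 y = 0.
Proof. exact: cls0l. Qed.

Lemma box_addE X A A' (q : gmap A X) (q' : gmap A' X) x y x' y' :
  cls q x y + cls q' x' y' =
  cls (copair q q') (mjoin x x') (mjoin y y').
Proof. exact: badd_cls. Qed.

Lemma cls_coprod X A B C (i : gmap A C) (j : gmap B C) (q : gmap C X) x y :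
  is_coproduct i j ->
  cls q x y = cls (gcomp q i) (mres M i x) (mres N i y) +
              cls (gcomp q j) (mres M j x) (mres N j y).
Proof. by move=> ij; rewrite -(badd_coprod _ _ _ ij). Qed.

Lemma cls_addl X A (q : gmap A X) x x' y :
  cls q (x + x') y = cls q x y + cls q x' y.
Proof. by rewrite -badd_l. Qed.

Lemma cls_addr X A (q : gmap A X) x y y' :
  cls q x (y + y') = cls q x y + cls q x y'.
Proof. by rewrite -badd_r. Qed.

End Box.
Arguments bliftE {gT k R R' f f' M N X D F} HF {A} q x y.
Arguments blift {gT k R R' f f' M N X D} F b.

Section PackMorphisms.
Variables (U V : zmodType) (g : U -> V) (gD : {morph g : x y / x + y}).

Lemma pack_additive_subproof : {morph g : x y / x - y}.
Proof.
move=> x y; apply: (addIr (g y)).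
by rewrite -gD !subrK.
Qed.

Definition pack_additive : {additive U -> V} :=
  HB.pack g (GRing.isZmodMorphism.Build U V g pack_additive_subproof).
End PackMorphisms.

Section PackRmorphism.
Variables (U V : comPzRingType) (g : U -> V) (gD : {morph g : x y / x + y}).
Hypotheses (g1 : g 1 = 1) (gM : {morph g : x y / x * y}).

Definition pack_rmorphism : {rmorphism U -> V} :=
  HB.pack g (GRing.isZmodMorphism.Build U V g (pack_additive_subproof gD))
    (GRing.isMonoidMorphism.Build U V g (g1, gM)).
End PackRmorphism.

(** The pullback of q u along h factors through that of q, and the new square over u is again
    cartesian. Base change in it carries the defining relations of the box product to relations
    between restricted tensors. *)
Lemma pb_lift_sq (gT : finGroupType) (A B X X' P P' : gset gT) (u : gmap A B)
    (q : gmap B X) (h : gmap X' X) (a : gmap P B) (b : gmap P X')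
    (a' : gmap P' A) (b' : gmap P' X') :
    is_pullback a b q h -> is_pullback a' b' (gcomp q u) h ->
  exists v : gmap P' P,
    [/\ gcomp a v = gcomp u a', gcomp b v = b' & is_pullback a' v u a].
Proof.
move=> p1 p2.
have [v [va vb]] := pb_lift (u := gcomp u a') (v := b') p1 (proj1 p2).
exists v; split=> //; apply/is_pullback_sym.
apply: (pb_cancel (v := b) (w := h) (u := q)) => [x||].
- by exact: (gmap_app va x).
- exact: is_pullback_sym.
- by rewrite vb; exact: is_pullback_sym.
Qed.

(** * The Mackey functor underlying a box product *)

Section BoxFunctor.
Variables (gT : finGroupType) (k R R' : tambara gT).
Variables (f : tmap k R) (f' : tmap k R') (M : kmodule R) (N : kmodule R').
Local Notation gset := (gset gT).
Local Notation boxT := (boxT f f' M N).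
Local Notation cls := (@cls _ k R R' f f' M N _ _).
Implicit Types A B C P X Y Z : gset.

Section Res.
Variables (X' X : gset) (h : gmap X' X).

Let bres_rep A (q : gmap A X) (x : M A) (y : N A) : boxT X' :=
  cls (pb2 q h) (mres M (pb1 q h) x) (mres N (pb1 q h) y).

Let res_resp : bresp f f' bres_rep.
Proof.
split=> [A B u q x y|A B u q x y|A q c x y]; rewrite /bres_rep.
- have [v [va <- pP]] := pb_lift_sq (pbP q h) (pbP (gcomp q u) h).
  by rewrite -mres_comp -va mres_comp cls_trl -(mres_tr _ pP).
- have [v [va <- pP]] := pb_lift_sq (pbP q h) (pbP (gcomp q u) h).
  by rewrite -mres_comp -va mres_comp cls_trr -(mres_tr _ pP).
- by rewrite !res_kact -!tmap_res cls_act.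
Qed.

Definition bres (b : boxT X) : boxT X' := blift bres_rep b.

Lemma bresE A P (a : gmap P A) (b : gmap P X') (q : gmap A X) x y :
  is_pullback a b q h -> bres (cls q x y) = cls b (mres M a x) (mres N a y).
Proof.
move=> pP; rewrite /bres (bliftE res_resp) /bres_rep.
have [u [ub <- <-]] := pb_uniq pP (pbP q h).
by rewrite !mres_comp cls_gbij.
Qed.

Lemma bresD : {morph bres : b b' / b + b'}.
Proof.
elim/boxT_ind => A q x y; elim/boxT_ind => A' q' x' y'.
rewrite (bresE _ _ (pbP q h)) (bresE _ _ (pbP q' h)) !box_addE -!mres_gsummap.
apply: bresE.
apply: is_pullbackI => [[u|u] /=|[u|u] [v|v] //= [e1] e2|[z|z] t /= e].
- exact: (proj1 (pbP q h)).
- exact: (proj1 (pbP q' h)).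
- by congr inl; apply: (pb_ext (pbP q h)).
- by congr inr; apply: (pb_ext (pbP q' h)).
- by have [u [<- <-]] := pb_ex (pbP q h) e; exists (inl u).
- by have [u [<- <-]] := pb_ex (pbP q' h) e; exists (inr u).
Qed.
End Res.

Section Tr.
Variables (X X' : gset) (h : gmap X X').

Let tr_resp : bresp f f' (fun A (q : gmap A X) x y => cls (gcomp h q) x y).
Proof.
split=> [A B u q x y|A B u q x y|A q c x y].
- by rewrite gcompA cls_trl.
- by rewrite gcompA cls_trr.
- exact: cls_act.
Qed.

Definition btr (b : boxT X) : boxT X' :=
  blift (fun A q x y => cls (gcomp h q) x y) b.

Lemma btrE A (q : gmap A X) x y : btr (cls q x y) = cls (gcomp h q) x y.
Proof. exact: (bliftE tr_resp). Qed.

Lemma btrD : {morph btr : b b' / b + b'}.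
Proof.
elim/boxT_ind => A q x y; elim/boxT_ind => A' q' x' y'.
by rewrite box_addE !btrE box_addE copair_comp.
Qed.
End Tr.

Lemma box_void X (b : boxT X) : #|X| = 0%N -> b = 0.
Proof.
move=> X0; elim/boxT_ind: b => A q x y.
suff -> : x = 0 by rewrite box_cls0l.
apply: mackey0; apply: eq_card0 => a; case: (gset0_void (q a) X0).
Qed.

Lemma bres_id X (b : boxT X) : bres (gid X) b = b.
Proof.
elim/boxT_ind: b => A q x y.
by rewrite (bresE _ _ (pb_idr q)) !mres_id.
Qed.

Lemma bres_comp X Y Z (g : gmap Y Z) (u : gmap X Y) (b : boxT Z) :
  bres (gcomp g u) b = bres u (bres g b).
Proof.
elim/boxT_ind: b => A q x y.
rewrite (bresE _ _ (pbP q g)) (bresE _ _ (pbP _ u)) -!mres_comp.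
apply: bresE; apply: pb_paste (pbP _ _) _.
exact: pbP.
Qed.

Lemma btr_id X (b : boxT X) : btr (gid X) b = b.
Proof. by elim/boxT_ind: b => A q x y; rewrite btrE gcomp_idl. Qed.

Lemma btr_comp X Y Z (g : gmap Y Z) (u : gmap X Y) (b : boxT X) :
  btr (gcomp g u) b = btr g (btr u b).
Proof. by elim/boxT_ind: b => A q x y; rewrite !btrE gcompA. Qed.

Lemma bres_btr P A B C (a : gmap P A) (b : gmap P B) (u : gmap A C)
    (v : gmap B C) (t : boxT A) : is_pullback a b u v ->
  bres v (btr u t) = btr b (bres a t).
Proof.
move=> pP; elim/boxT_ind: t => D q x y; rewrite btrE.
rewrite (bresE _ _ (pbP q a)) btrE.
apply: bresE; apply/is_pullback_sym.
by have := pb_paste (is_pullback_sym (pbP q a)) (is_pullback_sym pP); exact.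
Qed.

Lemma box_mackey_axioms :
  @mackey_axioms gT boxT (fun X Y h => @bres X Y h) (fun X Y h => @btr X Y h).
Proof.
have btr0 X Y (h : gmap X Y) : btr h 0 = 0.
  by apply: (addIr (btr h 0)); rewrite -btrD !add0r.
have void0 (b : boxT (gvoid gT)) : b = 0 by apply/box_void/gvoid0.
split.
- exact: bres_id.
- exact: bres_comp.
- exact: btr_id.
- exact: btr_comp.
- by move=> P A B C a b u v pP t; exact: bres_btr.
- by move=> X X0 m; exact: box_void.
- move=> X Y Z i j ij; have [ii ji ijN] := coprod_inj ij.
  have jiN y x : j y <> i x by move/esym/ijN.
  exists (fun m => btr i m.1 + btr j m.2) => [|[m n]] /=.
    elim/boxT_ind => A q x y.
    rewrite !(bresE _ _ (pbP q _)) !btrE.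
    have -> : gcomp i (pb2 q i) = gcomp q (pb1 q i).
      by apply: gmap_ext => u; rewrite /= (proj1 (pbP q i)).
    have -> : gcomp j (pb2 q j) = gcomp q (pb1 q j).
      by apply: gmap_ext => u; rewrite /= (proj1 (pbP q j)).
    by rewrite -cls_coprod //; exact: pb_coprod ij (pbP _ _) (pbP _ _).
  rewrite !bresD (bres_btr _ (pb_inj ii)) (bres_btr _ (pb_inj ji)).
  rewrite !bres_id !btr_id.
  rewrite (bres_btr _ (pb_void jiN)) (bres_btr _ (pb_void ijN)).
  rewrite (void0 (bres (gvoid_to Y) n)) (void0 (bres (gvoid_to X) m)).
  by rewrite !btr0 addr0 add0r.
Qed.

Definition box_mackey : mackey gT :=
  @Mackey gT boxT (fun X Y h => pack_additive (@bresD X Y h))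
    (fun X Y h => pack_additive (@btrD X Y h)) box_mackey_axioms.

End BoxFunctor.
Arguments bresE {gT k R R' f f' M N X' X h A P a b q} x y _.
Arguments btrE {gT k R R' f f' M N X X'} h {A} q x y.
Arguments bres {gT k R R' f f' M N X' X} h b.
Arguments btr {gT k R R' f f' M N X X'} h b.

(** * Restriction of scalars *)

Section Restrict.
Variables (gT : finGroupType) (k R : tambara gT) (f : tmap k R).
Variable M : kmodule R.
Let act X (c : k X) (m : M X) : M X := kact (f X c) m.

Lemma restrict_actDl X (c d : k X) (m : M X) :
  act (c + d) m = act c m + act d m.
Proof. by rewrite /act rmorphD kactDl. Qed.
Lemma restrict_actDr X (c : k X) (m n : M X) :
  act c (m + n) = act c m + act c n.
Proof. exact: kactDr. Qed.
Lemma restrict_act1 X (m : M X) : act 1 m = m.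
Proof. by rewrite /act rmorph1 kact1. Qed.
Lemma restrict_actM X (c d : k X) (m : M X) : act (c * d) m = act c (act d m).
Proof. by rewrite /act rmorphM kactM. Qed.
Lemma restrict_res_act X Y (u : gmap X Y) (c : k Y) (m : M Y) :
  mres M u (act c m) = act (gres k u c) (mres M u m).
Proof. by rewrite /act res_kact tmap_res. Qed.
Lemma restrict_tr_actl X Y (u : gmap X Y) (c : k Y) (m : M X) :
  mtr M u (act (gres k u c) m) = act c (mtr M u m).
Proof. by rewrite /act tmap_res tr_kactl. Qed.
Lemma restrict_tr_actr X Y (u : gmap X Y) (c : k X) (m : M Y) :
  mtr M u (act c (mres M u m)) = act (gtr k u c) m.
Proof. by rewrite /act tr_kactr tmap_tr. Qed.

Definition restrict_mod : kmodule k :=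
  KModule restrict_actDl restrict_actDr restrict_act1 restrict_actM
    restrict_res_act restrict_tr_actl restrict_tr_actr.
End Restrict.

Definition restrict_map (gT : finGroupType) (k R : tambara gT) (f : tmap k R)
    (M N : kmodule R) (u : kmap M N) :
    kmap (restrict_mod f M) (restrict_mod f N) :=
  @KMap gT k (restrict_mod f M) (restrict_mod f N) (fun X => u X) (kmap_res u)
    (kmap_tr u) (fun X c m => kmap_act u (f X c) m).

(** * Actions on a box product and its universal property *)

Section BoxModule.
Variables (gT : finGroupType) (k R R' : tambara gT).
Variables (f : tmap k R) (f' : tmap k R') (M : kmodule R) (N : kmodule R').
Local Notation gset := (gset gT).
Local Notation boxT := (boxT f f' M N).
Local Notation cls := (@cls _ k R R' f f' M N _ _).
Implicit Types A B C P X Y Z : gset.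

Section PairAction.
Variables (X : gset) (r : R X) (s : R' X).

Let pact_rep A (q : gmap A X) (x : M A) (y : N A) : boxT X :=
  cls q (kact (gres R q r) x) (kact (gres R' q s) y).

Let pact_resp : bresp f f' pact_rep.
Proof.
split=> [A B u q x y|A B u q x y|A q c x y]; rewrite /pact_rep.
- by rewrite !gres_comp -res_kact cls_trl tr_kactl.
- by rewrite !gres_comp -res_kact cls_trr tr_kactl.
- by rewrite -kactM mulrC kactM cls_act -kactM mulrC kactM.
Qed.

(** The action of r (x) s, using both algebras at once. The R-module structure of a box product is
    the case s = 1, and the product of R (x)_k R is built from it. *)
Definition pact (t : boxT X) : boxT X := blift pact_rep t.

Lemma pactE A (q : gmap A X) x y :
  pact (cls q x y) = cls q (kact (gres R q r) x) (kact (gres R' q s) y).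
Proof. exact: (bliftE pact_resp). Qed.
End PairAction.

Lemma kact_mjoin (U : green gT) (L : kmodule U) A B C (i : gmap A C)
    (j : gmap B C) (c : U C) (x : L A) (y : L B) :
  kact (gres U (copair i j) c) (mjoin x y) =
  mjoin (kact (gres U i c) x) (kact (gres U j c) y).
Proof.
symmetry; apply: mjoin_uniq; rewrite res_kact -gres_comp.
  by rewrite mres_inl_join; congr (kact (gres U _ c) _); apply: gmap_ext.
by rewrite mres_inr_join; congr (kact (gres U _ c) _); apply: gmap_ext.
Qed.

Lemma pactD X (r : R X) (s : R' X) : {morph pact r s : t u / t + u}.
Proof.
elim/boxT_ind => A q x y; elim/boxT_ind => A' q' x' y'.
by rewrite box_addE !pactE box_addE !kact_mjoin.
Qed.

Lemma pact11 X (t : boxT X) : pact 1 1 t = t.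
Proof. by elim/boxT_ind: t => A q x y; rewrite pactE !rmorph1 !kact1. Qed.

Lemma pactM X (r r' : R X) (s s' : R' X) (t : boxT X) :
  pact (r * r') (s * s') t = pact r s (pact r' s' t).
Proof. by elim/boxT_ind: t => A q x y; rewrite !pactE !rmorphM !kactM. Qed.

Lemma pact_addl X (r r' : R X) (s : R' X) (t : boxT X) :
  pact (r + r') s t = pact r s t + pact r' s t.
Proof.
by elim/boxT_ind: t => A q x y; rewrite !pactE rmorphD kactDl cls_addl.
Qed.

Lemma pact_mor X (c : k X) (t : boxT X) : pact (f X c) 1 t = pact 1 (f' X c) t.
Proof.
elim/boxT_ind: t => A q x y; rewrite !pactE !rmorph1 !kact1.
by rewrite -!tmap_res cls_act.
Qed.

Lemma bres_pact X Y (h : gmap X Y) (r : R Y) (s : R' Y) (t : boxT Y) :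
  bres h (pact r s t) = pact (gres R h r) (gres R' h s) (bres h t).
Proof.
elim/boxT_ind: t => A q x y.
rewrite pactE !(bresE _ _ (pbP q h)) pactE -!gres_comp !res_kact -!gres_comp.
have -> // : gcomp q (pb1 q h) = gcomp h (pb2 q h).
by apply: gmap_ext => u; exact: (proj1 (pbP q h)).
Qed.

Lemma btr_pact X Y (h : gmap X Y) (r : R Y) (s : R' Y) (t : boxT X) :
  btr h (pact (gres R h r) (gres R' h s) t) = pact r s (btr h t).
Proof.
by elim/boxT_ind: t => A q x y; rewrite pactE !btrE pactE !gres_comp.
Qed.

Lemma btr_pactl X Y (h : gmap X Y) (r : R X) (s : R' Y) (t : boxT Y) :
  btr h (pact r (gres R' h s) (bres h t)) = pact (gtr R h r) s t.
Proof.
elim/boxT_ind: t => A q x y.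
rewrite (bresE _ _ (pbP q h)) pactE btrE -gres_comp.
have <- : gcomp q (pb1 q h) = gcomp h (pb2 q h).
  by apply: gmap_ext => u; exact: (proj1 (pbP q h)).
rewrite gres_comp -res_kact cls_trl tr_kactr pactE.
by rewrite (gres_tr _ (is_pullback_sym (pbP q h))).
Qed.

Lemma btr_pactr X Y (h : gmap X Y) (r : R Y) (s : R' X) (t : boxT Y) :
  btr h (pact (gres R h r) s (bres h t)) = pact r (gtr R' h s) t.
Proof.
elim/boxT_ind: t => A q x y.
rewrite (bresE _ _ (pbP q h)) pactE btrE -gres_comp.
have <- : gcomp q (pb1 q h) = gcomp h (pb2 q h).
  by apply: gmap_ext => u; exact: (proj1 (pbP q h)).
rewrite gres_comp -res_kact cls_trr tr_kactr pactE.
by rewrite (gres_tr _ (is_pullback_sym (pbP q h))).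
Qed.

Definition box_module : kmodule R.
Proof.
apply: (@KModule gT R (box_mackey f f' M N) (fun X r t => pact r 1 t)).
- by move=> X c d m; exact: pact_addl.
- by move=> X c m n; exact: pactD.
- by move=> X m; exact: pact11.
- by move=> X c d m; rewrite -pactM mulr1.
- by move=> X Y u c m; rewrite /= bres_pact rmorph1.
- by move=> X Y u c m; rewrite /= -btr_pact rmorph1.
- by move=> X Y u c m; rewrite /= -btr_pactl rmorph1.
Defined.

Lemma box_kactE X (r : R X) A (q : gmap A X) x y :
  @kact gT R box_module X r (cls q x y) = cls q (kact (gres R q r) x) y.
Proof. by rewrite [kact _ _]pactE rmorph1 kact1. Qed.

Definition bpure X (x : M X) (y : N X) : boxT X := cls (gid X) x y.

Lemma cls_pure X A (q : gmap A X) x y : cls q x y = btr q (bpure x y).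
Proof. by rewrite btrE gcomp_idr. Qed.

Lemma bpure_pairing :
  is_pairing (P := restrict_mod f box_module) (M := restrict_mod f M)
    (N := restrict_mod f' N) bpure.
Proof.
split=> [X m m' n|X m n n'|X c m n|X c m n|X Y h m n|X Y h m n|X Y h m n].
- exact: cls_addl.
- exact: cls_addr.
- by rewrite [RHS]pactE rmorph1 kact1 gres_id.
- by rewrite [RHS]pactE rmorph1 kact1 gres_id; exact/esym/cls_act.
- by rewrite [RHS](bresE _ _ (pb_idl h)).
- transitivity (cls (gcomp (gid Y) h) m (mres N h n)).
    by symmetry; apply: cls_trl.
  by rewrite [RHS]btrE gcomp_idr gcomp_idl.
- transitivity (cls (gcomp (gid Y) h) (mres M h m) n).
    by symmetry; apply: cls_trr.
  by rewrite [RHS]btrE gcomp_idr gcomp_idl.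
Qed.

Section Universal.
Variables (Q : kmodule k) (u : forall X, M X -> N X -> Q X).
Hypothesis uP :
  is_pairing (P := Q) (M := restrict_mod f M) (N := restrict_mod f' N) u.

(** A morphism extending u must commute with transfers, which forces tr_q (x (x) y) to go to tr_q (u
    x y). The pairing axioms say exactly that this respects the relations. *)
Lemma beval_resp X :
  bresp f f' (fun A (q : gmap A X) x y => mtr Q q (u x y)).
Proof.
split=> [A B h q x y|A B h q x y|A q c x y].
- by rewrite mtr_comp -(pair_trl uP).
- by rewrite mtr_comp -(pair_trr uP).
- by rewrite [u _ _](pair_actl uP) [u _ (kact _ _)](pair_actr uP).
Qed.

Definition beval X (b : boxT X) : Q X :=
  blift (fun A (q : gmap A X) x y => mtr Q q (u x y)) b.

Lemma bevalE X A (q : gmap A X) x y : beval (cls q x y) = mtr Q q (u x y).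
Proof. exact: (bliftE (beval_resp X)). Qed.

Lemma beval_pure X (x : M X) (y : N X) : beval (bpure x y) = u x y.
Proof. by rewrite bevalE mtr_id. Qed.

Lemma bevalD X : {morph @beval X : b b' / b + b'}.
Proof.
elim/boxT_ind => A q x y; elim/boxT_ind => A' q' x' y'.
rewrite box_addE !bevalE -mtr_copair; congr (mtr Q _ _).
symmetry; apply: mjoin_uniq; rewrite -(pair_res uP) /=.
  by rewrite !mres_inl_join.
by rewrite !mres_inr_join.
Qed.

Lemma beval_res X Y (h : gmap X Y) (b : boxT Y) :
  beval (bres h b) = mres Q h (beval b).
Proof.
elim/boxT_ind: b => A q x y; rewrite (bresE _ _ (pbP q h)) !bevalE.
by rewrite (mres_tr _ (pbP q h)) -(pair_res uP).
Qed.

Lemma beval_tr X Y (h : gmap X Y) (b : boxT X) :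
  beval (btr h b) = mtr Q h (beval b).
Proof. by elim/boxT_ind: b => A q x y; rewrite btrE !bevalE mtr_comp. Qed.

Lemma beval_act X (c : k X) (b : boxT X) :
  beval (pact (f X c) 1 b) = kact c (beval b).
Proof.
elim/boxT_ind: b => A q x y; rewrite pactE rmorph1 kact1 !bevalE -tmap_res.
by rewrite [u _ _](pair_actl uP) tr_kactl.
Qed.

Definition beval_kmap : kmap (restrict_mod f box_module) Q :=
  @KMap gT k (restrict_mod f box_module) Q (fun X => pack_additive (@bevalD X))
    beval_res beval_tr beval_act.
End Universal.

Lemma box_map_eq (Q : mackey gT) (h h' : forall X, boxT X -> Q X) :
    (forall X Y (q : gmap X Y) t, h Y (btr q t) = mtr Q q (h X t)) ->
    (forall X Y (q : gmap X Y) t, h' Y (btr q t) = mtr Q q (h' X t)) ->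
    (forall X (x : M X) (y : N X), h X (bpure x y) = h' X (bpure x y)) ->
  forall X t, h X t = h' X t.
Proof.
move=> H H' e X; elim/boxT_ind => A q x y.
by rewrite cls_pure H H' e.
Qed.

Lemma bpure_is_box :
  is_box (P := restrict_mod f box_module) (M := restrict_mod f M)
    (N := restrict_mod f' N) bpure.
Proof.
split=> [|Q u uP]; first exact: bpure_pairing.
exists (beval_kmap uP); split=> [X m n|h' h'u]; first exact: beval_pure.
apply: (box_map_eq (Q := Q)) => [X Y q t|X Y q t|X x y].
- exact: (kmap_tr h').
- exact: beval_tr.
- by rewrite h'u; symmetry; exact: beval_pure.
Qed.

End BoxModule.

Definition tid (gT : finGroupType) (R : tambara gT) : tmap R R :=
  @TMap gT R R (fun X => idfun) (fun X Y f x => erefl) (fun X Y f x => erefl)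
    (fun X Y f x => erefl).

(** * The Tambara functor R (x)_k R *)

Section SelfBox.
Variables (gT : finGroupType) (k R : tambara gT) (f : tmap k R).
Local Notation gset := (gset gT).
Local Notation L := (alg_module (tid R)).
Local Notation sb := (boxT f f L L).
Implicit Types A B C P X Y Z W : gset.

Definition scls X A (q : gmap A X) (x y : R A) : sb X :=
  cls f f (M := L) (N := L) q x y.

Definition spact X (r s : R X) (t : sb X) : sb X := pact r s t.

Lemma scls_trl X A B (h : gmap A B) (q : gmap B X) (x : R A) (y : R B) :
  scls (gcomp q h) x (gres R h y) = scls q (gtr R h x) y.
Proof. exact: (@cls_trl _ _ _ _ f f L L). Qed.

Lemma scls_trr X A B (h : gmap A B) (q : gmap B X) (x : R B) (y : R A) :
  scls (gcomp q h) (gres R h x) y = scls q x (gtr R h y).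
Proof. exact: (@cls_trr _ _ _ _ f f L L). Qed.

Lemma scls_act X A (q : gmap A X) (c : k A) (x y : R A) :
  scls q (f A c * x) y = scls q x (f A c * y).
Proof. exact: (@cls_act _ _ _ _ f f L L). Qed.

Lemma scls_addl X A (q : gmap A X) (x x' y : R A) :
  scls q (x + x') y = scls q x y + scls q x' y.
Proof. exact: (@cls_addl _ _ _ _ f f L L). Qed.

Lemma scls_addr X A (q : gmap A X) (x y y' : R A) :
  scls q x (y + y') = scls q x y + scls q x y'.
Proof. exact: (@cls_addr _ _ _ _ f f L L). Qed.

Lemma spactE X (r s : R X) A (q : gmap A X) (x y : R A) :
  spact r s (scls q x y) = scls q (gres R q r * x) (gres R q s * y).
Proof. exact: (@pactE _ _ _ _ f f L L). Qed.

Lemma sbres X X' (h : gmap X' X) A P (a : gmap P A) (b : gmap P X')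
    (q : gmap A X) (x y : R A) : is_pullback a b q h ->
  bres h (scls q x y) = scls b (gres R a x) (gres R a y).
Proof. exact: (@bresE _ _ _ _ f f L L). Qed.

Lemma sbtr X X' (h : gmap X X') A (q : gmap A X) (x y : R A) :
  btr h (scls q x y) = scls (gcomp h q) x y.
Proof. exact: (@btrE _ _ _ _ f f L L). Qed.

Lemma sb_ind X (S : sb X -> Prop) :
  (forall A (q : gmap A X) (x y : R A), S (scls q x y)) -> forall t, S t.
Proof. by move=> H; exact: (@boxT_ind _ _ _ _ f f L L X S H). Qed.

Lemma spactM X (r r' s s' : R X) (t : sb X) :
  spact (r * r') (s * s') t = spact r s (spact r' s' t).
Proof. exact: (@pactM _ _ _ _ f f L L). Qed.

Lemma spact11 X (t : sb X) : spact 1 1 t = t.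
Proof. exact: (@pact11 _ _ _ _ f f L L). Qed.

Lemma spactD X (r s : R X) : {morph spact r s : t u / t + u}.
Proof. exact: (@pactD _ _ _ _ f f L L). Qed.

Lemma spact_mor X (c : k X) (x y : R X) (t : sb X) :
  spact (f X c * x) y t = spact x (f X c * y) t.
Proof.
have H u : spact (f X c) 1 u = spact 1 (f X c) u.
  exact: (@pact_mor _ _ _ _ f f L L).
by rewrite -[y in LHS]mul1r spactM H -spactM mul1r.
Qed.

Lemma bres_spact X Y (h : gmap X Y) (r s : R Y) (t : sb Y) :
  bres h (spact r s t) = spact (gres R h r) (gres R h s) (bres h t).
Proof. exact: (@bres_pact _ _ _ _ f f L L). Qed.

Lemma btr_spact X Y (h : gmap X Y) (r s : R Y) (t : sb X) :
  btr h (spact (gres R h r) (gres R h s) t) = spact r s (btr h t).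
Proof. exact: (@btr_pact _ _ _ _ f f L L). Qed.

Lemma btr_spactl X Y (h : gmap X Y) (r : R X) (s : R Y) (t : sb Y) :
  btr h (spact r (gres R h s) (bres h t)) = spact (gtr R h r) s t.
Proof. exact: (@btr_pactl _ _ _ _ f f L L). Qed.

Lemma btr_spactr X Y (h : gmap X Y) (r : R Y) (s : R X) (t : sb Y) :
  btr h (spact (gres R h r) s (bres h t)) = spact r (gtr R h s) t.
Proof. exact: (@btr_pactr _ _ _ _ f f L L). Qed.

(* Frobenius reciprocity forces
   t * tr_q (x (x) y) = tr_q ((x (x) y) * res_q t). *)
Section Mul.
Variables (X : gset) (t : sb X).

Let smul_rep A (q : gmap A X) (x y : L A) : sb X :=
  btr q (spact (x : R A) (y : R A) (bres q t)).

Let smul_resp : bresp f f smul_rep.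
Proof.
split=> [A B h q x y|A B h q x y|A q c x y]; rewrite /smul_rep.
- by rewrite bres_comp btr_comp btr_spactl.
- by rewrite bres_comp btr_comp btr_spactr.
- by congr btr; exact: spact_mor.
Qed.

Definition smul (u : sb X) : sb X := blift smul_rep u.

Lemma smulE A (q : gmap A X) (x y : R A) :
  smul (scls q x y) = btr q (spact x y (bres q t)).
Proof. exact: (bliftE smul_resp). Qed.
End Mul.

Lemma smul_btr X Y (h : gmap X Y) (t : sb Y) (u : sb X) :
  smul t (btr h u) = btr h (smul (bres h t) u).
Proof.
elim/sb_ind: u => A q x y.
by rewrite sbtr !smulE btr_comp bres_comp.
Qed.

Lemma smul_spact X (r s : R X) (t u : sb X) :
  smul t (spact r s u) = spact r s (smul t u).
Proof.
elim/sb_ind: u => A q x y.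
by rewrite spactE !smulE spactM btr_spact.
Qed.

Lemma bres_smul X Y (h : gmap X Y) (t u : sb Y) :
  bres h (smul t u) = smul (bres h t) (bres h u).
Proof.
elim/sb_ind: u => A q x y.
rewrite (sbres _ _ (pbP q h)) !smulE -bres_comp.
have <- : gcomp q (pb1 q h) = gcomp h (pb2 q h).
  by apply: gmap_ext => u; exact: (proj1 (pbP q h)).
rewrite bres_comp -bres_spact.
exact: bres_btr (pbP q h).
Qed.

(** Both products are represented by the same tensor on the fibre product of A and A' over X. *)
Lemma smulC X : commutative (@smul X).
Proof.
elim/sb_ind => A q x y; elim/sb_ind => A' q' x' y'.
rewrite !smulE (sbres _ _ (pbP q q')) (sbres _ _ (is_pullback_sym (pbP q q'))).
rewrite !spactE !sbtr.
rewrite [gres R (pb1 _ _) x * _]mulrC [gres R (pb1 _ _) y * _]mulrC.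
congr scls; apply: gmap_ext => u /=; symmetry; exact: (proj1 (pbP q q')).
Qed.

Lemma smulA X : associative (@smul X).
Proof.
move=> t u; elim/sb_ind => A q x y.
by rewrite !(smulE _ q x y) smul_btr smul_spact bres_smul.
Qed.

Definition sone X : sb X := scls (gid X) 1 1.

Lemma smul1 X : left_id (@sone X) (@smul X).
Proof. by move=> t; rewrite smulC smulE btr_id bres_id spact11. Qed.

Lemma smulDl X : left_distributive (@smul X) +%R.
Proof.
move=> t u; elim/sb_ind => A q x y.
by rewrite !smulE bresD spactD btrD.
Qed.

Definition sb_ring X : comPzRingType :=
  HB.pack (sb X) (GRing.Zmodule_isComPzRing.Build (sb X)
    (@smulA X) (@smulC X) (@smul1 X) (@smulDl X)).

Lemma bres_one X Y (h : gmap X Y) : bres h (sone Y) = sone X.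
Proof. by rewrite (sbres _ _ (pb_idl h)) !rmorph1. Qed.

Lemma sb_frobenius X Y (h : gmap X Y) (t : sb X) (u : sb Y) :
  btr h (smul t (bres h u)) = smul (btr h t) u.
Proof. by rewrite [RHS]smulC smul_btr smulC. Qed.

Definition sb_green : green gT.
Proof.
apply: (@Green gT sb_ring
  (fun X Y h => @pack_rmorphism (sb_ring Y) (sb_ring X) (bres h)
     (@bresD _ _ _ _ f f L L X Y h) (bres_one h) (bres_smul h))
  (fun X Y h => @pack_additive (sb_ring X) (sb_ring Y) (btr h)
     (@btrD _ _ _ _ f f L L X Y h))).
- exact: (box_mackey_axioms f f L L).
- exact: sb_frobenius.
Defined.

(* The norm of tr_q (x (x) y) is forced by the distributive law [nm_tr]. *)
Section Norm.
Variables (X Y : gset) (h : gmap X Y).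

(** The value is specified against all exponential diagrams simultaneously, so that later
    computations may use whichever diagram is at hand. Independence of the diagram is
    [expo_uniq]. *)
Lemma snm_rep_subproof A (q : gmap A X) (x y : R A) :
  exists b : sb Y, forall Z W (e : gmap Z A) (p : gmap Z W) (pi : gmap W Y),
    expo q h e p pi -> b = scls pi (tnm p (gres R e x)) (tnm p (gres R e y)).
Proof.
have [Z [W [e [p [pi E]]]]] := expo_exists q h.
exists (scls pi (tnm p (gres R e x)) (tnm p (gres R e y))).
move=> Z' W' e' p' pi' E'.
have [v [u [vb <- <- pP]]] := expo_uniq E E'.
rewrite !gres_comp -!(res_nm pP).
exact: (@cls_gbij _ _ _ _ f f L L).
Qed.

Let snm_rep A (q : gmap A X) (x y : L A) : sb Y :=
  projT1 (cid (snm_rep_subproof q (x : R A) (y : R A))).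

Let snm_repE A (q : gmap A X) (x y : R A) Z W (e : gmap Z A) (p : gmap Z W)
    (pi : gmap W Y) : expo q h e p pi ->
  snm_rep q x y = scls pi (tnm p (gres R e x)) (tnm p (gres R e y)).
Proof. by rewrite /snm_rep; case: cid => b /= /[apply]. Qed.

Let snm_resp : bresp f f snm_rep.
Proof.
(* An exponential of (q u, h) is obtained by stacking one on top of that of
   (q, h); this turns the defining relations of the box product into each
   other under the norm. *)
have main A B (u : gmap A B) (q : gmap B X) : exists Z W Z2 W2 (e : gmap Z B)
    (p : gmap Z W) (pi : gmap W Y) (e3 : gmap Z2 A) (p2 : gmap Z2 W2)
    (pi2 : gmap W2 W),
    [/\ expo q h e p pi, expo (gcomp q u) h e3 p2 (gcomp pi pi2),
      forall x : R A,
        tnm p (gres R e (gtr R u x)) = gtr R pi2 (tnm p2 (gres R e3 x))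
    & forall y : R B, tnm p2 (gres R e3 (gres R u y)) =
        gres R pi2 (tnm p (gres R e y))].
  have [Z [W [e [p [pi E]]]]] := expo_exists q h.
  have pP := pbP u e.
  have [Z2 [W2 [e2 [p2 [pi2 E2]]]]] := expo_exists (pb2 u e) p.
  exists Z, W, Z2, W2, e, p, pi, (gcomp (pb1 u e) e2), p2, pi2; split=> //.
  - exact: expo_tr E pP E2.
  - move=> x; rewrite (gres_tr _ pP) gres_comp; apply: nm_tr; exact/expoP.
  - move=> y; rewrite (res_nm (expo_pb E2)) -!gres_comp.
    congr (tnm _ (gres R _ _)).
    by apply: gmap_ext => z /=; exact: (proj1 pP).
split=> [A B u q x y|A B u q x y|A q c x y].
- have [Z [W [Z2 [W2 [e [p [pi [e3 [p2 [pi2 [E E2 H1 H2]]]]]]]]]]] :=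
    main A B u q.
  rewrite (snm_repE _ _ E2) [RHS](snm_repE _ _ E) /= H1 H2.
  exact: scls_trl.
- have [Z [W [Z2 [W2 [e [p [pi [e3 [p2 [pi2 [E E2 H1 H2]]]]]]]]]]] :=
    main A B u q.
  rewrite (snm_repE _ _ E2) [RHS](snm_repE _ _ E) /= H1 H2.
  exact: scls_trr.
- have [Z [W [e [p [pi E]]]]] := expo_exists q h.
  rewrite !(snm_repE _ _ E) !rmorphM !nm_mul /= -!tmap_res -!tmap_nm.
  exact: scls_act.
Qed.

Definition snm (t : sb X) : sb Y := blift snm_rep t.

Lemma snmE A (q : gmap A X) (x y : R A) Z W (e : gmap Z A) (p : gmap Z W)
    (pi : gmap W Y) : expo q h e p pi ->
  snm (scls q x y) = scls pi (tnm p (gres R e x)) (tnm p (gres R e y)).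
Proof. by move=> E; rewrite /snm (bliftE snm_resp) (snm_repE _ _ E). Qed.
End Norm.

Lemma snm_spact X Y (h : gmap X Y) (r s : R X) (t : sb X) :
  snm h (spact r s t) = spact (tnm h r) (tnm h s) (snm h t).
Proof.
elim/sb_ind: t => A q x y; have [Z [W [e [p [pi E]]]]] := expo_exists q h.
rewrite spactE !(snmE _ _ E) spactE !rmorphM !nm_mul.
by rewrite !(res_nm (expo_pb E)) !gres_comp.
Qed.

Lemma snm_btr A X Y Z W (q : gmap A X) (h : gmap X Y) (e : gmap Z A)
    (p : gmap Z W) (pi : gmap W Y) (t : sb A) : expo q h e p pi ->
  snm h (btr q t) = btr pi (snm p (bres e t)).
Proof.
elim/sb_ind: t => A' q' x y E.
have [Z2 [W2 [e2 [p2 [pi2 E2]]]]] := expo_exists (pb2 q' e) p.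
rewrite sbtr (sbres _ _ (pbP q' e)) (snmE _ _ E2) sbtr.
by rewrite (snmE _ _ (expo_tr E (pbP q' e) E2)) !gres_comp.
Qed.

Lemma bres_snm P A B C (a : gmap P A) (b : gmap P B) (h : gmap A C)
    (g : gmap B C) (t : sb A) : is_pullback a b h g ->
  bres g (snm h t) = snm b (bres a t).
Proof.
elim/sb_ind: t => D q x y pP; have [Z [W [e [p [pi E]]]]] := expo_exists q h.
have pZ := pbP p (pb1 pi g).
have [e' [ee' E']] := expo_bc E pP (pbP q a) (pbP pi g) pZ.
rewrite (snmE _ _ E) (sbres _ _ (pbP pi g)) (sbres _ _ (pbP q a)) (snmE _ _ E').
by rewrite !(res_nm pZ) -!gres_comp ee'.
Qed.

(** Once the product is written as a transfer, the distributive law and base change for norms turn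
    its norm into the transfer that defines the product of the norms. *)
Lemma snm_smul X Y (h : gmap X Y) (t u : sb X) :
  snm h (smul t u) = smul (snm h t) (snm h u).
Proof.
elim/sb_ind: u => A q x y; have [Z [W [e [p [pi E]]]]] := expo_exists q h.
rewrite (smulE t q x y) (snm_btr _ E) bres_spact snm_spact -bres_comp.
by rewrite -(bres_snm _ (expo_pb E)) (snmE _ _ E) smulE.
Qed.

Definition sb_tambara : tambara gT.
Proof.
apply: (@Tambara gT sb_green snm).
- by move=> X Y h; rewrite [LHS](snmE _ _ (expo_idl h)) !gres_id !nm_one.
- exact: snm_smul.
- move=> X; elim/sb_ind => A q x y.
  by rewrite (snmE _ _ (expo_idr q)) !gres_id !nm_id.
- move=> X Y Z g h; elim/sb_ind => A q x y.
  have [Z0 [W [e [p [pi E]]]]] := expo_exists q h.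
  have [Z1 [W1 [e1 [p1 [pi1 E1]]]]] := expo_exists pi g.
  rewrite (snmE _ _ (expo_comp E E1 (pbP p e1))) (snmE _ _ E) (snmE _ _ E1).
  by rewrite !(res_nm (pbP p e1)) !nm_comp !gres_comp.
- by move=> P A B C a b h g pP t; exact: bres_snm.
- by move=> A X Y Z W q h e p pi /expoP E t; exact: snm_btr.
Defined.

Lemma sb_lin_add X : {morph (fun x : R X => scls (gid X) x 1) : x y / x + y}.
Proof. by move=> x y; exact: scls_addl. Qed.

Lemma sb_rin_add X : {morph (fun x : R X => scls (gid X) 1 x) : x y / x + y}.
Proof. by move=> x y; exact: scls_addr. Qed.

Lemma smul_pure X (x y x' y' : R X) :
  smul (scls (gid X) x y) (scls (gid X) x' y') = scls (gid X) (x * x') (y * y').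
Proof.
rewrite smulE btr_id bres_id spactE !gres_id.
by rewrite [x * _]mulrC [y * _]mulrC.
Qed.

Lemma sb_lin_mul X (x y : R X) :
  scls (gid X) (x * y) 1 = smul (scls (gid X) x 1) (scls (gid X) y 1).
Proof. by rewrite smul_pure mul1r. Qed.

Lemma sb_rin_mul X (x y : R X) :
  scls (gid X) 1 (x * y) = smul (scls (gid X) 1 x) (scls (gid X) 1 y).
Proof. by rewrite smul_pure mul1r. Qed.

Definition sb_lin : tmap R sb_tambara.
Proof.
apply: (@TMap gT R sb_tambara (fun X => @pack_rmorphism (R X) (sb_ring X)
  (fun x => scls (gid X) x 1) (@sb_lin_add X) erefl (@sb_lin_mul X))).
- by move=> X Y h x; rewrite [RHS](sbres _ _ (pb_idl h)) rmorph1.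
- move=> X Y h x; rewrite [RHS]sbtr gcomp_idr.
  by rewrite -[LHS]scls_trl gcomp_idl rmorph1.
- by move=> X Y h x; rewrite [RHS](snmE _ _ (expo_idl h)) !gres_id nm_one.
Defined.

Definition sb_rin : tmap R sb_tambara.
Proof.
apply: (@TMap gT R sb_tambara (fun X => @pack_rmorphism (R X) (sb_ring X)
  (fun x => scls (gid X) 1 x) (@sb_rin_add X) erefl (@sb_rin_mul X))).
- by move=> X Y h x; rewrite [RHS](sbres _ _ (pb_idl h)) rmorph1.
- move=> X Y h x; rewrite [RHS]sbtr gcomp_idr.
  by rewrite -[LHS]scls_trr gcomp_idl rmorph1.
- by move=> X Y h x; rewrite [RHS](snmE _ _ (expo_idl h)) !gres_id nm_one.
Defined.

Lemma sb_pure X (x y : R X) : sb_lin X x * sb_rin X y = scls (gid X) x y.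
Proof.
by have := smul_pure x 1 1 y; rewrite mulr1 mul1r; exact.
Qed.

Lemma sb_cls X A (q : gmap A X) (x y : R A) :
  scls q x y = gtr sb_tambara q (sb_lin A x * sb_rin A y).
Proof. by rewrite sb_pure [RHS]sbtr gcomp_idr. Qed.

(** * R (x)_k R as a pushout *)

Section Copairing.
Variables (U : tambara gT) (a b : tmap R U).
Hypothesis ab : forall X (c : k X), a X (f X c) = b X (f X c).

Let cop_rep X A (q : gmap A X) (x y : L A) : U X :=
  gtr U q (a A (x : R A) * b A (y : R A)).

Let cop_resp X : bresp f f (@cop_rep X).
Proof.
split=> [A B h q x y|A B h q x y|A q c x y]; rewrite /cop_rep.
- by rewrite gtr_comp /= tmap_tr tmap_res frobenius.
- rewrite gtr_comp /= tmap_tr tmap_res mulrC frobenius.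
  by rewrite [_ * a _ _]mulrC.
- congr (gtr U q _).
  by rewrite /= !rmorphM ab mulrCA mulrA.
Qed.

Definition sb_cop_fun X (t : sb X) : U X := blift (@cop_rep X) t.

Lemma sb_copE X A (q : gmap A X) (x y : R A) :
  sb_cop_fun (scls q x y) = gtr U q (a A x * b A y).
Proof. exact: (bliftE (@cop_resp X)). Qed.

Lemma sb_cop_tr X Y (h : gmap X Y) (t : sb X) :
  sb_cop_fun (btr h t) = gtr U h (sb_cop_fun t).
Proof. by elim/sb_ind: t => A q x y; rewrite sbtr !sb_copE gtr_comp. Qed.

Lemma sb_cop_res X Y (h : gmap X Y) (t : sb Y) :
  sb_cop_fun (bres h t) = gres U h (sb_cop_fun t).
Proof.
elim/sb_ind: t => A q x y; rewrite (sbres _ _ (pbP q h)) !sb_copE.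
by rewrite (gres_tr _ (pbP q h)) rmorphM !tmap_res.
Qed.

Lemma sb_cop_add X : {morph @sb_cop_fun X : t u / t + u}.
Proof.
elim/sb_ind => A q x y; elim/sb_ind => A' q' x' y'.
rewrite [scls q x y + _](@box_addE _ _ _ _ f f L L).
rewrite [sb_cop_fun (cls _ _ _ _ _)]sb_copE !sb_copE.
rewrite -[RHS](@mtr_copair _ (green_mackey U)).
congr (gtr U _ _); symmetry; apply: (mjoin_uniq (M := green_mackey U));
  rewrite /= rmorphM -!tmap_res.
  by rewrite ![gres R _ _](@mres_inl_join _ (green_mackey R)).
by rewrite ![gres R _ _](@mres_inr_join _ (green_mackey R)).
Qed.

Lemma sb_cop_mul X (t u : sb X) :
  sb_cop_fun (smul t u) = sb_cop_fun t * sb_cop_fun u.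
Proof.
have pc Y (x y : R Y) (v : sb Y) :
    sb_cop_fun (spact x y v) = a Y x * b Y y * sb_cop_fun v.
  elim/sb_ind: v => A q x' y'; rewrite spactE !sb_copE !rmorphM !tmap_res.
  rewrite [RHS]mulrC -frobenius; congr (gtr U q _).
  by rewrite rmorphM mulrACA mulrC.
elim/sb_ind: u => A q x y.
by rewrite smulE sb_cop_tr pc sb_cop_res frobenius sb_copE mulrC.
Qed.

Lemma sb_cop_one X : sb_cop_fun (sone X) = 1.
Proof. by rewrite sb_copE !rmorph1 mulr1 gtr_id. Qed.

(** Norms of transfers in U obey the distributive law, which is the same exponential formula that
    defines the norm on R (x)_k R. *)
Lemma sb_cop_nm X Y (h : gmap X Y) (t : sb X) :
  sb_cop_fun (snm h t) = tnm h (sb_cop_fun t).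
Proof.
elim/sb_ind: t => A q x y; have [Z [W [e [p [pi E]]]]] := expo_exists q h.
rewrite (snmE _ _ E) !sb_copE (nm_tr (proj2 (expoP _ _ _ _ _) E)).
by rewrite !tmap_nm !tmap_res rmorphM nm_mul.
Qed.

Definition sb_cop : tmap sb_tambara U :=
  @TMap gT sb_tambara U (fun X => @pack_rmorphism (sb_ring X) (U X)
    (@sb_cop_fun X) (@sb_cop_add X) (@sb_cop_one X) (@sb_cop_mul X))
    sb_cop_res sb_cop_tr sb_cop_nm.

End Copairing.

Lemma smul_pure_spact X (r s : R X) (t : sb X) :
  smul (scls (gid X) r s) t = spact r s t.
Proof. by rewrite smulC smulE btr_id bres_id. Qed.

Lemma sb_str_mul X (c : k X) (t : sb_tambara X) :
  sb_lin X (f X c) * t = spact (f X c) 1 t.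
Proof. exact: smul_pure_spact. Qed.

(** The actions on [alg_module f] and on the restriction of [L] along [f] agree by computation, so
    pairings pass from one to the other field by field and the universal property of [bpure]
    applies. *)
Lemma sb_is_box :
  @is_box gT k (alg_module f) (alg_module f) (alg_module (tcomp sb_lin f))
    (fun X (x y : R X) => sb_lin X x * sb_rin X y).
Proof.
split.
  have [p1 p2 p3 p4 p5 p6 p7] := bpure_pairing f f L L.
  split=> [X m m' n|X m n n'|X c m n|X c m n|X Y h m n|X Y h m n|X Y h m n].
  - by rewrite !sb_pure; exact: p1.
  - by rewrite !sb_pure; exact: p2.
  - by rewrite [RHS]sb_str_mul !sb_pure; exact: p3.
  - by rewrite [RHS]sb_str_mul !sb_pure; exact: p4.
  - by rewrite !sb_pure; exact: p5.
  - by rewrite !sb_pure; exact: p6.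
  - by rewrite !sb_pure; exact: p7.
move=> Q u [u1 u2 u3 u4 u5 u6 u7].
have uP : is_pairing (P := Q) (M := restrict_mod f L) (N := restrict_mod f L) u.
  by split.
pose ev := fun X (t : sb X) => beval (f := f) (f' := f) (M := L) (N := L) u t.
have evact X (c : k X) (t : sb X) :
    ev X (sb_lin X (f X c) * (t : sb_tambara X)) = kact c (ev X t).
  by rewrite sb_str_mul; exact: (beval_act uP).
exists (@KMap gT k (alg_module (tcomp sb_lin f)) Q
  (fun X => @pack_additive (sb_ring X) (Q X) (ev X) (bevalD uP (X := X)))
  (beval_res uP) (beval_tr uP) evact); split=> [X m n|h' h'u].
  by rewrite sb_pure; exact: (beval_pure uP).
apply: (@box_map_eq gT k R R f f L L Q (fun X => h' X) ev)
  => [X Y q t|X Y q t|X x y].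
- exact: (kmap_tr h' q t).
- exact: (beval_tr uP q t).
- transitivity (u X x y); last by symmetry; exact: (beval_pure uP).
  by have := h'u X x y; rewrite sb_pure; exact.
Qed.

Definition sb_mul : tmap sb_tambara R :=
  @sb_cop R (tid R) (tid R) (fun X c => erefl).

Lemma sb_mulE X (x y : R X) : sb_mul X (sb_lin X x * sb_rin X y) = x * y.
Proof. by rewrite sb_pure [LHS]sb_copE // gtr_id. Qed.

(** All that the study of differentials takes from the construction: every element is a transferred
    pure tensor, and two maps that agree on k extend to the box product. *)
Lemma self_box_pushout : exists B : self_box f,
  (forall X (t : B X), exists A (q : gmap A X) (x y : R A),
     t = gtr B q (sbox_l B A x * sbox_r B A y)) /\
  (forall (U : tambara gT) (a b : tmap R U),
     (forall X (c : k X), a X (f X c) = b X (f X c)) ->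
     exists h : tmap B U, forall X (x : R X),
       h X (sbox_l B X x) = a X x /\ h X (sbox_r B X x) = b X x).
Proof.
exists (@SelfBox gT k R f sb_tambara sb_lin sb_rin sb_is_box sb_mul sb_mulE).
split=> [X|U a b ab].
  elim/sb_ind => A q x y; exists A, q, x, y; exact: sb_cls.
exists (sb_cop ab) => X x; split; rewrite [LHS](sb_copE ab) rmorph1.
  by rewrite mulr1 gtr_id.
by rewrite mul1r gtr_id.
Qed.

End SelfBox.

(** * Differentials *)

Section Kahler.
Variable gT : finGroupType.
Implicit Types k R S U : tambara gT.

(** Tambara ideals are kernels, so every closure property that cosets of I^{>1} require reduces to
    additivity of morphisms. *)
Lemma kahler_zeroP k R (f : tmap k R) :
  kahler_zero f <-> forall (B : self_box f) X (x : B X),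
    mul_ideal (B := B) x -> ideal_gt1 (@mul_ideal _ _ _ _ B) x.
Proof.
have gt1_0 (B : self_box f) X : ideal_gt1 (@mul_ideal _ _ _ _ B) (0 : B X).
  by move=> J [U [h hJ]] _; rewrite hJ /tkernel /= raddf0.
split=> [kz B X x xI|H B X].
  have : kahler (B := B) (X := X) (kahler_class x) by exists x.
  rewrite kz /= => e.
  have : kahler_class x x by rewrite /kahler_class /= subrr; exact: gt1_0.
  by rewrite e /kahler_class /= subr0.
apply/seteqP; split=> [_ [x xI <-]|_ ->].
  apply/seteqP; split=> y yx J [U [h hJ]] JN; rewrite hJ /tkernel /=.
    have := yx J (ex_intro _ U (ex_intro _ h hJ)) JN.
    have := H B X x xI J (ex_intro _ U (ex_intro _ h hJ)) JN.
    by rewrite !hJ /tkernel /= subr0 => hx; rewrite raddfB /= hx subr0.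
  have := yx J (ex_intro _ U (ex_intro _ h hJ)) JN.
  have := H B X x xI J (ex_intro _ U (ex_intro _ h hJ)) JN.
  by rewrite !hJ /tkernel /= subr0 => hx hy; rewrite raddfB /= hx hy subr0.
by exists 0 => //; rewrite /mul_ideal /tkernel /= raddf0.
Qed.

(* The image in U, under the map R (x)_k R -> U induced by a and b, of the
   kernel of the multiplication. *)
Definition copair_ker R U (a b : tmap R U) X (u : U X) : Prop :=
  exists A (q : gmap A X) (x y : R A),
    u = gtr U q (a A x * b A y) /\ gtr R q (x * y) = 0.

(* The vanishing of the differentials makes k -> R formally unramified: two
   extensions that agree up to elements with vanishing nontrivial norms are
   equal. *)
Lemma kahler_zero_unramified k R (f : tmap k R) U (a b : tmap R U) :
    kahler_zero f ->
    (forall X (c : k X), a X (f X c) = b X (f X c)) ->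
    (forall X (u v : U X), gtransitive X -> copair_ker a b u ->
      copair_ker a b v -> u * v = 0) ->
    (forall X Y (h : gmap X Y) (u : U X), gtransitive X -> gtransitive Y ->
      ~ injective h -> copair_ker a b u -> tnm h u = 0) ->
  forall X (x : R X), a X x = b X x.
Proof.
move=> /kahler_zeroP kz ab Kmul Knm X x.
have [B [Bgen Buni]] := self_box_pushout f.
have [h hlr] := Buni U a b ab.
have kerE Y (t : B Y) : mul_ideal t -> copair_ker a b (h Y t).
  have [A [q [y [z ->]]]] := Bgen Y t.
  rewrite /mul_ideal /tkernel /= tmap_tr sbox_mulE => e.
  exists A, q, y, z; split=> //.
  by rewrite tmap_tr rmorphM; have [-> _] := hlr A y; have [_ ->] := hlr A z.
have mul_l : sbox_mul B X (sbox_l B X x) = x.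
  by have := sbox_mulE B x 1; rewrite rmorph1 !mulr1.
have mul_r : sbox_mul B X (sbox_r B X x) = x.
  by have := sbox_mulE B 1 x; rewrite rmorph1 !mul1r.
have : h X (sbox_l B X x - sbox_r B X x) = 0.
  (* The difference x (x) 1 - 1 (x) x lies in I, hence in I^{>1}, and the kernel of [h] is an ideal
     containing the nontrivial norms. *)
  apply: (kz B X _ _ (tkernel h)).
  - by rewrite /mul_ideal /tkernel /= raddfB /= mul_l mul_r subrr.
  - by exists U, h.
  - move=> Y t [t1 t2 tY /kerE k1 /kerE k2|Z u t1 tZ tY ui /kerE k1].
      by rewrite /tkernel /= rmorphM; exact: Kmul.
    by rewrite /tkernel /= tmap_nm; exact: Knm.
by rewrite raddfB /=; have [-> ->] := hlr X x; move/subr0_eq.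
Qed.

Lemma pairing_comp (k : green gT) (M N P Q : kmodule k)
    (t : forall X, M X -> N X -> P X) (h : kmap P Q) :
  is_pairing t -> is_pairing (fun X m n => h X (t X m n)).
Proof.
case=> t1 t2 t3 t4 t5 t6 t7.
split=> [X m m' n|X m n n'|X c m n|X c m n|X Y u m n|X Y u m n|X Y u m n].
- by rewrite t1 raddfD.
- by rewrite t2 raddfD.
- by rewrite t3 kmap_act.
- by rewrite t4 kmap_act.
- by rewrite t5 kmap_res.
- by rewrite t6 kmap_tr.
- by rewrite t7 kmap_tr.
Qed.

Lemma box_ext (k : green gT) (M N P Q : kmodule k)
    (t : forall X, M X -> N X -> P X) (h h' : kmap P Q) :
    is_box t -> (forall X m n, h X (t X m n) = h' X (t X m n)) ->
  forall X p, h X p = h' X p.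
Proof.
move=> [tP uni] e X p.
have [h0 [_ h0U]] := uni Q _ (pairing_comp h tP).
by rewrite (h0U h) // (h0U h').
Qed.

Definition alg_kmap k R U (s : tmap k R) (s' : tmap k U) (h : tmap R U)
    (hs : forall X (c : k X), h X (s X c) = s' X c) :
    kmap (alg_module s) (alg_module s').
Proof.
apply: (@KMap gT k (alg_module s) (alg_module s')
  (fun X => h X : {additive R X -> U X}) (tmap_res h) (tmap_tr h)).
by move=> X c m; rewrite /= rmorphM hs.
Defined.

Lemma kahler_zero_comp k R S (f : tmap k R) (g : tmap R S) :
  kahler_zero g -> kahler_zero f -> kahler_zero (tcomp g f).
Proof.
move=> kg kf; apply/kahler_zeroP => B X x xI J [U [h hJ]] JN; rewrite hJ.
have Jmul Y (t t' : B Y) : gtransitive Y -> mul_ideal (B := B) t ->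
    mul_ideal (B := B) t' -> h Y t * h Y t' = 0.
  move=> tY tI t'I; rewrite -rmorphM.
  by have := JN Y _ (NormProduct tY tI t'I); rewrite hJ.
have Jnm Y Z (v : gmap Y Z) (t : B Y) : gtransitive Y -> gtransitive Z ->
    ~ injective v -> mul_ideal (B := B) t -> tnm v (h Y t) = 0.
  move=> tY tZ vi tI; rewrite -tmap_nm.
  by have := JN Z _ (NormProper tY tZ vi tI); rewrite hJ.
pose a := tcomp h (sbox_l B); pose b := tcomp h (sbox_r B).
have mul_l Y (s : S Y) : sbox_mul B Y (sbox_l B Y s) = s.
  by rewrite -[sbox_l B Y s]mulr1 -(rmorph1 (sbox_r B Y)) sbox_mulE mulr1.
(* Replacing a and b by the two coprojections lifts u to [B]. Multiplication sends the lift to tr_q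
   (y z) = 0, so it lies in I. *)
have Kab Y (u : U Y) : copair_ker a b u ->
    exists t : B Y, mul_ideal (B := B) t /\ u = h Y t.
  move=> [A [q [y [z [-> e]]]]].
  exists (gtr B q (sbox_l B A y * sbox_r B A z)).
  rewrite /mul_ideal /tkernel /= !tmap_tr sbox_mulE; split=> //.
  by rewrite rmorphM.
(* Balancing over k, applied to 1 (x) 1, identifies the two images of c. *)
have ab_k Y (c : k Y) : a Y (tcomp g f Y c) = b Y (tcomp g f Y c).
  have [[_ _ p3 p4 _ _ _] _] := sbox_box B.
  have := p3 Y c 1 1; rewrite -p4 /= !mulr1 !rmorph1 mulr1 mul1r.
  by move/(congr1 (h Y)).
have ab_R : forall Y (r : R Y), a Y (g Y r) = b Y (g Y r).
  (* An element of [copair_ker] for the restrictions of a and b to R is one for a and b themselves,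
     with the tensors g y (x) g z; hence its nontrivial norms vanish. *)
  apply: (kahler_zero_unramified (a := tcomp a g) (b := tcomp b g) kf) => //.
  - move=> Y u v tY [A [q [y [z [-> e]]]]] [A' [q' [y' [z' [-> e']]]]].
    have [|t [tI ->]] := Kab Y (gtr U q (a A (g A y) * b A (g A z))).
      by exists A, q, (g A y), (g A z); rewrite -rmorphM -tmap_tr e raddf0.
    have [|t' [t'I ->]] := Kab Y (gtr U q' (a A' (g A' y') * b A' (g A' z'))).
      exists A', q', (g A' y'), (g A' z').
      by rewrite -rmorphM -tmap_tr e' raddf0.
    exact: Jmul.
  - move=> Y Z v u tY tZ vi [A [q [y [z [-> e]]]]].
    have [|t [tI ->]] := Kab Y (gtr U q (a A (g A y) * b A (g A z))).
      by exists A, q, (g A y), (g A z); rewrite -rmorphM -tmap_tr e raddf0.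
    exact: Jnm.
have ab_S : forall Y (s : S Y), a Y s = b Y s.
  apply: (kahler_zero_unramified kg) => //.
  - move=> Y u v tY /Kab[t [tI ->]] /Kab[t' [t'I ->]]; exact: Jmul.
  - move=> Y Z v u tY tZ vi /Kab[t [tI ->]]; exact: Jnm.
(* With a = b on S, the map [h] agrees with [a] after multiplication on pure tensors, hence
   everywhere by universality of the box product. It therefore kills I. *)
pose h1 := alg_kmap (s := tcomp (sbox_l B) (tcomp g f))
  (s' := tcomp a (tcomp g f)) (h := h) (fun Y c => erefl).
have h2P Y (c : k Y) :
    tcomp a (sbox_mul B) Y (tcomp (sbox_l B) (tcomp g f) Y c) =
    tcomp a (tcomp g f) Y c by rewrite /= mul_l.
have := box_ext (h := h1) (h' := alg_kmap h2P) (sbox_box B).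
rewrite /tkernel /= => -> => [|Y s s'] /=.
  by rewrite (_ : sbox_mul B X x = 0) ?raddf0.
by rewrite sbox_mulE rmorphM -[h Y (sbox_r B Y s')]/(b Y s') -ab_S /= -!rmorphM.
Qed.

End Kahler.

(** * Flatness *)

Section ModuleMaps.
Variables (gT : finGroupType) (k : green gT).
Implicit Types M N P Q A B C : kmodule k.

Definition kid M : kmap M M :=
  @KMap gT k M M (fun X => idfun) (fun X Y f m => erefl) (fun X Y f m => erefl)
    (fun X c m => erefl).

Definition kcomp M N P (v : kmap N P) (u : kmap M N) : kmap M P.
Proof.
apply: (@KMap gT k M P (fun X => v X \o u X : {additive M X -> P X})).
- by move=> X Y f m; rewrite /= !kmap_res.
- by move=> X Y f m; rewrite /= !kmap_tr.
- by move=> X c m; rewrite /= !kmap_act.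
Defined.

Lemma box_iso M N P P' (t : forall X, M X -> N X -> P X)
    (t' : forall X, M X -> N X -> P' X) :
    is_box t -> is_box t' ->
  exists h : kmap P P', (forall X m n, h X (t X m n) = t' X m n) /\
    forall X, bijective (h X).
Proof.
move=> tb tb'; have [tP uni] := tb; have [tP' uni'] := tb'.
have [h [hE _]] := uni _ _ tP'; have [h' [hE' _]] := uni' _ _ tP.
exists h; split=> // X; exists (h' X) => x.
  have := box_ext (h := kcomp h' h) (h' := kid P) tb; apply=> Y m n /=.
  by rewrite hE hE'.
have := box_ext (h := kcomp h h') (h' := kid P') tb'; apply=> Y m n /=.
by rewrite hE' hE.
Qed.

Lemma short_exact_iso A B C A' B' C' (u : kmap A B) (v : kmap B C)
    (u' : kmap A' B') (v' : kmap B' C') (a : kmap A A') (b : kmap B B')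
    (c : kmap C C') :
    (forall X, bijective (a X)) -> (forall X, bijective (b X)) ->
    (forall X, bijective (c X)) ->
    (forall X x, b X (u X x) = u' X (a X x)) ->
    (forall X x, c X (v X x) = v' X (b X x)) ->
  short_exact u' v' -> short_exact u v.
Proof.
move=> ab bb cb bu cv ex X; have [ui im vs] := ex X.
have [a' aK aK'] := ab X; have [b' bK bK'] := bb X; have [c' cK cK'] := cb X.
split=> [x y e|y|z].
- by apply: (can_inj aK); apply: ui; rewrite -!bu e.
- split=> [vy|[x <-]].
    have /im[x ex'] : v' X (b X y) = 0 by rewrite -cv vy raddf0.
    by exists (a' x); apply: (can_inj bK); rewrite bu aK'.
  by apply: (can_inj cK); rewrite cv bu raddf0; apply/im; exists (a X x).
- have [y ey] := vs (c X z).
  by exists (b' y); apply: (can_inj cK); rewrite cv bK'.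
Qed.
End ModuleMaps.

(** * Extension of scalars *)

Section ExtensionOfScalars.
Variables (gT : finGroupType) (k R : tambara gT) (f : tmap k R).
Implicit Types N : kmodule k.

Definition ext_mod N : kmodule R :=
  box_module f (tid k) (alg_module (tid R)) N.

Definition ext_pure N X (r : R X) (n : N X) : ext_mod N X :=
  bpure f (tid k) (M := alg_module (tid R)) r n.

Lemma ext_is_box N :
  is_box (M := alg_module f) (P := restrict_mod f (ext_mod N)) (@ext_pure N).
Proof.
have [[p1 p2 p3 p4 p5 p6 p7] uni] :=
  bpure_is_box f (tid k) (alg_module (tid R)) N.
split=> [|Q u [u1 u2 u3 u4 u5 u6 u7]]; first by split.
by apply: uni; split.
Qed.

Lemma ext_ind N (S : forall X, ext_mod N X -> Prop) :
    (forall X Y (q : gmap X Y) (r : R X) (n : N X),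
      S Y (mtr (ext_mod N) q (ext_pure r n))) ->
  forall X t, S X t.
Proof.
move=> H X.
apply: (@boxT_ind _ _ _ _ f (tid k) (alg_module (tid R)) N X (@S X)).
by move=> A q x y; rewrite cls_pure; exact: H.
Qed.

Lemma ext_act_pure N X (r s : R X) (n : N X) :
  kact r (ext_pure s n) = ext_pure (r * s) n.
Proof. by rewrite [LHS]box_kactE gres_id. Qed.

Lemma ext_act_tr N X Y (q : gmap X Y) (r : R Y) (s : R X) (n : N X) :
  kact r (mtr (ext_mod N) q (ext_pure s n)) =
  mtr (ext_mod N) q (ext_pure (gres R q r * s) n).
Proof. by rewrite -tr_kactl ext_act_pure. Qed.

End ExtensionOfScalars.

Section ExtensionUniversal.
Variables (gT : finGroupType) (k R : tambara gT) (f : tmap k R) (N : kmodule k).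

(** The universal k-linear map is R-linear as soon as u is R-linear in its first variable: on a
    transferred pure tensor the scalar is restricted and absorbed into the first factor. *)
Lemma ext_lift (Q : kmodule R) (u : forall X, R X -> N X -> Q X) :
    is_pairing (M := alg_module f) (N := N) (P := restrict_mod f Q) u ->
    (forall X (r s : R X) (n : N X), u X (r * s) n = kact r (u X s n)) ->
  exists h : kmap (ext_mod f N) Q, forall X r n, h X (ext_pure f r n) = u X r n.
Proof.
move=> uP ulin; have [_ uni] := ext_is_box f N; have [h [hE _]] := uni _ _ uP.
have hact X (r : R X) (t : ext_mod f N X) :
    (h X : ext_mod f N X -> Q X) (kact r t) = kact r (h X t : Q X).
  move: X t r; apply: ext_ind => X Y q s n r.
  have htr (t : ext_mod f N X) : h Y (mtr (ext_mod f N) q t) = mtr Q q (h X t).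
    exact: (kmap_tr h q t).
  by rewrite ext_act_tr !htr !hE ulin tr_kactl.
by exists (@KMap gT R (ext_mod f N) Q (fun X => h X) (kmap_res h) (kmap_tr h)
  hact).
Qed.

Lemma ext_map_eq (Q : kmodule R) (h h' : kmap (ext_mod f N) Q) :
    (forall X r n, h X (ext_pure f r n) = h' X (ext_pure f r n)) ->
  forall X t, h X t = h' X t.
Proof.
by move=> e; apply: ext_ind => X Y q r n; rewrite !kmap_tr e.
Qed.

End ExtensionUniversal.

Section ExtensionMap.
Variables (gT : finGroupType) (k R : tambara gT) (f : tmap k R).

Lemma ext_map_exists (N N' : kmodule k) (u : kmap N N') :
  exists h : kmap (ext_mod f N) (ext_mod f N'),
    forall X r n, h X (ext_pure f r n) = ext_pure f r (u X n).
Proof.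
have [[p1 p2 p3 p4 p5 p6 p7] _] := ext_is_box f N'.
apply: ext_lift => [|X r s n]; last by rewrite ext_act_pure.
split=> [X m m' n|X m n n'|X c m n|X c m n|X Y h m n|X Y h m n|X Y h m n].
- exact: p1.
- by rewrite raddfD; exact: p2.
- exact: p3.
- by rewrite kmap_act; exact: p4.
- by rewrite kmap_res; exact: p5.
- by rewrite kmap_res; exact: p6.
- by rewrite kmap_tr; exact: p7.
Qed.

Definition ext_map N N' (u : kmap N N') : kmap (ext_mod f N) (ext_mod f N') :=
  projT1 (cid (ext_map_exists u)).

Lemma ext_mapE N N' (u : kmap N N') X r n :
  ext_map u X (ext_pure f r n) = ext_pure f r (u X n).
Proof. by rewrite /ext_map; case: cid. Qed.

End ExtensionMap.

(** * Transitivity of extension of scalars and composition of flat morphisms *)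

Section Transitivity.
Variables (gT : finGroupType) (k R S : tambara gT).
Variables (f : tmap k R) (g : tmap R S).
Local Notation gf := (tcomp g f).

Lemma ext_unit_exists (N : kmodule k) :
  exists h : kmap (ext_mod f N) (restrict_mod g (ext_mod gf N)),
    forall X r n, h X (ext_pure f r n) = ext_pure gf (g X r) n.
Proof.
have [[p1 p2 p3 p4 p5 p6 p7] _] := ext_is_box gf N.
apply: ext_lift => [|X r s n]; last first.
  by rewrite rmorphM; symmetry; apply: ext_act_pure.
split=> [X m m' n|X m n n'|X c m n|X c m n|X Y h m n|X Y h m n|X Y h m n].
- by rewrite rmorphD; exact: p1.
- exact: p2.
- rewrite -p3; congr ext_pure; exact: rmorphM.
- exact: p4.
- rewrite -p5; congr ext_pure; exact: tmap_res.
- rewrite -p6; congr ext_pure; exact: tmap_tr.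
- rewrite p7; congr (mtr _ _ (ext_pure _ _ _)); symmetry; exact: tmap_res.
Qed.

Definition ext_unit N : kmap (ext_mod f N) (restrict_mod g (ext_mod gf N)) :=
  projT1 (cid (ext_unit_exists N)).

Lemma ext_unitE N X r n : ext_unit N X (ext_pure f r n) = ext_pure gf (g X r) n.
Proof. by rewrite /ext_unit; case: cid. Qed.

(** The pairing s (x) (r (x) n) |-> s g(r) (x) n, which exhibits S (x)_k N as the box product of S
    and R (x)_k N over R. *)
Definition ext_trans_pair (N : kmodule k) X (s : S X) (t : ext_mod f N X) :
    ext_mod gf N X :=
  kact s (ext_unit N X t : ext_mod gf N X).

Lemma ext_trans_pairing N :
  is_pairing (M := alg_module g) (N := ext_mod f N)
    (P := restrict_mod g (ext_mod gf N)) (@ext_trans_pair N).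
Proof.
pose E := ext_mod gf N.
split=> [X m m' n|X m n n'|X c m n|X c m n|X Y h m n|X Y h m n|X Y h m n];
  rewrite /ext_trans_pair.
- exact: (@kactDl gT S E X m m').
- by rewrite raddfD; exact: (@kactDr gT S E X m).
- exact: (@kactM gT S E X (g X c) m).
- rewrite kmap_act; transitivity (kact (m * g X c) (ext_unit N X n : E X)).
    by symmetry; exact: (@kactM gT S E X m (g X c)).
  by rewrite mulrC; exact: (@kactM gT S E X (g X c) m).
- by rewrite kmap_res; symmetry; exact: (@res_kact gT S E X Y h m).
- by rewrite kmap_res; symmetry; exact: (@tr_kactr gT S E X Y h m).
- by rewrite kmap_tr; symmetry; exact: (@tr_kactl gT S E X Y h m).
Qed.

(** Restricting a pairing u on S and R (x)_k N along n |-> 1 (x) n gives a pairing on S and N over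
    k, to which the universal property of S (x)_k N applies. R-balancing recovers u, since s (x) (r
    (x) n) = s g(r) (x) (1 (x) n). *)
Lemma ext_trans_is_box N :
  is_box (M := alg_module g) (N := ext_mod f N)
    (P := restrict_mod g (ext_mod gf N)) (@ext_trans_pair N).
Proof.
split=> [|Q u uP]; first exact: ext_trans_pairing.
pose eta X (n : N X) : ext_mod f N X := ext_pure f 1 n.
have [[p1 p2 p3 p4 p5 p6 p7] _] := ext_is_box f N.
have wP : is_pairing (M := alg_module gf) (N := N)
    (P := restrict_mod f Q) (fun X (s : S X) n => u X s (eta X n)).
  split=> [X m m' n|X m n n'|X c m n|X c m n|X Y h m n|X Y h m n|X Y h m n].
  - exact: (pairDl uP).
  - by rewrite /eta [ext_pure _ _ _]p2; exact: (pairDr uP).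
  - exact: (pair_actl uP (f X c)).
  - by rewrite /eta [ext_pure _ _ _]p4; exact: (pair_actr uP).
  - have -> : eta X (mres N h n) = mres (ext_mod f N) h (eta Y n).
      rewrite /eta -[RHS]p5; congr ext_pure; symmetry; exact: rmorph1.
    exact: (pair_res uP).
  - have -> : eta X (mres N h n) = mres (ext_mod f N) h (eta Y n).
      rewrite /eta -[RHS]p5; congr ext_pure; symmetry; exact: rmorph1.
    exact: (pair_trl uP).
  - have -> : eta Y (mtr N h n) = mtr (ext_mod f N) h (eta X n).
      rewrite /eta [LHS]p7; congr (mtr _ _ (ext_pure _ _ _)); exact: rmorph1.
    exact: (pair_trr uP).
have [_ uni] := ext_is_box gf N; have [h [hE _]] := uni _ _ wP.
have htr X Y (q : gmap X Y) (t : ext_mod gf N X) :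
    h Y (mtr (ext_mod gf N) q t) = mtr Q q (h X t) by exact: (kmap_tr h q t).
have hact X (r : R X) (t : ext_mod gf N X) :
    h X (kact (g X r) t : ext_mod gf N X) = kact r (h X t : Q X).
  move: X t r; apply: ext_ind => X Y q s n r.
  rewrite ext_act_tr !htr !hE -tmap_res.
  by rewrite [u _ _ _](pair_actl uP) tr_kactl.
pose h0 := @KMap gT R (restrict_mod g (ext_mod gf N)) Q (fun X => h X)
  (kmap_res h) (kmap_tr h) hact.
have pureE X (s : S X) (n : N X) : ext_pure gf s n = ext_trans_pair s (eta X n).
  by rewrite /ext_trans_pair ext_unitE rmorph1 ext_act_pure mulr1.
exists h0; split=> [X s t|h' h'E].
  move: X t s; apply: ext_ind => X Y q r n s.
  rewrite (pair_trr uP) /ext_trans_pair kmap_tr ext_unitE.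
  rewrite [kact _ _]ext_act_tr [LHS]htr hE; congr (mtr Q q _).
  rewrite mulrC [LHS](pair_actl uP) -(pair_actr uP); congr u.
  by rewrite ext_act_pure mulr1.
apply: ext_ind => X Y q s n; rewrite [RHS]htr hE.
have := kmap_tr h' q (ext_pure gf s n); rewrite /= => ->.
by rewrite pureE h'E.
Qed.

Lemma ext_trans_natural N N' (u : kmap N N') X (s : S X) (t : ext_mod f N X) :
  ext_map gf u X (ext_trans_pair s t) = ext_trans_pair s (ext_map f u X t).
Proof.
rewrite /ext_trans_pair kmap_act; congr (kact s _).
have := ext_map_eq (h := kcomp (restrict_map g (ext_map gf u)) (ext_unit N))
  (h' := kcomp (ext_unit N') (ext_map f u)); apply=> Y r n /=.
by rewrite ext_unitE !ext_mapE ext_unitE.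
Qed.

Lemma flat_comp : flat g -> flat f -> flat (tcomp g f).
Proof.
move=> fg ff A B C u v ex MA MB MC Mu Mv indu indv.
(* Exactness is a levelwise condition, so the sequence obtained from flatness over k is also exact
   as a sequence of R-modules, and flatness over R applies to it. *)
have exR : short_exact (ext_map f u) (ext_map f v).
  apply: (ff _ _ _ u v ex (BoxProduct (ext_is_box f A))
    (BoxProduct (ext_is_box f B)) (BoxProduct (ext_is_box f C))
    (restrict_map f (ext_map f u))
    (restrict_map f (ext_map f v))) => X m n; exact: ext_mapE.
have exS : short_exact (restrict_map gf (ext_map gf u))
    (restrict_map gf (ext_map gf v)).
  apply: (fg _ _ _ _ _ exR (BoxProduct (ext_trans_is_box A))
    (BoxProduct (ext_trans_is_box B)) (BoxProduct (ext_trans_is_box C))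
    (restrict_map g (ext_map gf u)) (restrict_map g (ext_map gf v))) => X m n;
  exact: ext_trans_natural.
(* The given box products are isomorphic to the constructed ones, and the induced maps correspond
   because they agree on pure tensors. *)
have [a [aE ab]] := box_iso (box_univ MA) (ext_is_box gf A).
have [b [bE bb]] := box_iso (box_univ MB) (ext_is_box gf B).
have [c [cE cb]] := box_iso (box_univ MC) (ext_is_box gf C).
apply: short_exact_iso ab bb cb _ _ exS => X x.
- have := box_ext (h := kcomp b Mu)
    (h' := kcomp (restrict_map gf (ext_map gf u)) a) (box_univ MA);
    apply=> Y m n /=.
  by rewrite indu bE aE; symmetry; apply: ext_mapE.
- have := box_ext (h := kcomp c Mv)
    (h' := kcomp (restrict_map gf (ext_map gf v)) b) (box_univ MB);
    apply=> Y m n /=.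
  by rewrite indv cE bE; symmetry; apply: ext_mapE.
Qed.

End Transitivity.

(** * Finite presentation *)

Section Terms.
Variables (gT : finGroupType) (k : tambara gT) (I : finType) (Y : I -> gset gT).
Local Notation gset := (gset gT).
Local Notation talg := (talgebra k).
Implicit Types X Z : gset.

(** Formal expressions in the Tambara operations, subject to no axioms; all equations enter through
    [teq]. *)
Inductive term : gcode gT -> Type :=
| TConst (c : gcode gT) (x : k c) : term c
| TVar (c : gcode gT) (i : I) (h : gmap c (Y i)) : term c
| TAdd (c : gcode gT) (t u : term c) : term c
| TOpp (c : gcode gT) (t : term c) : term c
| TMul (c : gcode gT) (t u : term c) : term c
| TRes (c d : gcode gT) (h : gmap c d) (t : term d) : term c
| TTr (c d : gcode gT) (h : gmap c d) (t : term c) : term d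
| TNm (c d : gcode gT) (h : gmap c d) (t : term c) : term d.

Fixpoint eval (A : talg) (a : forall i, A (Y i)) c (t : term c) : A c :=
  match t in term c return A c with
  | TConst c x => astr A c x
  | TVar c i h => gres A h (a i)
  | TAdd c t u => eval a t + eval a u
  | TOpp c t => - eval a t
  | TMul c t u => eval a t * eval a u
  | TRes c d h t => gres A h (eval a t)
  | TTr c d h t => gtr A h (eval a t)
  | TNm c d h t => tnm h (eval a t)
  end.

(* The k-algebra presented by the class C of its models: two terms are equal
   when they have the same value in every member of C. *)
Variable C : forall A : talg, (forall i, A (Y i)) -> Prop.

Definition teq c (t u : term c) : Prop :=
  forall (A : talg) a, C (A := A) a -> eval a t = eval a u.

Definition tquot X := {S : term (code X) -> Prop | exists t, S = teq t}.

HB.instance Definition _ X := gen_eqMixin (tquot X).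
HB.instance Definition _ X := gen_choiceMixin (tquot X).

Definition tclass X (t : term (code X)) : tquot X :=
  exist _ (teq t) (ex_intro _ t erefl).
Definition trepr X (b : tquot X) : term (code X) := projT1 (cid (svalP b)).

Definition tev (A : talg) (a : forall i, A (Y i)) X (b : tquot X) : A X :=
  gres A (cin X) (eval a (trepr b)).

Lemma tev_class (A : talg) a X (t : term (code X)) :
  C (A := A) a -> tev a (tclass t) = gres A (cin X) (eval a t).
Proof.
move=> Ca; rewrite /tev /trepr; case: (cid _) => u /= e; congr (gres A _ _).
have tu : teq t u by rewrite e.
by rewrite (tu A a Ca).
Qed.

(** The models separate points. Every identity below is checked by evaluating in a model and using
    the corresponding identity there. *)
Lemma tev_sep X (b b' : tquot X) :
  (forall (A : talg) a, C (A := A) a -> tev a b = tev a b') -> b = b'.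
Proof.
move=> H; have {H} e : teq (trepr b) (trepr b').
  move=> A a Ca; have := congr1 (gres A (cout X)) (H A a Ca).
  by rewrite /tev -!gres_comp coutK !gres_id.
have tK (d : tquot X) : tclass (trepr d) = d.
  by case: d => S p; rewrite /trepr; case: (cid _) => t /= et; apply: eq_exist.
rewrite -(tK b) -(tK b'); apply: eq_exist.
apply: funext => v; apply: propext; split=> H A a Ca.
  by rewrite -(e A a Ca) (H A a Ca).
by rewrite (e A a Ca) (H A a Ca).
Qed.

Let cod X Z (h : gmap X Z) : gmap (code X) (code Z) :=
  gcomp (cin Z) (gcomp h (cout X)).

Let cod_pb X Z (h : gmap X Z) : is_pullback (cin X) h (cod h) (cin Z).
Proof.
apply: pb_gbij_sq; [|exact: cin_gbij|exact: cin_gbij] => x /=.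
by rewrite enum_rankK.
Qed.

Definition tconst X (x : k X) : tquot X := tclass (TConst (gres k (cout X) x)).
Definition tvar i : tquot (Y i) := tclass (TVar (cout (Y i))).
Definition tadd X (b b' : tquot X) := tclass (TAdd (trepr b) (trepr b')).
Definition topp X (b : tquot X) := tclass (TOpp (trepr b)).
Definition tmul X (b b' : tquot X) := tclass (TMul (trepr b) (trepr b')).
Definition tres X Z (h : gmap X Z) (b : tquot Z) :=
  tclass (TRes (cod h) (trepr b)).
Definition ttr X Z (h : gmap X Z) (b : tquot X) :=
  tclass (TTr (cod h) (trepr b)).
Definition tnorm X Z (h : gmap X Z) (b : tquot X) :=
  tclass (TNm (cod h) (trepr b)).
(* [code c] is isomorphic but not equal to [c]. *)
Definition tlift (c : gcode gT) (t : term c) : tquot c :=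
  tclass (TRes (cout c) t).

Section Ev.
Variables (A : talg) (a : forall i, A (Y i)).
Hypothesis Ca : C a.

Lemma tev_const X (x : k X) : tev a (tconst x) = astr A X x.
Proof. by rewrite tev_class //= -tmap_res -gres_comp cinK gres_id. Qed.
Lemma tev_var i : tev a (tvar i) = a i.
Proof. by rewrite tev_class //= -gres_comp cinK gres_id. Qed.
Lemma tev_add X (b b' : tquot X) : tev a (tadd b b') = tev a b + tev a b'.
Proof. by rewrite tev_class //= rmorphD. Qed.
Lemma tev_opp X (b : tquot X) : tev a (topp b) = - tev a b.
Proof. by rewrite tev_class //= rmorphN. Qed.
Lemma tev_mul X (b b' : tquot X) : tev a (tmul b b') = tev a b * tev a b'.
Proof. by rewrite tev_class //= rmorphM. Qed.
Lemma tev_res X Z (h : gmap X Z) (b : tquot Z) :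
  tev a (tres h b) = gres A h (tev a b).
Proof.
rewrite tev_class //= -gres_comp /cod -gcompA gres_comp -gcompA cinK gcomp_idr.
by rewrite -gres_comp gres_comp.
Qed.
Lemma tev_tr X Z (h : gmap X Z) (b : tquot X) :
  tev a (ttr h b) = gtr A h (tev a b).
Proof. by rewrite tev_class //= (gres_tr _ (cod_pb h)). Qed.
Lemma tev_nm X Z (h : gmap X Z) (b : tquot X) :
  tev a (tnorm h b) = tnm h (tev a b).
Proof. by rewrite tev_class //= (res_nm (cod_pb h)). Qed.
Lemma tev_lift c (t : term c) : tev a (tlift t) = eval a t.
Proof. by rewrite tev_class //= -gres_comp cinK gres_id. Qed.
Lemma tev_0 X : tev a (tconst (0 : k X)) = 0.
Proof. by rewrite tev_const rmorph0. Qed.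
Lemma tev_1 X : tev a (tconst (1 : k X)) = 1.
Proof. by rewrite tev_const rmorph1. Qed.

Definition tevE := (tev_0, tev_1, tev_const, tev_var, tev_add, tev_opp,
  tev_mul, tev_res, tev_tr, tev_nm, tev_lift).
End Ev.

Section Ring.
Variable X : gset.
Lemma taddA : associative (@tadd X).
Proof. by move=> b c d; apply: tev_sep => A a Ca; rewrite !(tevE Ca) addrA. Qed.
Lemma taddC : commutative (@tadd X).
Proof. by move=> b c; apply: tev_sep => A a Ca; rewrite !(tevE Ca) addrC. Qed.
Lemma tadd0 : left_id (tconst 0) (@tadd X).
Proof. by move=> b; apply: tev_sep => A a Ca; rewrite !(tevE Ca) add0r. Qed.
Lemma taddN : left_inverse (tconst 0) (@topp X) (@tadd X).
Proof. by move=> b; apply: tev_sep => A a Ca; rewrite !(tevE Ca) addNr. Qed.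
HB.instance Definition _ :=
  GRing.isZmodule.Build (tquot X) taddA taddC tadd0 taddN.

Lemma tmulA : associative (@tmul X).
Proof. by move=> b c d; apply: tev_sep => A a Ca; rewrite !(tevE Ca) mulrA. Qed.
Lemma tmulC : commutative (@tmul X).
Proof. by move=> b c; apply: tev_sep => A a Ca; rewrite !(tevE Ca) mulrC. Qed.
Lemma tmul1 : left_id (tconst 1) (@tmul X).
Proof. by move=> b; apply: tev_sep => A a Ca; rewrite !(tevE Ca) mul1r. Qed.
Lemma tmulDl : left_distributive (@tmul X) (@tadd X).
Proof.
by move=> b c d; apply: tev_sep => A a Ca; rewrite !(tevE Ca) mulrDl.
Qed.
HB.instance Definition _ :=
  GRing.Zmodule_isComPzRing.Build (tquot X) tmulA tmulC tmul1 tmulDl.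
End Ring.

Lemma tresD X Z (h : gmap X Z) : {morph tres h : b c / tadd b c}.
Proof. by move=> b c; apply: tev_sep => A a Ca; rewrite !(tevE Ca) rmorphD. Qed.
Lemma tresM X Z (h : gmap X Z) : {morph tres h : b c / tmul b c}.
Proof. by move=> b c; apply: tev_sep => A a Ca; rewrite !(tevE Ca) rmorphM. Qed.
Lemma tres1 X Z (h : gmap X Z) : tres h (tconst 1) = tconst 1.
Proof. by apply: tev_sep => A a Ca; rewrite !(tevE Ca) rmorph1. Qed.
Lemma ttrD X Z (h : gmap X Z) : {morph ttr h : b c / tadd b c}.
Proof. by move=> b c; apply: tev_sep => A a Ca; rewrite !(tevE Ca) raddfD. Qed.

Lemma term_mackey_axioms :
  @mackey_axioms gT (fun X => tquot X) (fun X Z h => @tres X Z h)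
    (fun X Z h => @ttr X Z h).
Proof.
split.
- by move=> X b; apply: tev_sep => A a Ca; rewrite !(tevE Ca) gres_id.
- by move=> X Z W g h b; apply: tev_sep => A a Ca; rewrite !(tevE Ca) gres_comp.
- by move=> X b; apply: tev_sep => A a Ca; rewrite !(tevE Ca) gtr_id.
- by move=> X Z W g h b; apply: tev_sep => A a Ca; rewrite !(tevE Ca) gtr_comp.
- move=> P A' B' C' a' b' f g pP b; apply: tev_sep => A a Ca.
  by rewrite !(tevE Ca) (gres_tr _ pP).
- move=> X X0 b; apply: tev_sep => A a Ca.
  rewrite [LHS](mackey0 (M := green_mackey A)) //.
  by rewrite [RHS](mackey0 (M := green_mackey A)).
- move=> X Z W i j ij; have [ii ji ijN] := coprod_inj ij.
  have jiN y x : j y <> i x by move/esym/ijN.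
  exists (fun m => tadd (ttr i m.1) (ttr j m.2)) => [b|[b b']] /=.
    apply: tev_sep => A a Ca; rewrite !(tevE Ca).
    exact: (coprod_split (M := green_mackey A)).
  congr (_, _); apply: tev_sep => A a Ca; rewrite !(tevE Ca) rmorphD.
    rewrite [X in X + _](mres_tr_inj (M := green_mackey A)) //.
    by rewrite [X in _ + X](mres_tr_disj (M := green_mackey A)) // addr0.
  rewrite [X in X + _](mres_tr_disj (M := green_mackey A)) //.
  by rewrite [X in _ + X](mres_tr_inj (M := green_mackey A)) // add0r.
Qed.

Definition term_green : green gT.
Proof.
apply: (@Green gT (fun X => tquot X)
  (fun X Z h => @pack_rmorphism (tquot Z) (tquot X) (tres h) (@tresD X Z h)
     (@tres1 X Z h) (@tresM X Z h))
  (fun X Z h => @pack_additive (tquot X) (tquot Z) (ttr h) (@ttrD X Z h))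
  term_mackey_axioms).
move=> X Z h b c; apply: tev_sep => A a Ca.
rewrite [LHS](tev_tr Ca) [X in gtr _ _ X](tev_mul Ca) [RHS](tev_mul Ca).
by rewrite [X in _ * X](tev_res Ca) (tev_tr Ca) frobenius.
Defined.

Definition term_tambara : tambara gT.
Proof.
apply: (@Tambara gT term_green tnorm).
- by move=> X Z h; apply: tev_sep => A a Ca; rewrite !(tevE Ca) nm_one.
- by move=> X Z h b c; apply: tev_sep => A a Ca; rewrite !(tevE Ca) nm_mul.
- by move=> X b; apply: tev_sep => A a Ca; rewrite !(tevE Ca) nm_id.
- by move=> X Z W g h b; apply: tev_sep => A a Ca; rewrite !(tevE Ca) nm_comp.
- move=> P A' B' C' a' b' f g pP b; apply: tev_sep => A a Ca.
  by rewrite !(tevE Ca) (res_nm pP).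
- move=> A' X Z Z' W q f e p pi E b; apply: tev_sep => A a Ca.
  by rewrite !(tevE Ca) (nm_tr E).
Defined.

Lemma tconst_add X : {morph @tconst X : x y / x + y}.
Proof. by move=> x y; apply: tev_sep => A a Ca; rewrite !(tevE Ca) rmorphD. Qed.
Lemma tconst_mul X : {morph @tconst X : x y / x * y}.
Proof. by move=> x y; apply: tev_sep => A a Ca; rewrite !(tevE Ca) rmorphM. Qed.

Definition term_str : tmap k term_tambara.
Proof.
apply: (@TMap gT k term_tambara (fun X => @pack_rmorphism (k X) (tquot X)
  (@tconst X) (@tconst_add X) erefl (@tconst_mul X))).
- by move=> X Z h x; apply: tev_sep => A a Ca; rewrite !(tevE Ca) tmap_res.
- by move=> X Z h x; apply: tev_sep => A a Ca; rewrite !(tevE Ca) tmap_tr.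
- by move=> X Z h x; apply: tev_sep => A a Ca; rewrite !(tevE Ca) tmap_nm.
Defined.

Definition term_alg : talg := TAlgebra term_str.

Lemma term_model (A : talg) (a : forall i, A (Y i)) :
  C a -> exists h : ahom term_alg A, forall X (b : tquot X), h X b = tev a b.
Proof.
move=> Ca.
pose h := @TMap gT term_tambara A (fun X => @pack_rmorphism (tquot X) (A X)
  (fun b => tev a b) (@tev_add A a Ca X) (tev_1 Ca X) (@tev_mul A a Ca X))
  (@tev_res A a Ca) (@tev_tr A a Ca) (@tev_nm A a Ca).
by exists (@AHom gT k term_alg A h (@tev_const A a Ca)).
Qed.

(** A class in level X is the restriction along [cin X] of the class of a term over [code X], so
    induction on terms over coded G-sets is enough. *)
Lemma tquot_ind (S : forall X, tquot X -> Prop) :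
    (forall X (x : k X), S X (tconst x)) -> (forall i, S (Y i) (tvar i)) ->
    (forall X (b c : tquot X), S X b -> S X c -> S X (tadd b c)) ->
    (forall X (b : tquot X), S X b -> S X (topp b)) ->
    (forall X (b c : tquot X), S X b -> S X c -> S X (tmul b c)) ->
    (forall X Z (h : gmap X Z) b, S Z b -> S X (tres h b)) ->
    (forall X Z (h : gmap X Z) b, S X b -> S Z (ttr h b)) ->
    (forall X Z (h : gmap X Z) b, S X b -> S Z (tnorm h b)) ->
  forall X b, S X b.
Proof.
move=> Sc Sv Sa So Sm Sr St Sn.
have lift c (t : term c) : S c (tlift t).
  elim: t => {c} [c x|c i h|c t IHt u IHu|c t IH|c t IHt u IHu|c d h t IH|
    c d h t IH|c d h t IH].
  - rewrite (_ : tlift _ = tconst x) //.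
    by apply: tev_sep => A a Ca; rewrite !(tevE Ca).
  - rewrite (_ : tlift _ = tres h (tvar i)); first exact/Sr/Sv.
    by apply: tev_sep => A a Ca; rewrite !(tevE Ca).
  - rewrite (_ : tlift _ = tadd (tlift t) (tlift u)); first exact: Sa.
    by apply: tev_sep => A a Ca; rewrite !(tevE Ca).
  - rewrite (_ : tlift _ = topp (tlift t)); first exact: So.
    by apply: tev_sep => A a Ca; rewrite !(tevE Ca).
  - rewrite (_ : tlift _ = tmul (tlift t) (tlift u)); first exact: Sm.
    by apply: tev_sep => A a Ca; rewrite !(tevE Ca).
  - rewrite (_ : tlift _ = tres h (tlift t)); first exact: Sr.
    by apply: tev_sep => A a Ca; rewrite !(tevE Ca).
  - rewrite (_ : tlift _ = ttr h (tlift t)); first exact: St.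
    by apply: tev_sep => A a Ca; rewrite !(tevE Ca).
  - rewrite (_ : tlift _ = tnorm h (tlift t)); first exact: Sn.
    by apply: tev_sep => A a Ca; rewrite !(tevE Ca).
move=> X b; rewrite (_ : b = tres (cin X) (tlift (trepr b))).
  exact/Sr/lift.
by apply: tev_sep => A a Ca; rewrite !(tevE Ca).
Qed.

End Terms.

(** * Generators, free algebras and surjectivity of coequalizers *)

Section Generation.
Variables (gT : finGroupType) (k : tambara gT).
Local Notation talg := (talgebra k).

Record closed_family (A : tambara gT) (S : forall X, A X -> Prop) : Prop :=
    ClosedFamily {
  closed_add : forall X (x y : A X), S X x -> S X y -> S X (x + y);
  closed_opp : forall X (x : A X), S X x -> S X (- x);
  closed_mul : forall X (x y : A X), S X x -> S X y -> S X (x * y);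
  closed_res : forall X Z (h : gmap X Z) (x : A Z), S Z x -> S X (gres A h x);
  closed_tr : forall X Z (h : gmap X Z) (x : A X), S X x -> S Z (gtr A h x);
  closed_nm : forall X Z (h : gmap X Z) (x : A X), S X x -> S Z (tnm h x) }.

Definition generated (I : Type) (Y : I -> gset gT) (A : talg)
    (a : forall i, A (Y i)) : Prop :=
  forall S : forall X, A X -> Prop, closed_family S ->
    (forall X (x : k X), S X (astr A X x)) -> (forall i, S (Y i) (a i)) ->
  forall X x, S X x.

(** Freeness over an arbitrary index type, which allows generators indexed by a sum; [free_on_ord]
    returns to ordinals. *)
Definition free_on (I : Type) (Y : I -> gset gT) (P : talg)
    (x : forall i, P (Y i)) : Prop :=
  forall (A : talg) (a : forall i, A (Y i)),
    exists h : ahom P A, (forall i, h (Y i) (x i) = a i) /\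
      (forall h' : ahom P A, (forall i, h' (Y i) (x i) = a i) ->
        forall X (p : P X), h' X p = h X p).

Lemma image_closed (A B : tambara gT) (h : tmap A B) :
  closed_family (fun X (y : B X) => exists x, h X x = y).
Proof.
split.
- by move=> X _ _ [x <-] [y <-]; exists (x + y); rewrite rmorphD.
- by move=> X _ [x <-]; exists (- x); rewrite rmorphN.
- by move=> X _ _ [x <-] [y <-]; exists (x * y); rewrite rmorphM.
- by move=> X Z u _ [x <-]; exists (gres A u x); rewrite tmap_res.
- by move=> X Z u _ [x <-]; exists (gtr A u x); rewrite tmap_tr.
- by move=> X Z u _ [x <-]; exists (tnm u x); rewrite tmap_nm.
Qed.

Lemma equalizer_closed (A B : tambara gT) (h h' : tmap A B) :
  closed_family (fun X (x : A X) => h X x = h' X x).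
Proof.
split.
- by move=> X x y; rewrite !rmorphD => -> ->.
- by move=> X x; rewrite !rmorphN => ->.
- by move=> X x y; rewrite !rmorphM => -> ->.
- by move=> X Z u x; rewrite !tmap_res => ->.
- by move=> X Z u x; rewrite !tmap_tr => ->.
- by move=> X Z u x; rewrite !tmap_nm => ->.
Qed.

Lemma preimage_closed (A B : tambara gT) (h : tmap A B) S :
  closed_family S -> closed_family (fun X (x : A X) => S X (h X x)).
Proof.
case=> s1 s2 s3 s4 s5 s6; split.
- by move=> X x y; rewrite rmorphD; exact: s1.
- by move=> X x; rewrite rmorphN; exact: s2.
- by move=> X x y; rewrite rmorphM; exact: s3.
- by move=> X Z u x; rewrite tmap_res; exact: s4.
- by move=> X Z u x; rewrite tmap_tr; exact: s5.
- by move=> X Z u x; rewrite tmap_nm; exact: s6.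
Qed.

Lemma generated_ext (I : Type) (Y : I -> gset gT) (A B : talg)
    (a : forall i, A (Y i)) (h h' : ahom A B) :
  generated a -> (forall i, h (Y i) (a i) = h' (Y i) (a i)) ->
  forall X x, h X x = h' X x.
Proof.
move=> ga e; apply: (ga _ (equalizer_closed h h')) => // X x.
by rewrite !ahom_str.
Qed.

Definition aid (A : talg) : ahom A A :=
  @AHom gT k A A (tid A) (fun X c => erefl).

Definition acomp (A B D : talg) (h' : ahom B D) (h : ahom A B) : ahom A D.
Proof.
by apply: (@AHom gT k A D (tcomp h' h)) => X c; rewrite /= !ahom_str.
Defined.

Lemma term_alg_generated (I : finType) (Y : I -> gset gT) C :
  generated (A := @term_alg gT k I Y C) (@tvar gT k I Y C).
Proof.
by move=> S [s1 s2 s3 s4 s5 s6] Sc Sv; apply: (@tquot_ind gT k I Y C).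
Qed.

Lemma free_exists (I : finType) (Y : I -> gset gT) :
  exists (P : talg) (x : forall i, P (Y i)), free_on x /\ generated x.
Proof.
pose C (A : talg) (a : forall i, A (Y i)) := True.
exists (term_alg C), (tvar C); split=> [A a|]; last exact: term_alg_generated.
have [h hE] := @term_model gT k I Y C A a Logic.I.
have hv i : h (Y i) (tvar C i) = a i by rewrite hE tev_var.
exists h; split=> // h' h'v.
apply: (generated_ext (@term_alg_generated I Y C)) => i; by rewrite h'v hv.
Qed.

(** The models are the pairs (B, b) that have every property of (A, a), a Leibniz form of equality
    that avoids equations between dependent pairs. Terms are then identified exactly when their
    values in A agree, which makes evaluation injective. *)
Lemma subalgebra_exists (I : finType) (Y : I -> gset gT) (A : talg)
    (a : forall i, A (Y i)) :
  exists (P : talg) (x : forall i, P (Y i)) (h : ahom P A),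
    [/\ generated x, forall i, h (Y i) (x i) = a i & forall X, injective (h X)].
Proof.
pose C (B : talg) (b : forall i, B (Y i)) :=
  forall S : (forall B : talg, (forall i, B (Y i)) -> Prop), S A a -> S B b.
have Ca : C A a by move=> S.
have [h hE] := @term_model gT k I Y C A a Ca.
exists (term_alg C), (tvar C), h; split=> [|i|X b b' e].
- exact: term_alg_generated.
- by rewrite hE tev_var.
- rewrite !hE in e; apply: tev_sep => B b0 Cb.
  exact: (Cb (fun B b0 => tev b0 b = tev b0 b')).
Qed.

(** Let F be the subalgebra generated by x. Freeness gives a map from P to F, and its composite with
    the inclusion is the identity by uniqueness. Hence every element of P comes from F. *)
Lemma free_generated (I : finType) (Y : I -> gset gT) (P : talg)
    (x : forall i, P (Y i)) : free_on x -> generated x.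
Proof.
move=> fx S Scl Sc Sv.
have [F [y [h [gy hy hi]]]] := subalgebra_exists x.
have [u [uE _]] := fx F y; have [v [_ vU]] := fx P x.
have hu X (p : P X) : h X (u X p) = p.
  have -> : h X (u X p) = v X p.
    by apply: (vU (acomp h u)) => i /=; rewrite uE hy.
  by symmetry; apply: (vU (aid P)).
move=> X p; rewrite -(hu X p).
apply: (gy _ (preimage_closed h Scl)) => [Z c|i]; first by rewrite ahom_str.
by rewrite hy.
Qed.

(** The subalgebra F of A generated by the images of the generators also coequalizes the pair,
    because it embeds in A. The induced map from A to F splits the inclusion, so F is all of A, and
    F lies in the image of c. *)
Lemma coequalizer_surj (I : finType) (Y : I -> gset gT) (P Q A : talg)
    (y : forall i, P (Y i)) (a b : ahom Q P) (c : ahom P A) :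
  free_on y -> is_coequalizer a b c -> forall X x, exists p, c X p = x.
Proof.
move=> fy [cab uni].
have [F [x [h [gx hx hi]]]] := subalgebra_exists (fun i => c (Y i) (y i)).
have [u [uE _]] := fy F x; have [v [_ vU]] := fy A (fun i => c (Y i) (y i)).
have hu X (p : P X) : h X (u X p) = c X p.
  have -> : h X (u X p) = v X p.
    by apply: (vU (acomp h u)) => i /=; rewrite uE hx.
  by symmetry; apply: vU.
have [X q|w [wE _]] := uni F u; first by apply: hi; rewrite !hu.
have [w' [_ w'U]] := uni A c cab.
have hw X (z : A X) : h X (w X z) = z.
  have -> : h X (w X z) = w' X z.
    by apply: (w'U (acomp h w)) => Z p /=; rewrite wE hu.
  by symmetry; apply: (w'U (aid A)).
move=> X z; rewrite -(hw X z).
suff S : forall Z (t : F Z), exists p, c Z p = h Z t by exact: S.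
apply: gx.
- exact: (preimage_closed h (image_closed c)).
- by move=> Z s; exists (astr P Z s); rewrite !ahom_str.
- by move=> i; exists (y i); rewrite hx.
Qed.

Lemma free_on_ord (I : finType) (Y : I -> gset gT) (P : talg)
    (x : forall i, P (Y i)) : free_on x ->
  is_free_talgebra (fun j : 'I_#|I| => x (enum_val j)).
Proof.
move=> fx A a.
pose a' i : A (Y i) :=
  eq_rect _ (fun i => A (Y i) : Type) (a (enum_rank i)) _ (enum_rankK i).
have a'E j : a' (enum_val j) = a j.
  rewrite /a'; move: (enum_rankK _); rewrite enum_valK => e.
  by rewrite (Prop_irrelevance e erefl).
have [h [hE hU]] := fx A a'.
exists h; split=> [j|h' h'E]; first by rewrite hE a'E.
apply: hU => i; rewrite /a'; move: (enum_rank i) (enum_rankK i) => j e.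
by case: _ / e; rewrite /= h'E.
Qed.

End Generation.

(** * Composition of finite presentations and the theorem *)

Section Composition.
Variables (gT : finGroupType) (k R S : tambara gT).
Variables (f : tmap k R) (g : tmap R S).

Definition base_alg (A : talgebra R) : talgebra k :=
  TAlgebra (tcomp (astr A) f).

Definition sum_elim (I J : Type) (T : I + J -> Type) (a : forall i, T (inl i))
    (b : forall j, T (inr j)) (s : I + J) : T s :=
  match s with inl i => a i | inr j => b j end.

Lemma finitely_presented_comp :
  finitely_presented g -> finitely_presented f ->
  finitely_presented (tcomp g f).
Proof.
move=> [n1 [Y1 [P1 [y1 [m1 [Z1 [Q1 [z1 [a1 [b1 [c1 [fy1 fz1 cq1]]]]]]]]]]]].
move=> [n0 [Y0 [P0 [y0 [m0 [Z0 [Q0 [z0 [a0 [b0 [c0 [fy0 fz0 cq0]]]]]]]]]]]].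
pose I := ('I_n0 + 'I_n1)%type; pose J := ('I_m0 + 'I_m1)%type.
pose Y (i : I) := match i with inl i => Y0 i | inr i => Y1 i end.
pose Z (j : J) := match j with inl j => Z0 j | inr j => Z1 j end.
have [P [y [fy gy]]] := free_exists k Y.
have [Q [z [fz gz]]] := free_exists k Z.
have [[c0ab c0U] [c1ab c1U]] := (cq0, cq1).
have c0S := coequalizer_surj fy0 cq0; have c1S := coequalizer_surj fy1 cq1.
have [iota [iotaE _]] := fy0 P (fun i => y (inl i)).
(* The comparison map from k[Y0, Y1] to R[Y1]: generators of R go to their values in R, those of S
   to themselves. *)
have [phi [phiE _]] := fy (base_alg P1) (sum_elim
  (T := fun i => base_alg P1 (Y i))
  (fun i => astr P1 _ (c0 (Y0 i) (y0 i))) y1).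
have phi_iota X (p : P0 X) : phi X (iota X p) = astr P1 X (c0 X p).
  move: X p; apply: (free_generated fy0 (equalizer_closed (tcomp phi iota)
    (tcomp (astr P1) c0))) => [X c|i] /=.
    by rewrite (ahom_str iota) (ahom_str c0) [LHS](ahom_str phi).
  by rewrite iotaE [LHS](phiE (inl i)).
have phiS : forall X (p : P1 X), exists p', phi X p' = p.
  apply: (free_generated fy1 (image_closed phi)) => [X r|i].
    by have [p <-] := c0S X r; exists (iota X p); rewrite phi_iota.
  by exists (y (inr i)); exact: (phiE (inr i)).
(* A set-theoretic section of [phi] at each level. No compatibility with the operations is needed,
   as it only serves to choose preimages of relators and of elements. *)
have [lift liftE] :
    exists u : (forall X, P1 X -> P X), forall X p, phi X (u X p) = p.
  exists (fun X p => projT1 (cid (phiS X p))) => X p.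
  by case: (cid _).
have [a [aE _]] := fz P (sum_elim (T := fun j => P (Z j))
  (fun j => iota _ (a0 _ (z0 j))) (fun j => lift _ (a1 _ (z1 j)))).
have [b [bE _]] := fz P (sum_elim (T := fun j => P (Z j))
  (fun j => iota _ (b0 _ (z0 j))) (fun j => lift _ (b1 _ (z1 j)))).
pose c : ahom P (TAlgebra (tcomp g f)) :=
  @AHom gT k P (TAlgebra (tcomp g f)) (tcomp c1 phi)
    (fun X s => etrans (congr1 (c1 X) (ahom_str phi s)) (ahom_str c1 (f X s))).
have cS X (x : S X) : exists p, c X p = x.
  by have [p <-] := c1S X x; exists (lift X p); rewrite /= liftE.
exists #|{: I}|, (fun i => Y (enum_val i)), P, (fun i => y (enum_val i)).
exists #|{: J}|, (fun j => Z (enum_val j)), Q, (fun j => z (enum_val j)).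
exists a, b, c.
split; [exact: free_on_ord|exact: free_on_ord|split].
  apply: (gz _ (equalizer_closed (tcomp c a) (tcomp c b))) => [X s|[j|j]] /=.
  - by rewrite (ahom_str a) (ahom_str b).
  - by rewrite (aE (inl j)) (bE (inl j)) /= !phi_iota c0ab.
  - by rewrite (aE (inr j)) (bE (inr j)) /= !liftE c1ab.
move=> B h hab.
(* On k[Y0] the map [h] respects the relators of R, so it descends to a map [rho] from R to B. This
   makes B an R-algebra, against which the presentation of S over R can be used. *)
have [X q|rho [rhoE _]] := c0U B (acomp h iota).
  move: X q; apply: (free_generated fz0 (equalizer_closed
    (tcomp (tcomp h iota) a0) (tcomp (tcomp h iota) b0))) => [X s|j] /=.
    by rewrite (ahom_str a0) (ahom_str b0).
  by have := hab _ (z (inl j)); rewrite (aE (inl j)) (bE (inl j)).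
pose B' : talgebra R := TAlgebra rho.
have [theta [thetaE _]] := fy1 B' (fun i => h (Y1 i) (y (inr i))).
have theta_phi : forall X (p : P X), theta X (phi X p) = h X p.
  apply: (gy _ (equalizer_closed (tcomp theta phi) h)) => [X s|[i|i]] /=.
  - rewrite (ahom_str phi) (ahom_str h) /= [LHS](ahom_str theta) /=.
    exact: (ahom_str rho).
  - by rewrite (phiE (inl i)) /= [LHS](ahom_str theta) /= rhoE /= iotaE.
  - by rewrite (phiE (inr i)) /= thetaE.
(* Since h = theta phi, the relation imposed on [h] by a lifted relator says that [theta] respects
   the original relator over R. *)
have [X q|w [wE _]] := c1U B' theta.
  move: X q; apply: (free_generated fz1 (equalizer_closed
    (tcomp theta a1) (tcomp theta b1))) => [X s|j] /=.
    by rewrite (ahom_str a1) (ahom_str b1).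
  have := hab _ (z (inr j)).
  by rewrite (aE (inr j)) (bE (inr j)) /= -!theta_phi !liftE.
have wstr X (s : k X) : w X (tcomp g f X s) = astr B X s.
  by rewrite [LHS](ahom_str w (f X s)) [LHS](ahom_str rho).
exists (@AHom gT k (TAlgebra (tcomp g f)) B w wstr).
split=> [X p|h'' h''E X x] /=.
  by rewrite wE theta_phi.
by have [p <-] := cS X x; rewrite h''E /= wE theta_phi.
Qed.

End Composition.

Theorem proposition4p1 (gT : finGroupType) (k R S : tambara gT)
    (f : tmap k R) (g : tmap R S) :
  (finitely_presented g -> finitely_presented f ->
     finitely_presented (tcomp g f)) /\
  (flat g -> flat f -> flat (tcomp g f)) /\
  (kahler_zero g -> kahler_zero f -> kahler_zero (tcomp g f)) /\
  (etale f -> etale g -> etale (tcomp g f)).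
Proof.
do 3 (split; first by [exact: finitely_presented_comp|exact: flat_comp|
  exact: kahler_zero_comp]).
move=> [[ff kf] pf] [[fg kg] pg]; split; last exact: finitely_presented_comp.
by split; [exact: flat_comp|exact: kahler_zero_comp].
Qed.
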